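(* Let $M$ be a complete simply-connected Riemannian manifold which admits an irrotational nowhere-zero Killing vector field $K$. Then every compact minimal submanifold of $M$ is contained in a leaf of the foliation $K^\perp$.
   Context: A Killing vector field $K$ is irrotational if the distribution $K^\perp$ orthogonal to $K$ is integrable; $K^\perp$ also denotes the resulting foliation by its maximal integral leaves. Submanifolds are immersed, connected, of dimension at least one, and compact submanifolds have no boundary. A submanifold is minimal if its mean curvature vector field vanishes identically. ''Contained in'' refers to the image of the immersion. *)

(* Defs.v *)
(* MathComp-Analysis, over an arbitrary realType.

   Smooth manifolds are given by an atlas modelled on R^n = 'rV[R]_n, and
   tensor fields by their components in each chart together with the
   transformation law under change of chart.  Vectors are row vectors, in line
   with the library's Jacobian: 'd f x v = v *m 'J f x, so that
   ('J f x) i j is the i-th partial derivative of the j-th component of f. *)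
From HB Require Import structures.
From mathcomp Require Import all_boot all_order all_algebra.
From mathcomp Require Import all_classical all_reals all_analysis.

Set Implicit Arguments.
Unset Strict Implicit.
Unset Printing Implicit Defensive.

Import Order.TTheory GRing.Theory Num.Theory numFieldNormedType.Exports.

Local Open Scope classical_set_scope.
Local Open Scope ring_scope.

Section Smoothness.
Context {R : realType} {m : nat} {V : normedModType R}.

Definition partial (i : 'I_m) (f : 'rV[R]_m -> V) (x : 'rV[R]_m) : V :=
  'D_(delta_mx 0 i) f x.

(* f is only constrained on U, which is open in all uses. *)
Fixpoint Ck (k : nat) (U : set 'rV[R]_m) (f : 'rV[R]_m -> V) : Prop :=
  (forall x, U x -> {for x, continuous f}) /\
  if k is k'.+1 then
    forall i : 'I_m, (forall x, U x -> derivable f x (delta_mx 0 i)) /\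
                     Ck k' U (partial i f)
  else True.

Definition smooth_on (U : set 'rV[R]_m) (f : 'rV[R]_m -> V) : Prop :=
  forall k, Ck k U f.

End Smoothness.

(* Charts are homeomorphisms between open sets, represented by total functions
   whose values outside chart_dom c, resp. its image, are irrelevant.
   The atlas need not be maximal. *)
Record manifold (R : realType) (n : nat) := Manifold {
  points :> topologicalType ;
  chart_index : Type ;
  chart_dom : chart_index -> set points ;
  chart : chart_index -> points -> 'rV[R]_n ;
  chart_inv : chart_index -> 'rV[R]_n -> points ;
  manifold_hausdorff : hausdorff_space points ;
  manifold_second_countable : @second_countable points ;
  chart_cover : forall p, exists c, chart_dom c p ;
  chart_dom_open : forall c, open (chart_dom c) ;
  chart_img_open : forall c, open (chart c @` chart_dom c) ;
  chartK : forall c p, chart_dom c p -> chart_inv c (chart c p) = p ;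
  chart_continuous : forall c p, chart_dom c p ->
    {for p, continuous (chart c)} ;
  chart_inv_continuous : forall c x, (chart c @` chart_dom c) x ->
    {for x, continuous (chart_inv c)} ;
  transition_smooth : forall c d,
    smooth_on (chart c @` (chart_dom c `&` chart_dom d))
              (chart d \o chart_inv c)
}.

Section Maps.
Context {R : realType} {m n : nat} {N : manifold R m} {M : manifold R n}.
Implicit Types (f : N -> M) (c : chart_index N) (d : chart_index M).

Definition rep_dom f c d : set 'rV[R]_m :=
  chart c @` (chart_dom c `&` f @^-1` chart_dom d).

Definition rep f c d : 'rV[R]_m -> 'rV[R]_n :=
  chart d \o f \o chart_inv c.

Definition smooth_map f : Prop :=
  continuous f /\ forall c d, smooth_on (rep_dom f c d) (rep f c d).

Definition immersion f : Prop :=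
  smooth_map f /\
  forall c d x, rep_dom f c d x -> row_free ('J (rep f c d) x).

(* An immersed connected submanifold is N together with the map f. *)
Definition submanifold f : Prop :=
  [/\ [set: N] !=set0, connected [set: N] & immersion f].

End Maps.

Section SimplyConnected.
Context {R : realType} {n : nat}.

Definition simply_connected (M : manifold R n) : Prop :=
  let I := `[0 : R, 1]%classic in
  [/\ [set: M] !=set0,
      forall p q : M, exists gamma : R -> M,
        [/\ {within I, continuous gamma}, gamma 0 = p & gamma 1 = q] &
      forall gamma : R -> M, {within I, continuous gamma} ->
        gamma 0 = gamma 1 ->
        exists H : R * R -> M,
          [/\ {within I `*` I, continuous H},
              forall t, I t -> H (0, t) = gamma t,
              forall t, I t -> H (1, t) = gamma 0 &
              forall s, I s -> H (s, 0) = gamma 0 /\ H (s, 1) = gamma 0]].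

End SimplyConnected.

Section Tensors.
Context {R : realType} {n : nat} (M : manifold R n).

Definition chart_img (c : chart_index M) : set 'rV[R]_n :=
  chart c @` chart_dom c.

(* rep_dom idfun c d and rep idfun c d are the domain of the change of
   coordinates from c to d, and that change of coordinates. *)
Record vector_field := VectorField {
  vf_comp :> chart_index M -> 'rV[R]_n -> 'rV[R]_n ;
  vf_smooth : forall c, smooth_on (chart_img c) (vf_comp c) ;
  vf_transform : forall c d x, rep_dom idfun c d x ->
    vf_comp d (rep idfun c d x) = vf_comp c x *m 'J (rep idfun c d) x
}.

Record riemannian_metric := RiemannianMetric {
  metric_comp :> chart_index M -> 'rV[R]_n -> 'M[R]_n ;
  metric_smooth : forall c, smooth_on (chart_img c) (metric_comp c) ;
  metric_sym : forall c x, chart_img c x ->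
    (metric_comp c x)^T = metric_comp c x ;
  metric_posdef : forall c x, chart_img c x ->
    forall v : 'rV[R]_n, v != 0 -> 0 < (v *m metric_comp c x *m v^T) 0 0 ;
  metric_transform : forall c d x, rep_dom idfun c d x ->
    metric_comp c x =
    'J (rep idfun c d) x *m metric_comp d (rep idfun c d x)
      *m ('J (rep idfun c d) x)^T
}.

End Tensors.

Section Geometry.
Context {R : realType} {n : nat} {M : manifold R n}.
Variable g : riemannian_metric M.

(* christoffel d x i j is the component vector of the Levi-Civita derivative
   of the coordinate field e_j along e_i:
   Gamma^k_ij = 1/2 g^kl (d_i g_jl + d_j g_il - d_l g_ij). *)
Definition christoffel (d : chart_index M) (x : 'rV[R]_n) (i j : 'I_n) :
    'rV[R]_n :=
  \row_k (2^-1 * \sum_(l < n) invmx (g d x) k l *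
    (partial i (g d) x j l + partial j (g d) x i l - partial l (g d) x i j)).

Definition christoffel_form (d : chart_index M) (x u v : 'rV[R]_n) :
    'rV[R]_n :=
  \sum_(i < n) \sum_(j < n) (u 0 i * v 0 j) *: christoffel d x i j.

Definition geodesic (gamma : R -> M) : Prop :=
  continuous gamma /\
  forall d t, chart_dom d (gamma t) ->
    let u : R -> 'rV[R]_n := chart d \o gamma in
    [/\ derivable u t 1, derivable (derive1 u) t 1 &
        derive1 (derive1 u) t
          + christoffel_form d (u t) (derive1 u t) (derive1 u t) = 0].

(* Geodesic completeness: the solution with any initial point and velocity is
   defined on all of R. *)
Definition complete_metric : Prop :=
  forall (p : M) (d : chart_index M) (v : 'rV[R]_n), chart_dom d p ->
    exists gamma : R -> M,
      [/\ geodesic gamma, gamma 0 = p & derive1 (chart d \o gamma) 0 = v].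

Variable K : vector_field M.

Definition nowhere_zero : Prop := forall c x, chart_img c x -> K c x != 0.

(* The left-hand side is the Lie derivative of g along K:
   (L_K g)_ij = K^l d_l g_ij + (d_i K^l) g_lj + g_il (d_j K^l). *)
Definition killing : Prop :=
  forall c x, chart_img c x ->
    'D_(K c x) (g c) x + 'J (K c) x *m g c x + g c x *m ('J (K c) x)^T = 0.

(* As dim N = n - 1 and f is an immersion, tangency to the orthogonal
   complement of K (which has rank n - 1 where K is nonzero) says that the
   tangent spaces of N are the fibres of that complement. *)
Definition integral_manifold (N : manifold R n.-1) (f : N -> M) : Prop :=
  [/\ submanifold f, injective f &
      forall c d x, rep_dom f c d x ->
        'J (rep f c d) x *m g d (rep f c d x) *m (K d (rep f c d x))^T = 0].

(* Integrability of the distribution orthogonal to K. *)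
Definition irrotational : Prop :=
  forall p : M, exists (N : manifold R n.-1) (f : N -> M),
    integral_manifold f /\ range f p.

Definition leaf (L : set M) : Prop :=
  (exists (N : manifold R n.-1) (f : N -> M),
     integral_manifold f /\ range f = L) /\
  forall (N : manifold R n.-1) (f : N -> M),
    integral_manifold f -> L `<=` range f -> range f `<=` L.

End Geometry.

Section Minimal.
Context {R : realType} {k n : nat} {N : manifold R k} {M : manifold R n}.
Variables (g : riemannian_metric M) (f : N -> M).
Variables (c : chart_index N) (d : chart_index M) (x : 'rV[R]_k).

Let F := rep f c d.
Let J := 'J F x.
Let G := g d (F x).

Definition induced_metric : 'M[R]_k := J *m G *m J^T.

(* v *m normal_proj is the g-orthogonal projection of v to the normal space. *)
Definition normal_proj : 'M[R]_n :=
  1%:M - G *m J^T *m invmx induced_metric *m J.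

(* Normal part of the Levi-Civita derivative along f of the pushforward of the
   coordinate field e_b in the direction e_a. *)
Definition second_fundamental_form (a b : 'I_k) : 'rV[R]_n :=
  (partial a (partial b F) x + christoffel_form g d (F x) (row a J) (row b J))
    *m normal_proj.

(* Trace of the second fundamental form, not divided by k. *)
Definition mean_curvature : 'rV[R]_n :=
  \sum_(a < k) \sum_(b < k)
    invmx induced_metric a b *: second_fundamental_form a b.

End Minimal.

Definition minimal (R : realType) (k n : nat) (N : manifold R k)
    (M : manifold R n) (g : riemannian_metric M) (f : N -> M) : Prop :=
  forall c d x, rep_dom f c d x -> mean_curvature g f c d x = 0.

(* Main.v *)
(* Let w be the 1-form dual to K and theta = w / |K|^2.  The Killing equation
   together with the integrability of the orthogonal distribution makes theta
   closed, so that on the simply connected M it has a potential h, without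
   critical points; K is orthogonal exactly to the kernel of dh.  By the Killing
   equation the Hessian of h is, up to a constant factor, the symmetric product of
   d|K|^2 / |K|^2 with dh, hence along a minimal immersion f the function h o f
   satisfies a linear elliptic equation without zeroth order term.  On a compact
   connected manifold the strong maximum principle forces h o f to be constant,
   so that f maps into a connected component of a level set of h, and these
   components are the leaves. *)
Require Import Defs.
From HB Require Import structures.
From mathcomp Require Import all_boot all_order all_algebra.
From mathcomp Require Import all_classical all_reals all_analysis.
From mathcomp Require Import perm ring lra.
Set Implicit Arguments.
Unset Strict Implicit.
Unset Printing Implicit Defensive.
Import Order.TTheory GRing.Theory Num.Theory numFieldNormedType.Exports.
Local Open Scope classical_set_scope.
Local Open Scope ring_scope.

(** * Calculus of C^k maps on R^m *)

(** The form theta is normalised by theta(K) = 1. For the dual form w itself the Killing equation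
    only gives that its symmetrised covariant derivative vanishes and that contracting dw with K
    yields -d|K|^2; dividing by |K|^2 corrects exactly this defect. In the Hessian of h every
    surviving term carries a factor dh, whose restriction to N is the differential of h o f: hence
    no zeroth order and no inhomogeneous term. In coordinates the first order part has a second
    source, the tangential part of the trace of the second derivatives of f. Two points shape the
    development. Paths and homotopies are merely continuous, so theta is not integrated along them;
    local primitives are continued along the maps instead, in an abstract setting which only knows
    that primitives exist locally and are locally unique up to a constant. And a leaf has to be the
    image of a manifold with an atlas, so a component of a level set must be given one, with the
    implicit function theorem providing the charts; its maximality then follows because h is
    constant on every integral manifold. *)

Section CkBasic.
Context {R : realType} {m : nat} {V : normedModType R}.
Implicit Types (U : set 'rV[R]_m) (f g : 'rV[R]_m -> V).

Lemma Ck_continuous k U f x : Ck k U f -> U x -> {for x, continuous f}.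
Proof. by case: k => [|k] [cf _] Ux; exact: cf. Qed.

Lemma CkW k U f : Ck k.+1 U f -> Ck k U f.
Proof.
elim: k f => [|k IH] f [cf df]; first by split.
by split=> // i; have [dfi Cfi] := df i; split=> //; exact: IH.
Qed.

Lemma Ck_le k l U f : (k <= l)%N -> Ck l U f -> Ck k U f.
Proof.
elim: l => [|l IH]; first by rewrite leqn0 => /eqP ->.
by rewrite leq_eqVlt => /orP[/eqP -> //|kl /CkW]; exact: IH.
Qed.

Lemma Ck_subset k U W f : W `<=` U -> Ck k U f -> Ck k W f.
Proof.
move=> WU; elim: k f => [|k IH] f [cf df]; split.
- by move=> x /WU; exact: cf.
- by [].
- by move=> x /WU; exact: cf.
- by move=> i; have [dfi Cfi] := df i; split; [move=> x /WU; exact: dfi|exact: IH].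
Qed.

Lemma eq_continuous_at (T S : topologicalType) (f g : T -> S) x :
  (\near x, f x = g x) -> {for x, continuous f} -> {for x, continuous g}.
Proof.
move=> fg; rewrite /prop_for /continuous_at (nbhs_singleton fg).
by apply: cvg_trans; apply: near_eq_cvg; move: fg; apply: filterS => y /esym.
Qed.

(** Openness is what lets equality on [U] pass to partial derivatives: they depend on values near a
    point, and these are all taken in [U]. *)
Lemma eq_Ck k U f g : open U -> (forall x, U x -> f x = g x) ->
  Ck k U f -> Ck k U g.
Proof.
move=> oU; elim: k f g => [|k IH] f g fg [cf df].
  split=> // x Ux; apply: eq_continuous_at (cf _ Ux).
  by apply: filterS (open_nbhs_nbhs (conj oU Ux)).
have nfg x : U x -> \near x, f x = g x.
  by move=> Ux; apply: filterS (open_nbhs_nbhs (conj oU Ux)).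
split=> [x Ux|i]; first exact: eq_continuous_at (nfg _ Ux) (cf _ Ux).
have [dfi Cfi] := df i; split.
  by move=> x Ux; apply: near_eq_derivable (nfg _ Ux) (dfi _ Ux).
by apply: IH Cfi => x Ux; apply: near_eq_derive; exact: nfg.
Qed.

Lemma Ck_partial k U f i : Ck k.+1 U f -> Ck k U (partial i f).
Proof. by move=> [_ /(_ i)[]]. Qed.

Lemma Ck_derivable k U f i x : Ck k.+1 U f -> U x ->
  derivable f x (delta_mx 0 i).
Proof. by move=> [_ /(_ i)[df _]] Ux; exact: df. Qed.

Lemma Ck_cst k U (a : V) : Ck k U (fun=> a).
Proof.
elim: k a => [|k IH] a; split=> //; try by move=> x _; exact: cst_continuous.
move=> i; split=> [x _|]; first exact: derivable_cst.
rewrite (_ : partial i _ = fun=> 0); first exact: IH.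
by apply/funext => x; rewrite /partial derive_cst.
Qed.

Lemma CkD k U f g : open U -> Ck k U f -> Ck k U g -> Ck k U (f \+ g).
Proof.
move=> oU; elim: k f g => [|k IH] f g [cf df] [cg dg]; split=> //.
- by move=> x Ux; apply: continuousD; [exact: cf|exact: cg].
- by move=> x Ux; apply: continuousD; [exact: cf|exact: cg].
move=> i; have [dfi Cfi] := df i; have [dgi Cgi] := dg i; split.
  by move=> x Ux; apply: derivableD; [exact: dfi|exact: dgi].
apply: eq_Ck (IH _ _ Cfi Cgi) => // x Ux.
by rewrite /partial /= -[_ \+ _]/(f + g) deriveD; [|exact: dfi|exact: dgi].
Qed.

Lemma Ck_sum (I : Type) (r : seq I) k U (F : I -> 'rV[R]_m -> V) : open U ->
  (forall i, Ck k U (F i)) -> Ck k U (fun x => \sum_(i <- r) F i x).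
Proof.
move=> oU CF; elim: r => [|i r IH].
  by apply: eq_Ck (Ck_cst k U 0) => // x _; rewrite big_nil.
by apply: eq_Ck (CkD oU (CF i) IH) => // x _; rewrite big_cons.
Qed.

End CkBasic.

Section CkScalar.
Context {R : realType} {m : nat}.
Implicit Types (U : set 'rV[R]_m) (f g : 'rV[R]_m -> R).

Lemma CkM k U f g : open U -> Ck k U f -> Ck k U g -> Ck k U (f \* g).
Proof.
move=> oU; elim: k f g => [|k IH] f g Cf Cg.
  split=> // x Ux; apply: continuousM; [exact: Ck_continuous Cf Ux|
  exact: Ck_continuous Cg Ux].
split=> [x Ux|i].
  by apply: continuousM; [exact: Ck_continuous Cf Ux|exact: Ck_continuous Cg Ux].
split=> [x Ux|].
  by apply: derivableM; [exact: Ck_derivable Cf Ux|exact: Ck_derivable Cg Ux].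
have := CkD oU (IH _ _ (CkW Cf) (Ck_partial i Cg))
               (IH _ _ (CkW Cg) (Ck_partial i Cf)).
apply: eq_Ck => // x Ux /=.
rewrite /partial -[_ \* _]/(f * g) deriveM//.
  exact: Ck_derivable Cf Ux.
exact: Ck_derivable Cg Ux.
Qed.

Lemma CkN k U f : open U -> Ck k U f -> Ck k U (fun x => - f x).
Proof.
move=> oU Cf; have C1 := Ck_cst k U (-1 : R^o).
have := CkM oU C1 Cf; apply: eq_Ck => // x _ /=.
by rewrite mulN1r.
Qed.

(** The induction closes because a partial of 1/f is -(1/f)^2 times a partial of f, so that it
    involves 1/f only at the lower order. *)
Lemma CkV k U f : open U -> (forall x, U x -> f x != 0) -> Ck k U f ->
  Ck k U (fun x => (f x)^-1).
Proof.
move=> oU f0; elim: k => [|k IH] Cf.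
  by split=> // x Ux; apply: continuousV; [exact: f0|exact: Ck_continuous Cf Ux].
split=> [x Ux|i].
  by apply: continuousV; [exact: f0|exact: Ck_continuous Cf Ux].
split=> [x Ux|].
  by apply: derivableV; [exact: f0|exact: Ck_derivable Cf Ux].
have := CkN oU (CkM oU (CkM oU (IH (CkW Cf)) (IH (CkW Cf))) (Ck_partial i Cf)).
apply: eq_Ck => // x Ux /=; rewrite /partial deriveV//; last exact: Ck_derivable Cf Ux.
  by rewrite [RHS]mulNr expr2 invfM.
exact: f0.
Qed.

Lemma Ck_prod (I : Type) (r : seq I) k U (F : I -> 'rV[R]_m -> R) : open U ->
  (forall i, Ck k U (F i)) -> Ck k U (fun x => \prod_(i <- r) F i x).
Proof.
move=> oU CF; elim: r => [|i r IH].
  by apply: eq_Ck (Ck_cst k U (1 : R^o)) => // x _; rewrite big_nil.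
by have := CkM oU (CF i) IH; apply: eq_Ck => // x _; rewrite big_cons.
Qed.

End CkScalar.

Section Matrices.
Context {R : realType}.

Lemma continuous_mxP (T : topologicalType) p q (F : T -> 'M[R]_(p, q)) x :
  {for x, continuous F} <-> forall i j, {for x, continuous (fun y => F y i j)}.
Proof.
split=> [cF i j|cF].
  apply: (@continuous_comp _ _ _ F (fun A : 'M[R]_(p, q) => A i j) x cF).
  exact: coord_continuous.
apply/cvgrPdist_lt => e e0; near=> y.
rewrite /Num.Def.normr/= mx_normrE bigmax_lt// => -[i j] _ /=.
rewrite !mxE; move: i j; near: y.
apply: filter_forall => i; apply: filter_forall => j.
by have /cvgrPdist_lt := cF i j; exact.
Unshelve. all: by end_near. Qed.

Lemma Ck_mxP m p q k (U : set 'rV[R]_m) (F : 'rV[R]_m -> 'M[R]_(p, q)) : open U ->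
  Ck k U F <-> forall i j, Ck k U (fun x => F x i j).
Proof.
move=> oU; elim: k F => [|k IH] F.
  split=> [[cF _] i j|CF]; split=> // x Ux.
    by have /continuous_mxP := cF _ Ux; exact.
  by apply/continuous_mxP => i j; have [cF _] := CF i j; exact: cF.
split=> [[cF dF] i j|CF].
  split=> [x Ux|l]; first by have /continuous_mxP := cF _ Ux; exact.
  have [dFl CFl] := dF l; split.
    by move=> x Ux; have /derivable_mxP := dFl _ Ux; exact.
  have /IH /(_ i j) := CFl; apply: eq_Ck => // x Ux.
  by rewrite /partial (derive_mx (dFl _ Ux)) mxE.
split=> [x Ux|l].
  by apply/continuous_mxP => i j; exact: Ck_continuous (CF i j) Ux.
have dFl x : U x -> derivable F x (delta_mx 0 l).
  by move=> Ux; apply/derivable_mxP => i j; exact: Ck_derivable (CF i j) Ux.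
split=> //; apply/IH => i j; apply: eq_Ck (Ck_partial l (CF i j)) => // x Ux.
by rewrite /partial (derive_mx (dFl _ Ux)) mxE.
Qed.

Lemma partial_mxE m p q (U : set 'rV[R]_m) (F : 'rV[R]_m -> 'M[R]_(p, q)) l x i j :
  Ck 1 U F -> U x ->
  partial l F x i j = partial l (fun y => F y i j) x.
Proof.
by move=> CF Ux; rewrite /partial (derive_mx (Ck_derivable CF Ux)) mxE.
Qed.

Lemma Ck_mulmx m p q r k (U : set 'rV[R]_m) (A : 'rV[R]_m -> 'M[R]_(p, q))
    (B : 'rV[R]_m -> 'M[R]_(q, r)) : open U -> Ck k U A -> Ck k U B ->
  Ck k U (fun x => A x *m B x).
Proof.
move=> oU /Ck_mxP CA /Ck_mxP CB; apply/Ck_mxP => // i j.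
apply: (@eq_Ck _ _ _ _ _ (fun x => \sum_l (A x i l * B x l j))) => //.
  by move=> x _; rewrite mxE.
by apply: Ck_sum => // l; apply: CkM => //; [exact: CA|exact: CB].
Qed.

Lemma Ck_trmx m p q k (U : set 'rV[R]_m) (A : 'rV[R]_m -> 'M[R]_(p, q)) :
  open U -> Ck k U A -> Ck k U (fun x => (A x)^T).
Proof.
move=> oU /Ck_mxP CA; apply/Ck_mxP => // i j.
by apply: eq_Ck (CA oU j i) => // x _; rewrite mxE.
Qed.

End Matrices.

(** * Restriction to lines *)

Section Lines.
Context {R : realType} {V : normedModType R}.
Implicit Types (f : V -> R) (s t : R).

Lemma is_derive_line f (y v : V) t : derivable f (y + t *: v) v ->
  is_derive t 1 (fun s : R => f (y + s *: v)) ('D_v f (y + t *: v)).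
Proof.
move=> df; rewrite /derive.
have E : (fun h : R => h^-1 *: (((fun s : R => f (y + s *: v)) \o shift t) (h *: 1)
    - f (y + t *: v))) =
  (fun h : R => h^-1 *: ((f \o shift (y + t *: v)) (h *: v) - f (y + t *: v))).
  apply/funext => h /=; congr (_ *: (f _ - _)).
  by rewrite [h%:A]mulr1 scalerDl addrCA addrA.
by split; rewrite ?/derivable ?/derive E.
Qed.

(** Turns a directional derivative into a derivative in one real parameter, the setting of
    differentiation under the integral sign. *)
Lemma is_derive_lineV f (y v : V) D :
  is_derive (0 : R) 1 (fun s : R => f (y + s *: v)) D -> is_derive y v f D.
Proof.
have E : (fun h : R => h^-1 *: (((fun s : R => f (y + s *: v)) \o shift 0) (h *: 1)
    - f (y + 0 *: v))) =
  (fun h : R => h^-1 *: ((f \o shift y) (h *: v) - f y)).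
  apply/funext => h /=; rewrite scale0r !addr0; congr (_ *: (f _ - _)).
  by rewrite [h%:A]mulr1 addrC.
by move=> []; rewrite /derivable /derive E => ? ?; split.
Qed.

Lemma MVT_line f (y v : V) s :
  (forall t, `|t| <= `|s| -> derivable f (y + t *: v) v) ->
  exists2 c, `|c| <= `|s| & f (y + s *: v) - f y = s * 'D_v f (y + c *: v).
Proof.
move=> df.
have dline t : `|t| <= `|s| -> is_derive t 1 (fun s : R => f (y + s *: v)) ('D_v f (y + t *: v)).
  by move=> ts; apply: is_derive_line; exact: df.
have cont (a b : R) : (forall t, t \in `[a, b] -> `|t| <= `|s|) ->
    {within `[a, b], continuous (fun s : R => f (y + s *: v))}.
  by move=> ab; apply: derivable_within_continuous => t /ab /dline [].
have f0 : f y = f (y + 0 *: v) by rewrite scale0r addr0.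
have [s0|s0|->] := ltgtP s 0.
- have Is t : t \in `[s, 0] -> `|t| <= `|s|.
    by rewrite in_itv => /andP[st t0]; rewrite !ler0_norm ?lerN2 ?(ltW s0).
  have [|c cs E] := @MVT_segment _ (fun s : R => f (y + s *: v))
    (fun t : R => 'D_v f (y + t *: v)) s 0 (ltW s0) _ (cont _ _ Is).
    by move=> t /subset_itv_oo_cc /Is /dline.
  exists c; first exact: Is.
  by rewrite f0 -opprB E sub0r mulrN opprK mulrC.
- have Is t : t \in `[0, s] -> `|t| <= `|s|.
    by rewrite in_itv => /andP[st t0]; rewrite !ger0_norm ?(ltW s0).
  have [|c cs E] := @MVT_segment _ (fun s : R => f (y + s *: v))
    (fun t : R => 'D_v f (y + t *: v)) 0 s (ltW s0) _ (cont _ _ Is).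
    by move=> t /subset_itv_oo_cc /Is /dline.
  exists c; first exact: Is.
  by rewrite f0 E subr0 mulrC.
- by exists 0; rewrite ?normr0// scale0r addr0 subrr mul0r.
Qed.

End Lines.

Lemma continuous_sum_at (R : realType) (T : topologicalType) (I : Type)
    (r : seq I) (P : pred I) (F : I -> T -> R) x :
  (forall i, P i -> {for x, continuous (F i)}) ->
  {for x, continuous (fun y => \sum_(i <- r | P i) F i y)}.
Proof.
move=> cF; apply: (@cvg_big _ _ _ _ _ _ _ (nbhs x)) => // .
exact: add_continuous.
Qed.

(** * Continuous partial derivatives and differentiability *)

Section Differentiable.
Context {R : realType} {m : nat}.
Implicit Types (U : set 'rV[R]_m).

Definition dotrow (c v : 'rV[R]_m) : R := \sum_i v 0 i * c 0 i.

Lemma dotrow_is_linear c : linear (dotrow c : _ -> R^o).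
Proof.
move=> a u v; rewrite /dotrow scaler_sumr -big_split; apply: eq_bigr => i _ /=.
by rewrite !mxE mulrDl -mulrA.
Qed.

HB.instance Definition _ c := GRing.isLinear.Build _ _ _ _ _ (dotrow_is_linear c).

Lemma dotrow_continuous c : continuous (dotrow c : _ -> R^o).
Proof.
move=> x; apply: continuous_sum_at => i _.
by apply: continuousM; [exact: coord_continuous|exact: cst_continuous].
Qed.

Lemma norm_coord_le p q (A : 'M[R]_(p, q)) i j : `|A i j| <= `|A|.
Proof.
rewrite [leRHS]/Num.Def.normr/= mx_normrE.
exact: (le_bigmax _ (fun ij : 'I_p * 'I_q => `|A ij.1 ij.2|) (i, j)).
Qed.

Lemma norm_mx_le p q (A : 'M[R]_(p, q)) e : 0 <= e ->
  (forall i j, `|A i j| <= e) -> `|A| <= e.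
Proof.
move=> e0 Ae; rewrite [leLHS]/Num.Def.normr/= mx_normrE.
by apply: bigmax_le => // -[i j] _; exact: Ae.
Qed.

Lemma norm_mx_lt p q (A : 'M[R]_(p, q)) e : 0 < e ->
  (forall i j, `|A i j| < e) -> `|A| < e.
Proof.
move=> e0 Ae; rewrite [ltLHS]/Num.Def.normr/= mx_normrE.
by apply: bigmax_lt => // -[i j] _; exact: Ae.
Qed.

Let trunc j (h : 'rV[R]_m) : 'rV[R]_m := \row_i (if (i < j)%N then h 0 i else 0).

(** The point moves from x to x + h one coordinate at a time, through the truncations [trunc j h];
    each increment is estimated by the mean value theorem and the continuity of one partial
    derivative. *)
Lemma partials_diff U (f : 'rV[R]_m -> R) x : open U ->
  (forall i y, U y -> derivable f y (delta_mx 0 i)) ->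
  (forall i, Ck 0 U (partial i f)) -> U x ->
  differentiable f x /\
  ('d f x : _ -> _) = dotrow (\row_i partial i f x).
Proof.
move=> oU df Cf Ux; set c := \row_i _.
suff o (e : R) : 0 < e -> \forall h \near (nbhs (0 : 'rV[R]_m)), `|f (x + h) - f x - dotrow c h| <= e * `|h|.
  have E : ('d f x : _ -> _) = dotrow c.
    apply: (@diff_unique R _ R^o f (dotrow c)); first exact: dotrow_continuous.
    apply/eqaddoP => e /o; apply: filterS => h /=.
    by rewrite -[X in _ -> `|X| <= _]/(f (h + x) - (f x + dotrow c h)) (addrC h) opprD addrA.
  split=> //; apply/diff_locallyP; rewrite E; split; first exact: dotrow_continuous.
  apply/eqaddoP => e /o; apply: filterS => h /=.
  by rewrite -[X in _ -> `|X| <= _]/(f (h + x) - (f x + dotrow c h)) (addrC h) opprD addrA.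
move=> /posnumP[{}e].
(* At most m increments contribute an error [e' * |h|] each; dividing by [m.+1] also covers m =
   0. *)
pose e' := e%:num / m.+1%:R.
have e'0 : 0 < e' by rewrite divr_gt0.
have [d /= d0 dU] : exists2 d : R, 0 < d & forall y, `|x - y| < d ->
    U y /\ forall i, `|partial i f x - partial i f y| <= e'.
  have : \forall y \near x, U y /\ forall i, `|partial i f x - partial i f y| <= e'.
    near=> y; split; first by near: y; exact: open_nbhs_nbhs.
    move=> i; move: i; near: y; apply: filter_forall => i.
    by have /cvgrPdist_le := Ck_continuous (Cf i) Ux; exact.
  by move=> /nbhs_ballP[d /= d0 dU]; exists d => // y xy; apply: dU; rewrite -ball_normE.
near=> h.
have hd : `|h| < d.
  by near: h; apply/nbhs_ballP; exists d => // h; rewrite -ball_normE /= sub0r normrN.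
have step j (jm : (j <= m)%N) : `|f (x + trunc j h) - f x -
    \sum_(i < m | (i < j)%N) h 0 i * partial i f x| <= j%:R * (e' * `|h|).
  elim: j jm => [|j IH] jm.
    rewrite (_ : trunc 0 h = 0); last by apply/rowP => i; rewrite !mxE.
    by rewrite addr0 subrr big_pred0// subrr normr0 mul0r.
  pose j' := Ordinal jm.
  have Etr : trunc j.+1 h = trunc j h + h 0 j' *: delta_mx 0 j'.
    apply/rowP => i; rewrite !mxE /= ltnS leq_eqVlt (_ : (i == j :> nat) = (i == j'))//.
    by have [->|_] /= := eqVneq i j'; rewrite ?ltnn ?mulr1 ?add0r ?mulr0 ?addr0.
  have near_seg t : `|t| <= `|h 0 j'| -> `|x - (x + trunc j h + t *: delta_mx 0 j')| < d.
    move=> th; rewrite -addrA opprD addNKr normrN; apply: le_lt_trans hd.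
    apply: norm_mx_le => // i k; rewrite !mxE ord1 /=.
    have [kj|kj] := ltnP k j; last first.
      have [_|_] := eqVneq k j'; last by rewrite mulr0 addr0 normr0.
      by rewrite mulr1 add0r (le_trans th)// norm_coord_le.
    have /negPf -> : k != j' by rewrite -val_eqE /= ltn_eqF.
    by rewrite mulr0 addr0 norm_coord_le.
  have [|r rh E] := @MVT_line _ _ f (x + trunc j h) (delta_mx 0 j') (h 0 j').
    by move=> t /near_seg /dU[Ut _]; exact: df.
  rewrite Etr (bigD1 j') //= (eq_bigl (fun i : 'I_m => (i < j)%N)); last first.
    move=> i; rewrite ltnS leq_eqVlt -val_eqE /=.
    by case: ltngtP.
  set S := \sum_(_ < m | _) _ in IH *.
  have -> : f (x + (trunc j h + h 0 j' *: delta_mx 0 j')) - f x -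
      (h 0 j' * partial j' f x + S) =
    (f (x + trunc j h) - f x - S) +
    h 0 j' * (partial j' f (x + trunc j h + r *: delta_mx 0 j') - partial j' f x).
    by rewrite mulrBr /partial -E addrA; ring.
  apply: (le_trans (ler_normD _ _)); rewrite -natr1 mulrDl mul1r lerD ?IH// ?(ltnW jm)//.
  rewrite normrM mulrC ler_pM// ?norm_coord_le// distrC.
  by have [_ ] := dU _ (near_seg _ rh); exact.
have := step m (leqnn m).
rewrite (_ : trunc m h = h); last by apply/rowP => i; rewrite !mxE ltn_ord.
rewrite (eq_big predT (fun i => h 0 i * c 0 i)); last 2 first.
- by move=> i; rewrite ltn_ord.
- by move=> i _; rewrite mxE.
move/le_trans; apply; rewrite mulrA ler_wpM2r// /e' mulrCA ler_piMr//.
by rewrite ler_pdivrMr// mul1r ler_nat.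
Unshelve. all: by end_near. Qed.

(** The continuity of f that [Ck] demands comes for free from [partials_diff]. This is how a
    potential, known only through its partials, is seen to be smooth. *)
Lemma Ck_intro k U (f : 'rV[R]_m -> R) : open U ->
  (forall i y, U y -> derivable f y (delta_mx 0 i)) ->
  (forall i, Ck k U (partial i f)) -> Ck k.+1 U f.
Proof.
move=> oU df Cf; split=> [x Ux|i]; last by split=> // x; exact: df.
apply: differentiable_continuous.
by have [|] := partials_diff oU df _ Ux => // i; exact: Ck_le (Cf i).
Qed.

Lemma C1_diff U (f : 'rV[R]_m -> R) x : open U -> Ck 1 U f -> U x ->
  differentiable f x /\
  ('d f x : _ -> _) = dotrow (\row_i partial i f x).
Proof.
move=> oU Cf Ux; apply: partials_diff Ux => // i; last exact: Ck_partial.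
by move=> y Uy; exact: Ck_derivable Cf Uy.
Qed.

Lemma C1_differentiable U (f : 'rV[R]_m -> R) x : open U -> Ck 1 U f -> U x ->
  differentiable f x.
Proof. by move=> oU Cf Ux; have [] := C1_diff oU Cf Ux. Qed.

Lemma C1_derive U (f : 'rV[R]_m -> R) x v : open U -> Ck 1 U f -> U x ->
  'D_v f x = \sum_i v 0 i * partial i f x.
Proof.
move=> oU Cf Ux; have [df E] := C1_diff oU Cf Ux.
by rewrite deriveE// E; apply: eq_bigr => i _; rewrite mxE.
Qed.

Lemma C1_differentiable_mx p q U (F : 'rV[R]_m -> 'M[R]_(p, q)) x :
  open U -> Ck 1 U F -> U x -> differentiable F x.
Proof.
move=> oU CF Ux.
rewrite (_ : F = \sum_(ij : 'I_p * 'I_q) (fun y => F y ij.1 ij.2 *: delta_mx ij.1 ij.2)); last first.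
  apply/funext => y; rewrite fct_sumE [LHS]matrix_sum_delta pair_big //=.
elim/big_ind : _ => [|f g df dg|ij _]; first exact: differentiable_cst.
  exact: differentiableD.
apply: differentiableZl; apply: C1_differentiable Ux => //.
by have /Ck_mxP := CF; exact.
Qed.

End Differentiable.

Section Chain.
Context {R : realType} {m n : nat}.
Implicit Types (U : set 'rV[R]_m) (W : set 'rV[R]_n).

Lemma jacobianE p q (U : set 'rV[R]_p) (F : 'rV[R]_p -> 'rV[R]_q) x i j :
  open U -> Ck 1 U F -> U x -> ('J F x) i j = partial i F x 0 j.
Proof.
move=> oU CF Ux; rewrite /jacobian mxE /partial deriveE//.
exact: C1_differentiable_mx CF Ux.
Qed.

Lemma row_jacobian p q (U : set 'rV[R]_p) (F : 'rV[R]_p -> 'rV[R]_q) x i :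
  open U -> Ck 1 U F -> U x -> row i ('J F x) = partial i F x.
Proof.
by move=> oU CF Ux; apply/rowP => j; rewrite mxE (jacobianE _ _ oU CF Ux).
Qed.

Lemma partial_comp U W (F : 'rV[R]_m -> 'rV[R]_n) (f : 'rV[R]_n -> R) x i :
  open U -> open W -> Ck 1 U F -> Ck 1 W f -> U x -> W (F x) ->
  partial i (f \o F) x = \sum_j partial i F x 0 j * partial j f (F x).
Proof.
move=> oU oW CF Cf Ux Wx.
have dF := C1_differentiable_mx oU CF Ux.
have [df E] := C1_diff oW Cf Wx.
rewrite {1}/partial deriveE; last exact: differentiable_comp.
rewrite diff_comp// E /= /dotrow -deriveE//.
by apply: eq_bigr => j _; rewrite mxE.
Qed.

Lemma derivable_comp U W (F : 'rV[R]_m -> 'rV[R]_n) (f : 'rV[R]_n -> R) x v :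
  open U -> open W -> Ck 1 U F -> Ck 1 W f -> U x -> W (F x) ->
  derivable (f \o F) x v.
Proof.
move=> oU oW CF Cf Ux Wx; apply: diff_derivable; apply: differentiable_comp.
  exact: C1_differentiable_mx CF Ux.
exact: C1_differentiable Cf Wx.
Qed.

(** Induction with the outer map varying: the chain rule expresses the partials through compositions
    of F with the partials of f, to which the induction hypothesis applies. *)
Lemma Ck_comp k U W (F : 'rV[R]_m -> 'rV[R]_n) (f : 'rV[R]_n -> R) :
  open U -> open W -> (forall x, U x -> W (F x)) ->
  Ck k U F -> Ck k W f -> Ck k U (f \o F).
Proof.
move=> oU oW UW; elim: k f => [|k IH] f CF Cf.
  by split=> // x Ux; apply: continuous_comp;
    [exact: Ck_continuous CF Ux|exact: Ck_continuous Cf (UW _ Ux)].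
have CF1 : Ck 1 U F by exact: Ck_le CF.
have Cf1 : Ck 1 W f by exact: Ck_le Cf.
split=> [x Ux|i].
  by apply: continuous_comp;
    [exact: Ck_continuous CF Ux|exact: Ck_continuous Cf (UW _ Ux)].
split=> [x Ux|].
  by exact: derivable_comp oU oW CF1 Cf1 Ux (UW _ Ux).
apply: (@eq_Ck _ _ _ _ _ (fun x => \sum_j partial i F x 0 j * partial j f (F x))) => //.
  by move=> x Ux; rewrite (partial_comp _ oU oW CF1 Cf1 Ux (UW _ Ux)).
apply: Ck_sum => // j; apply: CkM => //; last exact: IH (CkW CF) (Ck_partial j Cf).
by have /Ck_mxP := Ck_partial i CF; exact.
Qed.

Lemma Ck_comp_mx p q k U W (F : 'rV[R]_m -> 'rV[R]_n) (f : 'rV[R]_n -> 'M[R]_(p, q)) :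
  open U -> open W -> (forall x, U x -> W (F x)) ->
  Ck k U F -> Ck k W f -> Ck k U (f \o F).
Proof.
move=> oU oW UW CF /Ck_mxP Cf; apply/Ck_mxP => // i j.
exact: (Ck_comp oU oW UW CF (Cf oW i j)).
Qed.

Lemma partial_comp_mx p q U W (F : 'rV[R]_m -> 'rV[R]_n) (f : 'rV[R]_n -> 'M[R]_(p, q)) x i :
  open U -> open W -> Ck 1 U F -> Ck 1 W f -> U x -> W (F x) ->
  partial i (f \o F) x = \sum_j partial i F x 0 j *: partial j f (F x).
Proof.
move=> oU oW CF Cf Ux Wx.
have df := C1_differentiable_mx oW Cf Wx.
have dF := C1_differentiable_mx oU CF Ux.
rewrite {1}/partial deriveE; last exact: differentiable_comp.
rewrite diff_comp//= -(deriveE _ dF) -/(partial i F x).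
rewrite {1}[partial i F x]row_sum_delta linear_sum /=; apply: eq_bigr => j _.
by rewrite linearZ /= -deriveE.
Qed.

End Chain.

Lemma jacobian_comp (R : realType) (m n p : nat) (U : set 'rV[R]_m)
    (W : set 'rV[R]_n) (F : 'rV[R]_m -> 'rV[R]_n) (f : 'rV[R]_n -> 'rV[R]_p) x :
  open U -> open W -> Ck 1 U F -> Ck 1 W f -> U x -> W (F x) ->
  'J (f \o F) x = 'J F x *m 'J f (F x).
Proof.
move=> oU oW CF Cf Ux Wx.
have dF := C1_differentiable_mx oU CF Ux.
have df := C1_differentiable_mx oW Cf Wx.
apply/row_matrixP => i.
by rewrite row_mul !rowE /jacobian !mul_rV_lin1 (diff_comp dF df).
Qed.

Section MeanValue.
Context {R : realType}.

Lemma MVT_open (V : normedModType R) (f : V -> R) (a b : V) :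
  (forall t : R, 0 <= t <= 1 -> derivable f (a + t *: (b - a)) (b - a)) ->
  exists2 c : R, 0 < c < 1 & f b - f a = 'D_(b - a) f (a + c *: (b - a)).
Proof.
move=> df; set v := b - a.
have [||c c01 E] := @MVT _ (fun s : R => f (a + s *: v))
    (fun t : R => 'D_v f (a + t *: v)) 0 1 ltr01.
- move=> t /subset_itv_oo_cc t01; apply: is_derive_line; apply: df.
  by move: t01; rewrite in_itv.
- apply: derivable_within_continuous => t t01.
  have [] // := @is_derive_line _ _ f a v t.
  by apply: df; move: t01; rewrite in_itv.
exists c; first by move: c01; rewrite in_itv.
by move: E; rewrite scale1r scale0r addr0 subr0 mulr1 {1}/v [a + (b - a)]addrC subrK.
Qed.

Lemma MVT_convex (V : normedModType R) (f : V -> R) (a b : V) :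
  (forall t : R, 0 <= t <= 1 -> derivable f (a + t *: (b - a)) (b - a)) ->
  exists2 c : R, 0 <= c <= 1 & f b - f a = 'D_(b - a) f (a + c *: (b - a)).
Proof.
by move=> /MVT_open[c /andP[c0 c1] E]; exists c => //; rewrite !ltW.
Qed.

Lemma ball_convex (V : normedModType R) (x a b : V) (r t : R) : 0 <= t <= 1 ->
  ball x r a -> ball x r b -> ball x r (a + t *: (b - a)).
Proof.
move=> /andP[t0 t1]; rewrite -ball_normE /= => xa xb.
have -> : x - (a + t *: (b - a)) = (1 - t) *: (x - a) + t *: (x - b).
  rewrite scalerBl scale1r -addrA [- (t *: _) + _]addrC -scalerBr opprB.
  by rewrite [x - b + _]addrC addrA subrK opprD addrA -scalerN opprB.
have [t0'|t0'] := eqVneq t 0.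
  by rewrite t0' subr0 scale1r scale0r addr0.
apply: (le_lt_trans (ler_normD _ _)); rewrite !normrZ (ger0_norm t0) ger0_norm ?subr_ge0//.
have -> : r = (1 - t) * r + t * r by rewrite -mulrDl subrK mul1r.
rewrite ler_ltD// ?ler_wpM2l ?subr_ge0 ?(ltW xa)// ltr_pM2l//.
by rewrite lt_neqAle eq_sym t0'.
Qed.

Lemma ball_const m (x : 'rV[R]_m) (r : R) (f : 'rV[R]_m -> R) :
  Ck 1 (ball x r) f -> (forall y i, ball x r y -> partial i f y = 0) ->
  forall y z, ball x r y -> ball x r z -> f y = f z.
Proof.
move=> Cf f0 y z xy xz; apply/eqP; rewrite -subr_eq0; apply/eqP.
have oB : open (ball x r) by exact: ball_open.
have seg t : 0 <= t <= 1 -> ball x r (z + t *: (y - z)) by move=> ?; exact: ball_convex.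
have [|c c01 ->] := @MVT_convex _ f z y.
  by move=> t /seg Bt; apply: diff_derivable; exact: C1_differentiable Cf Bt.
rewrite (C1_derive _ oB Cf (seg _ c01)) big1// => i _.
by rewrite f0 ?mulr0//; exact: seg.
Qed.

End MeanValue.

(** * Symmetry of second partial derivatives *)

Section Schwarz.
Context {R : realType} {m : nat}.

(** Two applications of the mean value theorem: in direction i to the increment of f along s e_j,
    then in direction j to the i-th partial. The bound [s < r / 2] keeps all points used inside the
    ball. *)
Lemma double_difference (f : 'rV[R]_m -> R) (x : 'rV[R]_m) (r s : R) (i j : 'I_m) :
  Ck 2 (ball x r) f -> 0 < s -> s < r / 2 ->
  exists2 y, `|x - y| <= s + s &
    f (x + s *: delta_mx 0 i + s *: delta_mx 0 j) - f (x + s *: delta_mx 0 i)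
    - f (x + s *: delta_mx 0 j) + f x = s * (s * partial j (partial i f) y).
Proof.
move=> Cf s0 sr.
have norm_delta (l : 'I_m) t : `|t *: delta_mx 0 l : 'rV[R]_m| <= `|t|.
  apply: norm_mx_le => // a b; rewrite !mxE normrM ler_piMr//.
  by case: (_ && _); rewrite ?normr1 ?normr0.
have Bx t t' : `|t| <= s -> `|t'| <= s ->
    `|x - (x + t *: delta_mx 0 i + t' *: delta_mx 0 j)| <= s + s.
  move=> ts ts'; rewrite -addrA opprD addNKr normrN (le_trans (ler_normD _ _))// lerD//.
    exact: le_trans (norm_delta _ _) ts.
  exact: le_trans (norm_delta _ _) ts'.
have Br y : `|x - y| <= s + s -> ball x r y.
  by move=> xy; rewrite -ball_normE /= (le_lt_trans xy)// [ltRHS](splitr r) ltrD.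
have oB : open (ball x r) by exact: ball_open.
pose d : 'rV[R]_m := s *: delta_mx 0 j.
pose g := (fun y => f (y + d)) - f.
have derg (t : R) : `|t| <= s -> is_derive (x + t *: delta_mx 0 i) (delta_mx 0 i) g
    (partial i f (x + t *: delta_mx 0 i + d) - partial i f (x + t *: delta_mx 0 i)).
  move=> ts; have Bt : ball x r (x + t *: delta_mx 0 i).
    by apply: Br; have := Bx t 0 ts; rewrite scale0r addr0 normr0; apply; exact: ltW.
  have Btd : ball x r (x + t *: delta_mx 0 i + d).
    by apply: Br; apply: Bx => //; rewrite ger0_norm// ltW.
  apply: is_deriveB; last first.
    by apply: DeriveDef => //; exact: Ck_derivable Cf Bt.
  have dfd : derivable f (x + t *: delta_mx 0 i + d) (delta_mx 0 i) := Ck_derivable Cf Btd.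
  have E : (fun h : R => h^-1 *: (((fun y => f (y + d)) \o shift (x + t *: delta_mx 0 i)) (h *: delta_mx 0 i)
     - f (x + t *: delta_mx 0 i + d))) =
    (fun h : R => h^-1 *: ((f \o shift (x + t *: delta_mx 0 i + d)) (h *: delta_mx 0 i)
     - f (x + t *: delta_mx 0 i + d))) by apply/funext => h /=; rewrite [in RHS]addrA.
  by split; rewrite /partial /derivable /derive E.
have [|t ts E] := @MVT_line _ _ g x (delta_mx 0 i) s.
  by move=> t ts; have [] := derg t (le_trans ts (_ : _ <= s)); rewrite ?ger0_norm ?(ltW s0).
have {}ts : `|t| <= s by rewrite (le_trans ts)// ger0_norm// ltW.
have [|t' ts' E'] := @MVT_line _ _ (partial i f) (x + t *: delta_mx 0 i) (delta_mx 0 j) s.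
  move=> t' ts'; apply: Ck_derivable (Ck_partial i Cf) _; apply: Br; apply: Bx => //.
  by rewrite (le_trans ts')// ger0_norm// ltW.
exists (x + t *: delta_mx 0 i + t' *: delta_mx 0 j).
  by apply: Bx => //; rewrite (le_trans ts')// ger0_norm// ltW.
rewrite /partial -/(partial i f) -E'; have := derg t ts; case=> _ <-; rewrite -E /g /=.
rewrite -[(_ - f) _]/(_ - _) -[(_ - f) x]/(_ - _) /d; ring.
Qed.

(** The double difference does not change when i and j are exchanged, so the two mixed partials
    share a value, taken at points near x; continuity at x does the rest. *)
Lemma partialC (U : set 'rV[R]_m) (f : 'rV[R]_m -> R) x i j : open U ->
  Ck 2 U f -> U x -> partial i (partial j f) x = partial j (partial i f) x.
Proof.
move=> oU Cf Ux; apply/eqP; rewrite -subr_eq0 -normr_le0; apply/ler_addgt0Pr => e e0.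
rewrite add0r.
have [r /= r0 xr] : nbhs_ball x U by apply/nbhs_ballP; exact: open_nbhs_nbhs.
have e20 : 0 < e / 2 by rewrite divr_gt0.
have cij := Ck_continuous (Ck_partial i (Ck_partial j Cf)) Ux.
have cji := Ck_continuous (Ck_partial j (Ck_partial i Cf)) Ux.
have [d /= d0 dU] : exists2 d : R, 0 < d & forall y, `|x - y| < d ->
    `|partial i (partial j f) x - partial i (partial j f) y| <= e / 2 /\
    `|partial j (partial i f) x - partial j (partial i f) y| <= e / 2.
  have nij := (cvgrPdist_le _ _).1 cij _ e20.
  have nji := (cvgrPdist_le _ _).1 cji _ e20.
  have [d /= d0 dU] := (@nbhs_ballP R _ x _).1 (filterI (nij (nbhs_filter x)) (nji (nbhs_filter x))).
  by exists d => // y xy; apply: dU; rewrite -ball_normE.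
(* Both intermediate points are within 2 s of x, hence inside the ball of radius r and within the
   modulus of continuity d. *)
pose s := Num.min (r / 4) (d / 4).
have s0 : 0 < s by rewrite lt_min !divr_gt0.
have sr : s < r / 2 by rewrite (@le_lt_trans _ _ (r / 4)) ?ge_min ?lexx// ltr_pM2l// ltf_pV2 ?posrE// ltr_nat.
have ssd : s + s < d.
  have : s <= d / 4 by rewrite ge_min lexx orbT.
  lra.
have Cf' : Ck 2 (ball x r) f by exact: Ck_subset xr Cf.
have [y xy Ey] := double_difference i j Cf' s0 sr.
have [z xz Ez] := double_difference j i Cf' s0 sr.
have tri (a b c : R) : `|a - b| <= `|a - c| + `|b - c|.
  by rewrite [`|b - c|]distrC ler_distD.
have sn0 : s != 0 by rewrite gt_eqF.
have Eyz : partial j (partial i f) y = partial i (partial j f) z.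
  move: Ey Ez; move: (partial j _ y) (partial i _ z) => a b Ea Eb.
  have : s * (s * a) = s * (s * b) by rewrite -Ea -Eb (addrAC x); ring.
  by move=> /(mulfI sn0)/(mulfI sn0).
have [_ dy] := dU _ (le_lt_trans xy ssd).
have [dz _] := dU _ (le_lt_trans xz ssd).
move: dy dz; rewrite Eyz.
move: (partial i _ x) (partial j _ x) (partial i _ z) => a b c bc ac.
clear -tri bc ac; by rewrite (le_trans (tri a b c))// [e]splitr lerD.
Qed.

End Schwarz.

Section Coordinates.
Context {R : realType}.

Lemma Ck_coord m k (U : set 'rV[R]_m) (l : 'I_m) : open U ->
  Ck k U (fun y : 'rV[R]_m => y 0 l).
Proof.
move=> oU; case: k => [|k].
  by split=> // x _; exact: coord_continuous.
have did x v : derivable (fun y : 'rV[R]_m => y) x v by exact: derivable_id.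
split=> [x _|j]; first exact: coord_continuous.
split=> [x _|]; first by have /derivable_mxP := did x (delta_mx 0 j); exact.
apply: (@eq_Ck _ _ _ _ _ (fun=> (delta_mx 0 j : 'rV[R]_m) 0 l : R^o)) => //; last exact: Ck_cst.
move=> x _; have := derive_mx (did x (delta_mx 0 j)); rewrite derive_id /partial.
by move=> /rowP/(_ l); rewrite [in RHS]mxE.
Qed.

Lemma Ck_id m k (U : set 'rV[R]_m) : open U -> Ck k U (fun y : 'rV[R]_m => y).
Proof. by move=> oU; apply/Ck_mxP => // i j; rewrite ord1; exact: Ck_coord. Qed.

End Coordinates.

(** * The implicit function theorem for scalar functions *)

Section Insert.
Context {R : realType} {m : nat}.
Implicit Types (i : 'I_m.+1) (t : R) (y : 'rV[R]_m) (x : 'rV[R]_m.+1).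

(** [ins i] and [del i] split R^(m+1) into the i-th coordinate, which is to be solved for, and the m
    others. For the maximum norm a ball is the product of the two balls. *)
Definition ins i t y : 'rV[R]_m.+1 :=
  \row_j (if unlift i j is Some l then y 0 l else t).

Definition del i x : 'rV[R]_m := \row_l x 0 (lift i l).

Lemma insK i t y : del i (ins i t y) = y.
Proof. by apply/rowP => l; rewrite !mxE liftK. Qed.

Lemma ins_at i t y : ins i t y 0 i = t.
Proof. by rewrite mxE unlift_none. Qed.

Lemma delK i x : ins i (x 0 i) (del i x) = x.
Proof. by apply/rowP => j; rewrite !mxE; case: unliftP => [l ->|->]; rewrite ?mxE. Qed.

Lemma ins_ball i t y x (r : R) : 0 < r ->
  ball x r (ins i t y) <-> ball (del i x) r y /\ `|x 0 i - t| < r.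
Proof.
move=> r0; rewrite -!ball_normE /=; split=> [xr|[yr tr]].
  split; last by have := le_lt_trans (norm_coord_le (x - ins i t y) 0 i) xr; rewrite !mxE unlift_none.
  apply: norm_mx_lt => // a l; rewrite !mxE ord1.
  by have := le_lt_trans (norm_coord_le (x - ins i t y) 0 (lift i l)) xr; rewrite !mxE liftK.
apply: norm_mx_lt => // a j; rewrite !mxE ord1; case: unliftP => [l ->|-> //].
by have := le_lt_trans (norm_coord_le (del i x - y) 0 l) yr; rewrite !mxE.
Qed.

Lemma Ck_ins k (U : set 'rV[R]_m) i (psi : 'rV[R]_m -> R) : open U -> Ck k U psi ->
  Ck k U (fun y => ins i (psi y) y).
Proof.
move=> oU Cpsi; apply/Ck_mxP => // a j; case: (unliftP i j) => [l ->|->].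
  by apply: eq_Ck (Ck_coord k l oU) => // y _; rewrite mxE liftK.
by apply: eq_Ck Cpsi => // y _; rewrite mxE unlift_none.
Qed.

Lemma Ck_del k (U : set 'rV[R]_m.+1) i : open U -> Ck k U (del i).
Proof.
move=> oU; apply/Ck_mxP => // a l.
by apply: eq_Ck (Ck_coord k (lift i l) oU) => // y _; rewrite mxE.
Qed.

Lemma insD i (t h : R) y : ins i (t + h) y = ins i t y + h *: delta_mx 0 i.
Proof.
apply/rowP => j; rewrite !mxE; case: unliftP => [l ->|->] /=.
  by rewrite eq_sym (negPf (neq_lift _ _)) mulr0 addr0.
by rewrite eqxx mulr1.
Qed.

End Insert.

Lemma ltr_dist (R : realFieldType) (a b c : R) : a - c < b -> b < a + c -> `|a - b| < c.
Proof. by move=> ac bc; rewrite ltr_norml; lra. Qed.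

Section Implicit.
Context {R : realType} {m : nat}.
Variables (W : set 'rV[R]_m.+1) (f : 'rV[R]_m.+1 -> R) (i : 'I_m.+1).
Hypotheses (oW : open W) (Cf : smooth_on W f).

Variables (p : 'rV[R]_m.+1) (d : R).
Hypotheses (d0 : 0 < d) (pW : ball p d `<=` W)
  (f_pos : forall x, ball p d x -> 0 < partial i f x).

Let incr t t' y : ball p d (ins i t y) -> ball p d (ins i t' y) -> t < t' ->
  f (ins i t y) < f (ins i t' y).
Proof.
move=> Bt Bt' tt'; rewrite -subr_gt0.
have E : ins i t' y - ins i t y = (t' - t) *: delta_mx 0 i.
  by rewrite -[t'](subrK t) [X in ins i X y]addrC insD addrC addKr addrK.
have seg c : 0 <= c <= 1 -> ball p d (ins i t y + c *: (ins i t' y - ins i t y)).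
  by move=> c01; exact: ball_convex.
have C1 := Cf 1.
have [|c c01 ->] := @MVT_convex _ _ f (ins i t y) (ins i t' y).
  by move=> c /seg /pW Wc; apply: diff_derivable; exact: C1_differentiable (C1) Wc.
have Bc := seg _ c01; rewrite (C1_derive _ oW C1 (pW Bc)) (bigD1 i)//= big1 ?addr0.
  by move: (f_pos Bc); rewrite E !mxE !eqxx mulr1 => ?; rewrite mulr_gt0 ?subr_gt0.
by move=> j ji; rewrite E !mxE (negPf ji) mulr0 mul0r.
Qed.

Let near_lt (y1 : 'rV[R]_m) t (c : R) : ball p d (ins i t y1) -> f (ins i t y1) < c ->
  \forall y \near y1, f (ins i t y) < c.
Proof.
move=> Bt fc.
have oT : open [set: 'rV[R]_m] by exact: openT.
have Cins : Ck 0 setT (ins i t) by exact: Ck_ins oT (Ck_cst 0 setT (t : R^o)).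
have cf : {for y1, continuous (f \o ins i t)}.
  apply: continuous_comp; first exact: Ck_continuous Cins I.
  exact: Ck_continuous (Cf 0) (pW Bt).
exact: (cvgr_lt (f (ins i t y1)) cf).
Qed.

Let near_gt (y1 : 'rV[R]_m) t (c : R) : ball p d (ins i t y1) -> c < f (ins i t y1) ->
  \forall y \near y1, c < f (ins i t y).
Proof.
move=> Bt fc.
have oT : open [set: 'rV[R]_m] by exact: openT.
have Cins : Ck 0 setT (ins i t) by exact: Ck_ins oT (Ck_cst 0 setT (t : R^o)).
have cf : {for y1, continuous (f \o ins i t)}.
  apply: continuous_comp; first exact: Ck_continuous Cins I.
  exact: Ck_continuous (Cf 0) (pW Bt).
exact: (cvgr_gt (f (ins i t y1)) cf).
Qed.

(** Half the radius, so that the closed interval of heights at distance at most [s] stays inside the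
    open ball. *)
Let s := d / 2.
Let s0 : 0 < s. Proof. by rewrite divr_gt0. Qed.
Let sd : s < d. Proof. by rewrite ltr_pdivrMr// ltr_pMr// ltr1n. Qed.

Let box y t : ball (del i p) d y -> `|p 0 i - t| <= s -> ball p d (ins i t y).
Proof. by move=> By ts; apply/ins_ball => //; split=> //; exact: le_lt_trans sd. Qed.

Let in_box t : p 0 i - s <= t <= p 0 i + s -> `|p 0 i - t| <= s.
Proof. by move=> /andP[a b]; rewrite ler_norml; apply/andP; split; lra. Qed.

(** Since f increases strictly in the i-th coordinate, it is below [f p] at the bottom and above it
    at the top of the interval over the centre. Both inequalities persist for nearby y, and the
    intermediate value theorem gives a solution. *)
Lemma implicit_exists : exists2 r : R, 0 < r <= d &
  exists psi : 'rV[R]_m -> R, forall y, ball (del i p) r y ->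
    `|p 0 i - psi y| < s /\ f (ins i (psi y) y) = f p.
Proof.
have Bc := ballxx (del i p) d0.
have Bp t : p 0 i - s <= t <= p 0 i + s -> ball p d (ins i t (del i p)).
  by move=> /in_box; exact: box.
have sp0 : p 0 i - s <= p 0 i - s <= p 0 i + s.
  by rewrite lexx; have := s0; lra.
have sp1 : p 0 i - s <= p 0 i + s <= p 0 i + s.
  by rewrite lexx andbT; have := s0; lra.
have pp : p 0 i - s <= p 0 i <= p 0 i + s by have := s0; lra.
have lo : f (ins i (p 0 i - s) (del i p)) < f p.
  rewrite -[X in _ < f X](delK i) incr//; [exact: Bp|exact: Bp|by have := s0; lra].
have hi : f p < f (ins i (p 0 i + s) (del i p)).
  rewrite -[X in f X < _](delK i) incr//; [exact: Bp|exact: Bp|by have := s0; lra].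
have nlo := near_lt (Bp _ sp0) lo.
have nhi := near_gt (Bp _ sp1) hi.
have [r /= r0 rP] := (@nbhs_ballP R _ _ _).1 (filterI nlo nhi).
exists (Num.min r d); first by rewrite lt_min r0 d0 ge_min lexx orbT.
(* Placing the ball hypothesis under the existential lets choice produce a total function; its
   values off the ball are arbitrary. *)
suff H y : exists t, ball (del i p) (Num.min r d) y ->
    `|p 0 i - t| < s /\ f (ins i t y) = f p.
  by have [psi Hpsi] := choice H; exists psi.
have [By|nB] := pselect (ball (del i p) (Num.min r d) y); last by exists 0.
have [ylo yhi] : f (ins i (p 0 i - s) y) < f p /\ f p < f (ins i (p 0 i + s) y).
  by apply: rP; apply: le_ball By; rewrite ge_min lexx.
have Byd : ball (del i p) d y by apply: le_ball By; rewrite ge_min lexx orbT.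
have ps : p 0 i - s <= p 0 i + s by have := s0; lra.
have cg : {within `[p 0 i - s, p 0 i + s], continuous (fun t => f (ins i t y))}.
  apply: continuous_in_subspaceT => t; rewrite inE /= in_itv /= => /in_box tb.
  have cins : {for t, continuous (fun t => ins i t y)}.
    apply/continuous_mxP => a j; case: (unliftP i j) => [l ->|->].
      by apply: eq_continuous_at (@cst_continuous _ _ (y 0 l) t); near=> u; rewrite mxE liftK.
    by apply: (@eq_continuous_at _ _ id); [near=> u; rewrite mxE unlift_none|exact: cvg_id].
  apply: (@continuous_comp _ _ _ (fun t => ins i t y) f t cins).
  exact: Ck_continuous (Cf 0) (pW (box Byd tb)).
have [|t tb ft] := IVT ps cg (v := f p).
  by rewrite ge_min (ltW ylo) le_max (ltW yhi) orbT.
exists t => _; split=> //.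
(* The intermediate value theorem uses the closed interval; its endpoints are excluded because f
   differs from [f p] there. *)
move: tb; rewrite in_itv /= => tb; rewrite lt_neqAle in_box// andbT; apply/negP => /eqP E.
have [tp|tp] := leP t (p 0 i).
  have Et : t = p 0 i - s by move: E; rewrite ger0_norm ?subr_ge0// => <-; rewrite opprB addrC subrK.
  by move: ylo; rewrite -Et ft ltxx.
have Et : t = p 0 i + s by move: E; rewrite ltr0_norm ?subr_lt0// => <-; rewrite opprB addrC subrK.
by move: yhi; rewrite -Et ft ltxx.
Unshelve. all: by end_near. Qed.

Variables (r : R) (psi : 'rV[R]_m -> R).
Hypotheses (rd : r <= d)
  (psiP : forall y, ball (del i p) r y ->
    `|p 0 i - psi y| < s /\ f (ins i (psi y) y) = f p).

Let Bd y : ball (del i p) r y -> ball (del i p) d y.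
Proof. exact: le_ball. Qed.

Lemma implicit_unique y t : ball (del i p) r y -> `|p 0 i - t| < s ->
  f (ins i t y) = f p <-> t = psi y.
Proof.
move=> By ts; have [ps E] := psiP By; split=> [Et|->//].
have Bt := box (Bd By) (ltW ts); have Bpsi := box (Bd By) (ltW ps).
by have [tp|tp|//] := ltgtP t (psi y);
  [have := incr Bt Bpsi tp|have := incr Bpsi Bt tp]; rewrite E Et ltxx.
Qed.

(** By monotonicity f is below [f p] at height [psi y - e'] and above it at [psi y + e']. These
    strict inequalities survive for z near y and trap [psi z] between the two heights. *)
Lemma implicit_continuous y : ball (del i p) r y -> {for y, continuous psi}.
Proof.
move=> By; have [ps E] := psiP By.
apply/(@cvgrPdist_lt _ _ _ (nbhs y)) => e e0.
(* Small enough for the precision e and for the two test heights to remain in the box. *)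
pose e' := Num.min e (s - `|p 0 i - psi y|) / 2.
have m0 : 0 < Num.min e (s - `|p 0 i - psi y|) by rewrite lt_min e0 subr_gt0.
have e'0 : 0 < e' by rewrite divr_gt0.
have e'e : e' < e.
  by rewrite (@lt_le_trans _ _ (Num.min e (s - `|p 0 i - psi y|))) ?ge_min ?lexx// ltr_pdivrMr// ltr_pMr// ltr1n.
have e's : e' <= s - `|p 0 i - psi y|.
  rewrite (@le_trans _ _ (Num.min e (s - `|p 0 i - psi y|))) ?ge_min ?lexx ?orbT//.
  by rewrite ler_pdivrMr// ler_peMr ?ler1n// ltW.
have tb (u : R) : `|u| <= e' -> `|p 0 i - (psi y + u)| <= s.
  move=> ue; rewrite opprD addrA (le_trans (ler_normB _ _))//.
  by rewrite -lerBrDl (le_trans ue).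
have ne' : `|- e'| <= e' by rewrite normrN ger0_norm// ltW.
have pe' : `|e'| <= e' by rewrite ger0_norm// ltW.
have B0 := box (Bd By) (ltW ps).
have lo : f (ins i (psi y - e') y) < f p.
  rewrite -E incr//; first exact: box (Bd By) (tb _ ne').
  by rewrite ltrBlDr ltrDl.
have hi : f p < f (ins i (psi y + e') y).
  rewrite -E incr//; first exact: box (Bd By) (tb _ pe').
  by rewrite ltrDl.
have nlo := near_lt (box (Bd By) (tb _ ne')) lo.
have nhi := near_gt (box (Bd By) (tb _ pe')) hi.
have nB : \forall z \near y, ball (del i p) r z.
  by apply: open_nbhs_nbhs; split=> //; exact: ball_open.
apply: filterS (filterI nB (filterI nlo nhi)) => z [Bz [zlo zhi]].
have [zs Ez] := psiP Bz; have Bz' := box (Bd Bz) (ltW zs).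
have tz u : `|u| <= e' -> ball p d (ins i (psi y + u) z).
  by move=> ue; exact: box (Bd Bz) (tb _ ue).
have h1 : psi y - e' < psi z.
  rewrite ltNge; apply/negP; rewrite le_eqVlt => /orP[/eqP E1|lt1].
    by move: zlo; rewrite -E1 Ez ltxx.
  by have := incr Bz' (tz _ ne') lt1; rewrite Ez => /(lt_trans zlo); rewrite ltxx.
have h2 : psi z < psi y + e'.
  rewrite ltNge; apply/negP; rewrite le_eqVlt => /orP[/eqP E1|lt1].
    by move: zhi; rewrite E1 Ez ltxx.
  by have := incr (tz _ pe') Bz' lt1; rewrite Ez => /(lt_trans zhi); rewrite ltxx.
exact: lt_trans (ltr_dist h1 h2) e'e.
Qed.

Let gam y := ins i (psi y) y.

Let gamB y : ball (del i p) r y -> ball p d (gam y).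
Proof. by move=> By; have [ps _] := psiP By; exact: box (Bd By) (ltW ps). Qed.

(** The mean value theorem is applied to f on the chord between two points of the graph. As f agrees
    at its ends, the difference quotient of [psi] is exactly [Q] at an intermediate point, which
    tends to [gam y]. *)
Lemma implicit_is_derive y j : ball (del i p) r y ->
  is_derive y (delta_mx 0 j) psi
    (- (partial (lift i j) f (gam y) * (partial i f (gam y))^-1)).
Proof.
move=> By; set Q := fun x => - (partial (lift i j) f x * (partial i f x)^-1).
have C1 := Cf 1.
have oB : open (ball (del i p) r) by exact: ball_open.
have Cpsi : Ck 0 (ball (del i p) r) psi by split=> // z; exact: implicit_continuous.
have Cgam : Ck 0 (ball (del i p) r) gam by exact: Ck_ins.
have cgam := Ck_continuous Cgam By.
have WB : W (gam y) by exact/pW/gamB.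
have fi0 : partial i f (gam y) != 0 by rewrite gt_eqF// f_pos//; exact: gamB.
have cQ : {for gam y, continuous Q}.
  apply: continuousN; apply: continuousM; first exact: Ck_continuous (Ck_partial _ C1) WB.
  by apply: continuousV => //; exact: Ck_continuous (Ck_partial _ C1) WB.
suff H : h^-1 *: ((psi \o shift y) (h *: delta_mx 0 j) - psi y) @[h --> (0 : R)^'] --> Q (gam y).
  by split; [apply/cvg_ex; exists (Q (gam y))|apply/cvg_lim].
apply/cvgrPdist_lt => e e0.
have [dl /= dl0 dQ] := (@nbhs_ballP R _ _ _).1 ((cvgrPdist_lt _ _).1 cQ e e0).
have cline : {for (0 : R), continuous (fun h : R => h *: delta_mx 0 j + y)}.
  by apply: continuousD; [exact: scalel_continuous|exact: cst_continuous].
have line0 : 0 *: delta_mx 0 j + y = y by rewrite scale0r add0r.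
have nB : \forall h \near (0 : R), ball (del i p) r (h *: delta_mx 0 j + y).
  apply: cline; rewrite line0; apply: open_nbhs_nbhs; split => //.
have nG : \forall h \near (0 : R), ball (gam y) dl (gam (h *: delta_mx 0 j + y)).
  apply: (cline (fun z => ball (gam y) dl (gam z))); rewrite line0.
  by apply: (cgam (ball (gam y) dl)); exact: nbhsx_ballx.
near=> h.
have h0 : h != 0 by near: h; exact: nbhs_dnbhs_neq.
have Bh : ball (del i p) r (h *: delta_mx 0 j + y) by near: h; exact: nbhs_dnbhs.
have Gh : ball (gam y) dl (gam (h *: delta_mx 0 j + y)) by near: h; exact: nbhs_dnbhs.
set y' := h *: delta_mx 0 j + y in Bh Gh *.
have seg c : 0 <= c <= 1 -> ball p d (gam y + c *: (gam y' - gam y)).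
  by move=> c01; apply: ball_convex => //; exact: gamB.
have [|c c01] := @MVT_convex _ _ f (gam y) (gam y').
  by move=> c /seg /pW Wc; apply: diff_derivable; exact: C1_differentiable C1 Wc.
have [_ Ey'] := psiP Bh; have [_ Ey] := psiP By.
rewrite {1}/gam Ey' {1}/gam Ey subrr; set xi := gam y + _.
have Bxi : ball p d xi by exact: seg.
rewrite (C1_derive _ oW C1 (pW Bxi)).
(* The two points of the graph differ only in the coordinates i and [lift i j]. *)
have -> : \sum_l (gam y' - gam y) 0 l * partial l f xi =
    h * partial (lift i j) f xi + (psi y' - psi y) * partial i f xi.
  rewrite (bigD1 i)//= addrC; congr (_ + _); last first.
    by rewrite /gam !mxE unlift_none.
  rewrite (bigD1 (lift i j)) /=; last by rewrite eq_sym neq_lift.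
  rewrite big1 ?addr0; first by rewrite /gam !mxE liftK !mxE !eqxx mulr1 addrK.
  move=> l /andP[li lj]; case: (unliftP i l) => [l' El|El]; last by rewrite El eqxx in li.
  rewrite /gam !mxE El liftK !mxE /= [l' == j]negbTE ?mulr0 ?add0r ?subrr ?mul0r//.
  by apply: contraNneq lj => <-; rewrite El.
move=> /esym/eqP; rewrite addrC addr_eq0 => /eqP E.
have fx0 : partial i f xi != 0 by rewrite gt_eqF// f_pos.
have -> : h^-1 *: ((psi \o shift y) (h *: delta_mx 0 j) - psi y) = Q xi.
  rewrite /= -/y' /Q; apply: (mulfI h0); apply: (mulIf fx0).
  by rewrite mulrA mulfV// mul1r E mulrN mulrA mulNr divfK.
apply: dQ; rewrite -ball_normE /= /xi opprD addNKr normrN normrZ.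
move: Gh; rewrite -ball_normE /= distrC; apply: le_lt_trans.
by case/andP: c01 => c0' c1; rewrite ger0_norm// ler_piMl.
Unshelve. all: by end_near. Qed.

(** Bootstrap: the partials of [psi] are smooth functions of [gam], and [gam] is as regular as
    [psi], so each order gives the next. *)
Lemma implicit_smooth : smooth_on (ball (del i p) r) psi.
Proof.
have oB : open (ball (del i p) r) by exact: ball_open.
elim=> [|k IH]; first by split=> // y; exact: implicit_continuous.
split=> [y|j]; first exact: implicit_continuous.
split=> [y /(implicit_is_derive j)[] //|].
have CG : Ck k (ball (del i p) r) gam by exact: Ck_ins.
have maps y : ball (del i p) r y -> ball p d (gam y) by exact: gamB.
have oBp : open (ball p d) by exact: ball_open.
have Cp l : Ck k (ball p d) (partial l f).
  exact: Ck_partial (Ck_subset pW (Cf k.+1)).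
have Cl l := Ck_comp oB oBp maps CG (Cp l).
have fi0 y : ball (del i p) r y -> (partial i f \o gam) y != 0.
  by move=> /maps /f_pos; rewrite lt0r => /andP[].
have := CkN oB (CkM oB (Cl (lift i j)) (CkV oB fi0 (Cl i))).
apply: eq_Ck => // y By.
by have [_] := implicit_is_derive j By; rewrite /partial => ->.
Qed.

End Implicit.

(** The uniqueness clause covers a whole box: every point of the level set in it is on the graph.
    Charts of level sets rest on this. *)
Theorem implicit_function (R : realType) m (W : set 'rV[R]_m.+1)
    (f : 'rV[R]_m.+1 -> R) (i : 'I_m.+1) (p : 'rV[R]_m.+1) :
  open W -> smooth_on W f -> W p -> partial i f p != 0 ->
  exists (r s : R) (psi : 'rV[R]_m -> R),
    [/\ 0 < r, 0 < s, smooth_on (ball (del i p) r) psi &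
    forall y, ball (del i p) r y ->
      [/\ `|p 0 i - psi y| < s,
          forall t, `|p 0 i - t| < s -> W (ins i t y) &
          forall t, `|p 0 i - t| < s -> f (ins i t y) = f p <-> t = psi y]].
Proof.
move=> oW Cf Wp.
wlog fp : f Cf / 0 < partial i f p.
  move=> H; rewrite neq_lt => /orP[fp|fp]; last by apply: H => //; rewrite gt_eqF.
  have CN : smooth_on W (fun x => - f x) by move=> k; exact: CkN.
  have pN : partial i (fun x => - f x) p = - partial i f p.
    by rewrite /partial -[fun x => - f x]/(- f) deriveN//; exact: Ck_derivable (Cf 1) Wp.
  have [||r [s [psi [r0 s0 Cpsi HP]]]] := H _ CN; rewrite ?pN ?oppr_gt0// ?oppr_eq0 ?lt_eqF//.
  exists r, s, psi; split=> // y /HP[h1 h2 h3]; split=> // t /h3 [a b].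
  by split=> [E|/b /oppr_inj//]; apply: a; rewrite E.
move=> _.
have cfp := Ck_continuous (Ck_partial i (Cf 1)) Wp.
have [d /= d0 dP] := (@nbhs_ballP R _ _ _).1
  (filterI (open_nbhs_nbhs (conj oW Wp)) (cvgr_gt _ cfp _ fp)).
have pW : ball p d `<=` W by move=> x /dP[].
have f_pos x : ball p d x -> 0 < partial i f x by move=> /dP[].
have [r /andP[r0 rd] [psi psiP]] := implicit_exists oW Cf d0 pW f_pos.
exists r, (d / 2), psi; split=> //.
- by rewrite divr_gt0.
- exact: (implicit_smooth oW Cf d0 pW f_pos rd psiP).
move=> y By; have [ps E] := psiP _ By; split=> // t ts.
  apply: pW; apply/ins_ball => //; split; first exact: le_ball By.
  by rewrite (lt_trans ts)// ltr_pdivrMr// ltr_pMr// ltr1n.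
exact: (implicit_unique oW Cf d0 pW f_pos rd psiP By ts).
Qed.

(** * The Poincare lemma on balls *)

Section Poincare.
Context {R : realType} {m : nat}.
Variables (x0 : 'rV[R]_m) (r C : R) (th : 'I_m -> 'rV[R]_m -> R).
Hypotheses (r0 : 0 < r) (r1 : r <= 1).
Let B := ball x0 r.
Hypotheses (Cth : forall j, Ck 1 B (th j))
  (closed : forall i j y, B y -> partial i (th j) y = partial j (th i) y)
  (th_le : forall j y, B y -> `|th j y| <= C)
  (dth_le : forall i j y, B y -> `|partial i (th j) y| <= C).

Let oB : open B. Proof. exact: ball_open. Qed.
Let Bx0 : B x0. Proof. exact: ballxx. Qed.
Let C0 (j : 'I_m) : 0 <= C. Proof. exact: le_trans (normr_ge0 _) (th_le j Bx0). Qed.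

Let A (t : R) (y : 'rV[R]_m) := x0 + t *: (y - x0).

Let AB t y : 0 <= t <= 1 -> B y -> B (A t y).
Proof. by move=> t01 By; exact: ball_convex. Qed.

Let CA k t : Ck k B (A t).
Proof.
apply/Ck_mxP => // i j; rewrite ord1.
have := CkD oB (Ck_cst k B (x0 0 j : R^o)) (CkM oB (Ck_cst k B (t : R^o))
  (CkD oB (Ck_coord k j oB) (Ck_cst k B (- x0 0 j : R^o)))).
by apply: eq_Ck => // y _; rewrite !mxE.
Qed.

Let partial_A t y j : partial j (A t) y = t *: delta_mx 0 j.
Proof.
have d0 := is_derive_cst x0 y (delta_mx 0 j : 'rV[R]_m).
have d1 := is_derive_id y (delta_mx 0 j : 'rV[R]_m).
have [_ E] := is_deriveD d0 (is_deriveZ t (is_deriveB d1 d0)).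
by rewrite /partial; apply: (etrans E); rewrite add0r subr0.
Qed.

Let q t (y : 'rV[R]_m) := \sum_i th i (A t y) * (y - x0) 0 i.

Let Cw i : Ck 1 B (fun y : 'rV[R]_m => (y - x0) 0 i).
Proof.
have := CkD oB (Ck_coord 1 i oB) (Ck_cst 1 B (- x0 0 i : R^o)).
by apply: eq_Ck => // y _; rewrite !mxE.
Qed.

Let CthA t i : 0 <= t <= 1 -> Ck 1 B (th i \o A t).
Proof. by move=> t01; apply: Ck_comp (CA 1 t) (Cth i) => // y; exact: AB. Qed.

Let Cq t : 0 <= t <= 1 -> Ck 1 B (q t).
Proof. by move=> t01; apply: (Ck_sum _ oB) => i; exact: (CkM oB (CthA i t01) (Cw i)). Qed.

(** Closedness exchanges the indices of the derivative of theta; the right-hand side is then the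
    t-derivative of t th_j(x0 + t (y - x0)). *)
Let dq t y j : 0 <= t <= 1 -> B y ->
  partial j (q t) y = th j (A t y) + t * \sum_i (y - x0) 0 i * partial i (th j) (A t y).
Proof.
move=> t01 By.
have BA := AB t01 By.
have E : q t = \sum_i ((th i \o A t) * (fun y : 'rV[R]_m => (y - x0) 0 i)).
  by apply/funext => z; rewrite fct_sumE.
have dA i : derivable (th i \o A t) y (delta_mx 0 j).
  exact: Ck_derivable (CthA i t01) By.
have dw i : derivable (fun y : 'rV[R]_m => (y - x0) 0 i) y (delta_mx 0 j).
  exact: Ck_derivable (Cw i) By.
rewrite /partial E derive_sum; last by move=> i; exact: derivableM.
have Dw i : 'D_(delta_mx 0 j) (fun y : 'rV[R]_m => (y - x0) 0 i) y = (i == j)%:R.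
  have d0 := is_derive_cst x0 y (delta_mx 0 j : 'rV[R]_m).
  have [d1 E1] := is_deriveB (is_derive_id y (delta_mx 0 j : 'rV[R]_m)) d0.
  have := etrans (esym E1) (derive_mx d1); rewrite subr0 => /rowP/(_ i).
  by rewrite !mxE /= => <-.
have DA i : 'D_(delta_mx 0 j) (th i \o A t) y = t * partial j (th i) (A t y).
  have := partial_comp j oB oB (CA 1 t) (Cth i) By BA; rewrite /partial => ->.
  rewrite -/(partial j (A t) y) partial_A (bigD1 j)//= big1 ?addr0.
    by rewrite !mxE !eqxx mulr1.
  by move=> l lj; rewrite !mxE (negPf lj) mulr0 mul0r.
under eq_bigr => i _ do rewrite deriveM// Dw DA.
rewrite big_split /=; congr (_ + _).
  rewrite (bigD1 j)//= eqxx big1 ?addr0 ?[LHS]mulr1//.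
  by move=> i /negPf ->; rewrite [LHS]mulr0.
rewrite mulr_sumr; apply: eq_bigr => i _.
by rewrite [LHS]mulrCA closed.
Qed.

Let cont_A y t : {for t, continuous (fun t : R => A t y)}.
Proof.
apply: (@continuousD _ _ _ (fun=> x0) (fun t : R => t *: (y - x0))).
  exact: cst_continuous.
exact: scalel_continuous.
Qed.

Let cont_comp_A (f : 'rV[R]_m -> R) y (t : R) : {for A t y, continuous f} ->
  {for t, continuous (fun t : R => f (A t y))}.
Proof. by move=> cf; exact: (continuous_comp (@cont_A y t) cf). Qed.

Let cont_q y : B y -> {within `[0, 1], continuous (fun t => q t y)}.
Proof.
move=> By; apply: continuous_in_subspaceT => t; rewrite inE /= in_itv /= => t01.
apply: continuous_sum_at => i _; apply: continuousM; last exact: cst_continuous.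
apply: (@cont_comp_A (th i) y t).
exact: Ck_continuous (Cth i) (AB t01 By).
Qed.

Local Notation mu := (@lebesgue_measure R).

Let h y : R := \int[mu]_(t in `[0, 1]) q t y.

Let w_le y i : B y -> `|(y - x0) 0 i| <= 1.
Proof.
rewrite /B -ball_normE /= => By; apply: (le_trans (norm_coord_le _ _ _)).
by rewrite distrC (le_trans (ltW By)).
Qed.

(** Differentiation under the integral sign, after which the integrand is an exact t-derivative and
    the fundamental theorem of calculus evaluates it. *)
Lemma poincare_is_derive y j : B y -> is_derive y (delta_mx 0 j) h (th j y).
Proof.
move=> By; apply: is_derive_lineV.
have [u /= u0 uB] : exists2 u : R, 0 < u & forall s : R, `|s| < u -> B (y + s *: delta_mx 0 j).
  have cl : {for (0 : R), continuous (fun s : R => y + s *: delta_mx 0 j)}.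
    apply: continuousD; [exact: cst_continuous|exact: scalel_continuous].
  have nb : nbhs (y + 0 *: delta_mx 0 j) B.
    by rewrite scale0r addr0; exact: open_nbhs_nbhs.
  have [u /= u0 uP] := (@nbhs_ballP R _ _ _).1 (cl _ nb).
  by exists u => // s su; apply: uP; rewrite -ball_normE /= sub0r normrN.
pose f (s t : R) := q t (y + s *: delta_mx 0 j).
have Iu s : `]-u, u[%classic s -> B (y + s *: delta_mx 0 j).
  by rewrite /= in_itv /= => su; apply: uB; rewrite ltr_norml.
have df s t : `]-u, u[%classic s -> `[0, 1]%classic t ->
    is_derive s 1 (f^~ t) (partial j (q t) (y + s *: delta_mx 0 j)).
  rewrite [`[0, 1]%classic t]/= in_itv /= => /Iu Bs t01.
  by apply: is_derive_line; exact: Ck_derivable (Cq t01) Bs.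
have mI : measurable (`[0, 1] : set (measurableTypeR R)) by exact: measurable_itv.
have I0 : `]-u, u[%classic (0 : R) by rewrite /= in_itv /= oppr_lt0 u0.
have intf s : `]-u, u[%classic s -> mu.-integrable `[0, 1] (EFin \o f s).
  move=> /Iu Bs; apply: continuous_compact_integrable; first exact: segment_compact.
  exact: cont_q.
have derf s t : `]-u, u[%classic s -> `[0, 1]%classic t -> derivable (f^~ t) s 1.
  by move=> su t01; have [] := df s t su t01.
(* A constant dominating function: one bound for th_j and m for the sum, where [r <= 1] bounds the
   coordinates of y - x0 by 1. *)
pose G (_ : R) := C + m%:R * C.
have G0 t : 0 <= G t by rewrite addr_ge0 ?mulr_ge0 ?(C0 j).
have intG : mu.-integrable `[0, 1] (EFin \o G).
  apply: continuous_compact_integrable; first exact: segment_compact.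
  by apply: continuous_subspaceT => t; exact: cst_continuous.
have dE s t : `]-u, u[%classic s -> `[0, 1]%classic t ->
    partial1of2 f s t = partial j (q t) (y + s *: delta_mx 0 j).
  by move=> su t01; rewrite partial1of2E; have [] := df s t su t01.
have Gub s t : `]-u, u[%classic s -> `[0, 1]%classic t -> `|partial1of2 f s t| <= G t.
  move=> su t01; rewrite (dE _ _ su t01); have Bs := Iu _ su.
  move: t01; rewrite /= in_itv /= => t01; rewrite (dq j t01 Bs) /G.
  have BA := AB t01 Bs; case/andP: t01 => t0 t1.
  apply: (le_trans (ler_normD _ _)); apply: lerD; first exact: th_le.
  rewrite normrM ger0_norm// -[leRHS]mul1r ler_pM//.
  apply: (le_trans (ler_norm_sum _ _ _)).
  apply: (@le_trans _ _ (\sum_(i < m) C)); last by rewrite sumr_const card_ord mulr_natl.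
  by apply: ler_sum => i _; rewrite normrM -[leRHS]mul1r ler_pM// ?w_le// dth_le.
have D := derivable_under_integral mI I0 intf derf G0 intG Gub.
have E := differentiation_under_integral mI I0 intf derf G0 intG Gub.
apply: DeriveDef; first exact: D.
(* The antiderivative in t: it is 0 at t = 0 and th_j(y) at t = 1. *)
rewrite -derive1E E; pose F (t : R) := t * th j (A t y).
have dF (t : R) : 0 <= t <= 1 -> is_derive t 1 F (partial1of2 f 0 t).
  move=> t01; have t01' : `[0, 1]%classic t by rewrite /= in_itv.
  rewrite (dE _ _ I0 t01') scale0r addr0 (dq j t01 By); have BA := AB t01 By.
  have dt : is_derive t 1 (fun t : R => t) 1 by exact: is_derive_id.
  have dth : is_derive t 1 (fun t : R => th j (A t y)) (\sum_i (y - x0) 0 i * partial i (th j) (A t y)).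
    rewrite -(C1_derive (y - x0) oB (Cth j) BA); apply: is_derive_line.
    by apply: diff_derivable; exact: C1_differentiable (Cth j) BA.
  apply: (is_derive_eq (is_deriveM dt dth)).
  by rewrite addrC [X in X + _]mulr1.
have cd : {within `[0, 1], continuous (fun t => partial1of2 f 0 t)}.
  have cg : {within `[0, 1], continuous (fun t => th j (A t y) + t * \sum_i (y - x0) 0 i * partial i (th j) (A t y))}.
    apply: continuous_in_subspaceT => t; rewrite inE /= in_itv /= => t01.
    have BA := AB t01 By.
    have c1 := cont_comp_A (Ck_continuous (Cth j) BA).
    have c2 : {for t, continuous (fun t : R => \sum_i (y - x0) 0 i * partial i (th j) (A t y))}.
      apply: continuous_sum_at => i _; apply: continuousM; first exact: cst_continuous.
      exact: cont_comp_A (Ck_continuous (Ck_partial i (Cth j)) BA).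
    have c3 : {for t, continuous (fun t : R => t)} by exact: cvg_id.
    exact: (continuousD c1 (continuousM c3 c2)).
  move: cg; apply: subspace_eq_continuous => t; rewrite inE => t01.
  have t01' : 0 <= t <= 1 by move: t01; rewrite /= in_itv.
  by have := dE _ _ I0 t01; rewrite scale0r addr0 (dq j t01' By).
have cF (t : R) : 0 <= t <= 1 -> {for t, continuous F}.
  move=> t01; apply: differentiable_continuous; apply/derivable1_diffP.
  by have [] := dF t t01.
have := @continuous_FTC2 R (fun t => partial1of2 f 0 t) F 0 1 ltr01 cd.
rewrite /Rintegral => ->.
- by rewrite /F mul1r mul0r /= subr0 /A scale1r addrC subrK.
- split.
  + by move=> t; rewrite in_itv /= => /andP[t0 t1]; have [|] := dF t; rewrite ?(ltW t0) ?(ltW t1).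
  + by apply: cvg_at_right_filter; apply: cF; rewrite lexx ler01.
  + by apply: cvg_at_left_filter; apply: cF; rewrite lexx ler01.
- move=> t; rewrite in_itv /= => /andP[t0 t1]; rewrite derive1E.
  by have [|_ ->] := dF t; rewrite ?(ltW t0) ?(ltW t1).
Qed.

Lemma poincare_ball : exists h : 'rV[R]_m -> R,
  forall y j, B y -> is_derive y (delta_mx 0 j) h (th j y).
Proof. by exists h => y j; exact: poincare_is_derive. Qed.

End Poincare.

Theorem poincare (R : realType) m (W : set 'rV[R]_m) (x0 : 'rV[R]_m)
    (th : 'I_m -> 'rV[R]_m -> R) :
  open W -> W x0 -> (forall j, Ck 1 W (th j)) ->
  (forall i j y, W y -> partial i (th j) y = partial j (th i) y) ->
  exists r : R, [/\ 0 < r, ball x0 r `<=` W & exists h : 'rV[R]_m -> R,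
    forall y j, ball x0 r y -> is_derive y (delta_mx 0 j) h (th j y)].
Proof.
move=> oW Wx0 Cth cl.
(* All summands are nonnegative, so the total dominates each local bound at once. *)
pose C := \sum_j (`|th j x0| + 1) + \sum_i \sum_j (`|partial i (th j) x0| + 1).
have near_le (f : 'rV[R]_m -> R) : {for x0, continuous f} ->
    \forall y \near x0, `|f y| < `|f x0| + 1.
  move=> cf; have cnf := continuous_comp cf (@norm_continuous _ R (f x0)).
  by apply: (cvgr_lt _ cnf); rewrite ltrDl.
have n1 : \forall y \near x0, forall j, `|th j y| < `|th j x0| + 1.
  apply: (@filter_forall _ _ (fun j y => `|th j y| < `|th j x0| + 1) (nbhs x0) _) => j.
  by apply: near_le; exact: Ck_continuous (Cth j) Wx0.
have n2 : \forall y \near x0, forall i j, `|partial i (th j) y| < `|partial i (th j) x0| + 1.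
  apply: (@filter_forall _ _ (fun i y => forall j, `|partial i (th j) y| < `|partial i (th j) x0| + 1) (nbhs x0) _) => i.
  apply: (@filter_forall _ _ (fun j y => `|partial i (th j) y| < `|partial i (th j) x0| + 1) (nbhs x0) _) => j.
  apply: near_le.
  exact: Ck_continuous (Ck_partial i (Cth j)) Wx0.
have [d /= d0 dP] := (@nbhs_ballP R _ _ _).1
  (filterI (open_nbhs_nbhs (conj oW Wx0)) (filterI n1 n2)).
pose r := Num.min d 1.
have r0 : 0 < r by rewrite lt_min d0 ltr01.
have rB : ball x0 r `<=` ball x0 d by apply: le_ball; rewrite ge_min lexx.
have BW : ball x0 r `<=` W by move=> y /rB /dP[].
have pos1 j : 0 <= `|th j x0| + 1 by rewrite addr_ge0.
have pos2 i j : 0 <= `|partial i (th j) x0| + 1 by rewrite addr_ge0.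
have le_sum1 (F : 'I_m -> R) j : (forall i, 0 <= F i) -> F j <= \sum_i F i.
  by move=> F0; rewrite (bigD1 j)//= lerDl sumr_ge0.
exists r; split=> //; apply: (@poincare_ball R m x0 r C) => //.
- by rewrite ge_min lexx orbT.
- by move=> j; exact: Ck_subset BW (Cth j).
- by move=> i j y /BW; exact: cl.
- move=> j y /rB /dP[_ [/(_ j) /ltW H _]]; apply: (le_trans H).
  rewrite (le_trans (le_sum1 _ j pos1))// lerDl sumr_ge0// => i _.
  by rewrite sumr_ge0.
- move=> i j y /rB /dP[_ [_ /(_ i j) /ltW H]]; apply: (le_trans H).
  rewrite (le_trans (le_sum1 _ j (pos2 i)))// -[leLHS]add0r lerD ?sumr_ge0//.
  by rewrite (le_sum1 (fun i => \sum_j (`|partial i (th j) x0| + 1)))// => l; rewrite sumr_ge0.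
Qed.

(** * Global primitives on simply connected spaces *)

Section Cousin.
Context {R : realType}.
Variable Q : R -> R -> Prop.

(** Induction along the interval: the supremum of the t with [Q 0 t] is attained by joining a local
    piece, and the same piece reaches beyond it unless it is 1. *)
Lemma cousin :
  (forall x, 0 <= x <= 1 -> exists2 e, 0 < e & forall a b, 0 <= a -> b <= 1 ->
     x - e < a -> a <= x -> x <= b -> b < x + e -> Q a b) ->
  (forall a b c, 0 <= a -> a <= b -> b <= c -> c <= 1 -> Q a b -> Q b c -> Q a c) ->
  Q 0 1.
Proof.
move=> loc add; pose S := [set t | 0 <= t <= 1 /\ Q 0 t].
have S0 : S 0.
  have [|e e0 H] := loc 0; first by rewrite lexx ler01.
  split; first by rewrite lexx ler01.
  by apply: H; rewrite ?lexx ?ler01 ?sub0r ?oppr_lt0 ?add0r.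
have ubS : ubound S 1 by move=> t [/andP[]].
have supS : has_sup S by split; [exists 0|exists 1].
have s0 : 0 <= sup S by apply: sup_upper_bound.
have s1 : sup S <= 1 by apply: ge_sup => //; exists 0.
have [|e e0 H] := loc (sup S); first by rewrite s0.
have [t St st] := sup_adherent e0 supS.
have ts : t <= sup S by apply: sup_upper_bound.
have [/andP[t0 t1] Qt] := St.
have key b : sup S <= b -> b <= 1 -> b < sup S + e -> S b.
  move=> sb b1 be; split; first by rewrite b1 (le_trans s0).
  by apply: (add 0 t b) => //; [exact: le_trans sb|exact: H].
have [s1'|s1'] := ltP (sup S) 1; last by have [] := key 1 s1 (lexx _) (le_lt_trans s1' (ltr_pwDr e0 (lexx _))).
pose b := Num.min 1 (sup S + e / 2).
have e20 : 0 < e / 2 by rewrite divr_gt0.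
have sb : sup S < b by rewrite lt_min s1' ltrDl.
have : S b.
  apply: key; [exact: ltW|by rewrite ge_min lexx|].
  by rewrite gt_min ltrD2l ltr_pdivrMr// ltr_pMr// ltr1n orbT.
by move/(sup_upper_bound supS); rewrite leNgt sb.
Qed.

End Cousin.

(** Being locally constant makes both the fibre of k through x and its complement relatively open in
    A. *)
Lemma connected_loc_const (S : topologicalType) (T : Type) (A : set S) (k : S -> T) :
  connected A -> (forall x, A x -> \forall y \near x, A y -> k y = k x) ->
  forall x y, A x -> A y -> k x = k y.
Proof.
move=> cA lk x y Ax Ay.
have op (c : T -> Prop) : exists2 C, open C & A `&` [set z | c (k z)] = A `&` C.
  pose C := interior [set z | A z -> c (k z)].
  exists C; first exact: open_interior.
  apply/seteqP; split=> z [Az cz]; split=> //.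
    by rewrite /C /interior /=; apply: filterS (lk z Az) => w H /H ->.
  by have := interior_subset cz; exact.
have [C oC CE] := op (fun t => t = k x).
have [C' oC' CE'] := op (fun t => t <> k x).
have BA : A `&` [set z | k z = k x] = A.
  apply: cA; first by exists x.
  - by exists C.
  - exists (~` C'); first exact: open_closedC.
    apply/seteqP; split=> z [Az kz]; split=> //.
      by move=> C'z; have : (A `&` C') z by []; rewrite -CE' => -[_].
    apply: contrapT => nk; apply: kz.
    by have : (A `&` [set z | k z <> k x]) z by []; rewrite CE' => -[].
have : (A `&` [set z | k z = k x]) y by rewrite BA.
by case.
Qed.

Lemma pair_continuousl (S T : topologicalType) (s : S) : continuous (fun t : T => (s, t)).
Proof.
move=> t A [[A1 A2] /= [n1 n2] sub]; apply: (@filterS _ (nbhs t) _ _ _ _ n2) => u A2u.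
by apply: sub; split=> //=; exact: nbhs_singleton n1.
Qed.

Lemma pair_continuousr (S T : topologicalType) (t : T) : continuous (fun s : S => (s, t)).
Proof.
move=> s A [[A1 A2] /= [n1 n2] sub]; apply: (@filterS _ (nbhs s) _ _ _ _ n1) => u A1u.
by apply: sub; split=> //=; exact: nbhs_singleton n2.
Qed.

Section SetX.
Context {S T : Type}.
Implicit Types (A B : set S) (C D : set T).

Lemma setX_Ur A C D : (A `*` C) `|` (A `*` D) = A `*` (C `|` D).
Proof. by apply/seteqP; split=> -[u v] /=; tauto. Qed.

Lemma setX_Ul A B C : (A `*` C) `|` (B `*` C) = (A `|` B) `*` C.
Proof. by apply/seteqP; split=> -[u v] /=; tauto. Qed.

Lemma setX_Ir A C D : (A `*` C) `&` (A `*` D) = A `*` (C `&` D).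
Proof. by apply/seteqP; split=> -[u v] /=; tauto. Qed.

Lemma setX_Il A B C : (A `*` C) `&` (B `*` C) = (A `&` B) `*` C.
Proof. by apply/seteqP; split=> -[u v] /=; tauto. Qed.

End SetX.

(** * Continuation of primitives along paths and homotopies *)

Section Monodromy.
Context {R : realType} {T : topologicalType}.
(* [P p h]: the function [h] is a primitive of the closed form near [p]. *)
Variable P : T -> (T -> R) -> Prop.
Hypotheses (Pex : forall p, exists h, P p h)
  (Pnear : forall p h, P p h -> \forall q \near p, P q h)
  (Puniq : forall p h1 h2, P p h1 -> P p h2 ->
     \forall q \near p, h1 q - h2 q = h1 p - h2 p)
  (Padd : forall p h c, P p h -> P p (fun q => h q + c))
  (Peq : forall p h1 h2, (\forall q \near p, h1 q = h2 q) -> P p h1 -> P p h2).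

Definition wcont (S : topologicalType) (A : set S) (H : S -> T) :=
  forall x, A x -> forall O, nbhs (H x) O -> \forall y \near x, A y -> O (H y).

Lemma wcontP (S : topologicalType) (A : set S) (H : S -> T) :
  {within A, continuous H} -> wcont A H.
Proof. by move/subspace_continuousP => cH x Ax O HO; exact: cH. Qed.

(* A continuous choice of primitive along the map [H] over the set [A]. *)
Definition primitive_along (S : topologicalType) (A : set S) (H : S -> T) (U : S -> R) :=
  forall x, A x -> exists2 h, P (H x) h & \forall y \near x, A y -> U y = h (H y).

Section Along.
Context {S : topologicalType}.
Implicit Types (A B : set S) (H : S -> T) (U V : S -> R).

Lemma primitive_along_subset A B H U : B `<=` A ->
  primitive_along A H U -> primitive_along B H U.
Proof.
move=> BA pU x /BA Ax; have [h Ph Uh] := pU x Ax; exists h => //.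
by apply: filterS Uh => y UhH /BA.
Qed.

Lemma primitive_along_eq A H H' U : (forall x, A x -> H x = H' x) ->
  primitive_along A H U -> primitive_along A H' U.
Proof.
move=> E pU x Ax; have [h Ph Uh] := pU x Ax; exists h; first by rewrite -E.
by apply: filterS Uh => y UhH Ay; rewrite -E// UhH.
Qed.

Lemma primitive_along_unique A H U V : wcont A H -> connected A ->
  primitive_along A H U -> primitive_along A H V ->
  forall x y, A x -> A y -> U x - V x = U y - V y.
Proof.
move=> cH cA pU pV; apply: connected_loc_const => // x Ax.
have [h Ph Uh] := pU x Ax; have [h' Ph' Vh] := pV x Ax.
have nh := cH x Ax _ (Puniq Ph Ph').
near=> y => Ay.
have EU : A y -> U y = h (H y) by near: y.
have EV : A y -> V y = h' (H y) by near: y.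
have Eh : A y -> h (H y) - h' (H y) = h (H x) - h' (H x) by near: y.
by rewrite EU// EV// Eh// (nbhs_singleton Uh)// (nbhs_singleton Vh).
Unshelve. all: by end_near. Qed.

(** A single primitive at [H x] remains one at nearby points, so its composition with H serves over
    every small piece. Quantifying over [B] makes this usable for all short intervals and small
    rectangles at once. *)
Lemma primitive_along_ex A H x : wcont A H -> A x ->
  exists2 O, nbhs x O & forall B, B `<=` A `&` O -> exists U, primitive_along B H U.
Proof.
move=> cH Ax; have [h Ph] := Pex (H x).
have nO := cH x Ax _ (Pnear Ph).
exists [set y | A y -> P (H y) h] => // B BO.
exists (h \o H) => y /BO[Ay Ph']; exists h; first exact: Ph'.
exact: nearW.
Qed.

Lemma primitive_along_glue A B H U V : wcont (A `|` B) H -> closed A -> closed B ->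
  A `&` B !=set0 -> connected (A `&` B) ->
  primitive_along A H U -> primitive_along B H V ->
  exists W, primitive_along (A `|` B) H W.
Proof.
move=> cH clA clB [z ABz] cAB pU pV.
have cHI : wcont (A `&` B) H.
  move=> x [Ax Bx] O HO; apply: filterS (cH x (or_introl Ax) O HO) => y Hy [Ay _].
  by apply: Hy; left.
pose c := U z - V z.
have E x : A x -> B x -> U x = V x + c.
  move=> Ax Bx; have := primitive_along_unique cHI cAB
    (primitive_along_subset (@subIsetl _ A B) pU)
    (primitive_along_subset (@subIsetr _ A B) pV) (conj Ax Bx) ABz.
  by rewrite -/c => <-; rewrite addrC subrK.
exists (fun y => if `[< A y >] then U y else V y + c) => x ABx.
have cpl (C : set S) : closed C -> ~ C x -> \forall y \near x, ~ C y.
  by move=> clC nC; apply: open_nbhs_nbhs; split => //; exact: closed_openC.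
have [Ax|nAx] := pselect (A x); have [Bx|nBx] := pselect (B x).
- have [h Ph Uh] := pU x Ax; have [h' Ph' Vh] := pV x Bx.
  have nh := cH x ABx _ (Puniq Ph Ph').
  exists h => //; near=> y => ABy.
  have EU : A y -> U y = h (H y) by near: y.
  have EV : B y -> V y = h' (H y) by near: y.
  have Eh : (A `|` B) y -> h (H y) - h' (H y) = h (H x) - h' (H x) by near: y.
  case: asboolP => Ay; first exact: EU.
  case: ABy => // By; rewrite EV// /c.
  have -> : U z - V z = h (H x) - h' (H x).
    by rewrite -(nbhs_singleton Uh)// -(nbhs_singleton Vh)// (E x Ax Bx) addrAC subrr add0r.
  by rewrite -(Eh (or_intror By)) addrC subrK.
- have [h Ph Uh] := pU x Ax; exists h => //; near=> y => ABy.
  have EU : A y -> U y = h (H y) by near: y.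
  have nB : ~ B y by near: y; exact: cpl.
  by case: ABy => // Ay; case: asboolP => // _; exact: EU.
- have [h Ph Vh] := pV x Bx; exists (fun q => h q + c); first exact: Padd.
  near=> y => ABy.
  have EV : B y -> V y = h (H y) by near: y.
  have nA : ~ A y by near: y; exact: cpl.
  by case: ABy => // By; case: asboolP => // _; rewrite EV.
- by case: ABx.
Unshelve. all: by end_near. Qed.

End Along.

Lemma primitive_along_comp (S S' : topologicalType) (A : set S) (B : set S')
    (phi : S' -> S) H U : continuous phi -> (forall y, B y -> A (phi y)) ->
  primitive_along A H U -> primitive_along B (H \o phi) (U \o phi).
Proof.
move=> cphi BA pU y /BA Ay; have [h Ph Uh] := pU _ Ay; exists h => //=.
apply: (@filterS _ (nbhs y) _ _ _ _ (cphi y _ Uh)) => z /= UhH /BA; exact: UhH.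
Qed.

Local Notation I := (`[0 : R, 1]%classic).

Lemma connected_itvcc (a b : R) : connected `[a, b]%classic.
Proof. exact/connected_intervalP/interval_is_interval. Qed.

Lemma connected_setX1l (a b s : R) : connected ([set s] `*` `[a, b]%classic).
Proof.
have -> : [set s] `*` `[a, b]%classic = (fun t => (s, t)) @` `[a, b]%classic.
  by apply/seteqP; split=> [[u v] /= [-> ?]|_ /= [v ? <-]]; [exists v|].
apply: connected_continuous_connected; first exact: connected_itvcc.
exact/continuous_subspaceT/pair_continuousl.
Qed.

Lemma connected_setX1r (a b t : R) : connected (`[a, b]%classic `*` [set t]).
Proof.
have -> : `[a, b]%classic `*` [set t] = (fun s => (s, t)) @` `[a, b]%classic.
  by apply/seteqP; split=> [[u v] /= [? ->]|_ /= [v ? <-]]; [exists u|].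
apply: connected_continuous_connected; first exact: connected_itvcc.
exact/continuous_subspaceT/pair_continuousr.
Qed.

Lemma wcont_subset (S : topologicalType) (A B : set S) H : B `<=` A -> wcont A H -> wcont B H.
Proof.
by move=> BA cH x /BA Ax O HO; apply: filterS (cH x Ax O HO) => y Hy /BA.
Qed.

Lemma itv_subI (a b : R) : 0 <= a -> b <= 1 -> `[a, b]%classic `<=` I.
Proof.
by move=> a0 b1 y; rewrite /= !in_itv /= => /andP[ay yb]; rewrite (le_trans a0 ay) (le_trans yb b1).
Qed.

Lemma itv_setU (a b c : R) : a <= b -> b <= c ->
  `[a, b]%classic `|` `[b, c]%classic = `[a, c]%classic.
Proof.
move=> ab bc; apply/seteqP; split=> y /=; rewrite !in_itv /=.
  by move=> [] /andP[h1 h2]; apply/andP; split=> //; [exact: le_trans bc|exact: le_trans h1].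
by move=> /andP[h1 h2]; have [yb|by_] := leP y b; [left|right]; rewrite ?h1 ?h2 ?(ltW by_) ?yb.
Qed.

Lemma itv_setI (a b c : R) : a <= b -> b <= c ->
  `[a, b]%classic `&` `[b, c]%classic = [set b].
Proof.
move=> ab bc; apply/seteqP; split=> y /=; rewrite !in_itv /=.
  by move=> [/andP[_ h1] /andP[h2 _]]; apply/le_anti; rewrite h1 h2.
by move=> ->; rewrite ab bc !lexx.
Qed.

Lemma closed_setX (S1 S2 : topologicalType) (A : set S1) (B : set S2) :
  closed A -> closed B -> closed (A `*` B).
Proof.
move=> cA cB; have -> : A `*` B = (fst @^-1` A) `&` (snd @^-1` B) by [].
by apply: closedI; apply: preimage_closed => //; move=> x _; [exact: cvg_fst|exact: cvg_snd].
Qed.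

Lemma path_lift (gam : R -> T) : {within I, continuous gam} ->
  exists U, primitive_along I gam U.
Proof.
move=> /wcontP cg; pose Q a b := exists U, primitive_along `[a, b]%classic gam U.
apply: (@cousin R Q) => [x x01|a b c a0 ab bc c1 [U pU] [V pV]].
  have Ix : I x by rewrite /= in_itv.
  have [N nN HN] := primitive_along_ex cg Ix.
  have [e /= e0 eN] := (@nbhs_ballP R _ _ _).1 nN.
  exists e => // a b a0 b1 xa ax xb be; apply: HN => y; rewrite /= in_itv /= => /andP[ay yb].
  split; first by rewrite in_itv /= (le_trans a0 ay) (le_trans yb b1).
  by apply: eN; rewrite /ball /= ltr_distlC (lt_le_trans xa ay) (le_lt_trans yb be).
rewrite /Q -(itv_setU ab bc); apply: primitive_along_glue pU pV; rewrite ?itv_setU ?itv_setI//.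
- by apply: wcont_subset cg; exact: itv_subI.
- exact: itv_closed.
- exact: itv_closed.
- by exists b.
- exact: connected1.
Qed.

(** The interval induction runs in the second variable around a fixed s, and the width of the strip
    is part of the induced property: gluing two rectangles keeps the smaller width. *)
Lemma strip_lift (H : R * R -> T) (s : R) : wcont (I `*` I) H -> 0 <= s <= 1 ->
  exists2 e, 0 < e & forall a b, 0 <= a -> b <= 1 -> s - e < a -> a <= s -> s <= b -> b < s + e ->
    exists U, primitive_along (`[a, b]%classic `*` I) H U.
Proof.
move=> cH s01.
pose Q c d := exists2 e, 0 < e & forall a b, 0 <= a -> b <= 1 ->
  s - e < a -> a <= s -> s <= b -> b < s + e ->
  exists U, primitive_along (`[a, b]%classic `*` `[c, d]%classic) H U.
apply: (@cousin R Q) => [t t01|c d f c0 cd df f1 [e1 e10 H1] [e2 e20 H2]].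
  have Ist : (I `*` I) (s, t) by split; rewrite /= in_itv.
  have [N nN HN] := primitive_along_ex cH Ist.
  have [e /= e0 eN] := (@nbhs_ballP R _ _ _).1 nN.
  exists e => // c d c0 d1 tc ct td de; exists e => // a b a0 b1 sa as_ sb be.
  apply: HN => -[u v] [/= uab vcd]; split.
    by split; [exact: itv_subI uab|exact: itv_subI vcd].
  move: uab vcd; rewrite !in_itv /= => /andP[au ub] /andP[cv vd].
  apply: eN; split; rewrite /ball /= ltr_distlC.
    by rewrite (lt_le_trans sa au) (le_lt_trans ub be).
  by rewrite (lt_le_trans tc cv) (le_lt_trans vd de).
exists (Num.min e1 e2); first by rewrite lt_min e10.
move=> a b a0 b1 sa as_ sb be.
have [||U pU] := H1 a b a0 b1 _ as_ sb.
- by apply: le_lt_trans sa; rewrite lerD2l lerN2 ge_min lexx.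
- by apply: (lt_le_trans be); rewrite lerD2l ge_min lexx.
have [||V pV] := H2 a b a0 b1 _ as_ sb.
- by apply: le_lt_trans sa; rewrite lerD2l lerN2 ge_min lexx orbT.
- by apply: (lt_le_trans be); rewrite lerD2l ge_min lexx orbT.
have EU : (`[a, b]%classic `*` `[c, d]%classic) `|` (`[a, b]%classic `*` `[d, f]%classic)
    = `[a, b]%classic `*` `[c, f]%classic by rewrite setX_Ur itv_setU.
have EI : (`[a, b]%classic `*` `[c, d]%classic) `&` (`[a, b]%classic `*` `[d, f]%classic)
    = `[a, b]%classic `*` [set d].
  by rewrite setX_Ir itv_setI.
rewrite -EU; apply: primitive_along_glue pU pV; rewrite ?EU ?EI.
- apply: wcont_subset cH => -[u v] [/= uab vcf]; split; [exact: itv_subI uab|exact: itv_subI vcf].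
- by apply: closed_setX; exact: itv_closed.
- by apply: closed_setX; exact: itv_closed.
- by exists (s, d); split=> //=; rewrite in_itv /= as_ sb.
- exact: connected_setX1r.
Qed.

(** A second interval induction, in the first variable, glues full strips along vertical
    segments. *)
Lemma square_lift (H : R * R -> T) : wcont (I `*` I) H ->
  exists U, primitive_along (I `*` I) H U.
Proof.
move=> cH.
apply: (@cousin R (fun a b => exists U, primitive_along (`[a, b]%classic `*` I) H U)).
  by move=> s s01; exact: strip_lift.
move=> a b c a0 ab bc c1 [U pU] [V pV].
have EU : (`[a, b]%classic `*` I) `|` (`[b, c]%classic `*` I)
    = `[a, c]%classic `*` I by rewrite setX_Ul itv_setU.
have EI : (`[a, b]%classic `*` I) `&` (`[b, c]%classic `*` I) = [set b] `*` I.
  by rewrite setX_Il itv_setI.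
rewrite -EU; apply: primitive_along_glue pU pV; rewrite ?EU ?EI.
- by apply: wcont_subset cH => -[u v] [/= uab vcf]; split=> //; exact: itv_subI uab.
- by apply: closed_setX; exact: itv_closed.
- by apply: closed_setX; exact: itv_closed.
- by exists (b, 0); split=> //=; rewrite in_itv /= lexx ler01.
- exact: connected_setX1l.
Qed.

Lemma primitive_along_const (S : topologicalType) (A : set S) q U : connected A ->
  primitive_along A (fun=> q) U -> forall x y, A x -> A y -> U x = U y.
Proof.
move=> cA pU; apply: connected_loc_const => // x Ax.
have [h Ph Uh] := pU x Ax; apply: filterS (Uh) => y /[apply] ->.
by rewrite (nbhs_singleton Uh).
Qed.

(** The homotopy is constant on three sides of the square, so a primitive along it takes the same
    value at both ends of the fourth side, where it can differ from [U] only by a constant. *)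
Lemma null_homotopic_lift (gam : R -> T) (H : R * R -> T) U :
  {within I, continuous gam} -> {within I `*` I, continuous H} ->
  (forall t, I t -> H (0, t) = gam t) -> (forall t, I t -> H (1, t) = gam 0) ->
  (forall s, I s -> H (s, 0) = gam 0 /\ H (s, 1) = gam 0) ->
  primitive_along I gam U -> U 0 = U 1.
Proof.
move=> cg cH Hl Hr Htb pU.
have [V pV] := square_lift (wcontP cH).
have I0 : I 0 by rewrite /= in_itv /= lexx ler01.
have I1 : I 1 by rewrite /= in_itv /= lexx ler01.
have cI : connected I by exact: connected_itvcc.
have pl : primitive_along I gam (fun t => V (0, t)).
  have := primitive_along_comp (B := I) (@pair_continuousl R R 0) (fun t It => conj I0 It) pV.
  by apply: primitive_along_eq => t It; exact: Hl.
have pr : primitive_along I (fun=> gam 0) (fun t => V (1, t)).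
  have := primitive_along_comp (B := I) (@pair_continuousl R R 1) (fun t It => conj I1 It) pV.
  by apply: primitive_along_eq => t It; exact: Hr.
have pb : primitive_along I (fun=> gam 0) (fun s => V (s, 0)).
  have := primitive_along_comp (B := I) (@pair_continuousr R R 0) (fun t It => conj It I0) pV.
  by apply: primitive_along_eq => t It; have [] := Htb t It.
have pt : primitive_along I (fun=> gam 0) (fun s => V (s, 1)).
  have := primitive_along_comp (B := I) (@pair_continuousr R R 1) (fun t It => conj It I1) pV.
  by apply: primitive_along_eq => t It; have [] := Htb t It.
have := primitive_along_unique (wcontP cg) cI pU pl I0 I1.
(* Around the other three sides, through (1, 0) and (1, 1). *)
have E : V (0, 0) = V (0, 1).
  rewrite (primitive_along_const cI pb I0 I1) (primitive_along_const cI pr I0 I1).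
  exact/esym/(primitive_along_const cI pt).
by rewrite E => /(congr1 (fun u => u + V (0, 1))); rewrite !subrK.
Qed.

Section Global.
Variable p0 : T.
Hypotheses
  (Tpath : forall p q : T, exists gamma : R -> T,
     [/\ {within I, continuous gamma}, gamma 0 = p & gamma 1 = q])
  (Thom : forall gamma : R -> T, {within I, continuous gamma} -> gamma 0 = gamma 1 ->
     exists H : R * R -> T,
       [/\ {within I `*` I, continuous H},
           forall t, I t -> H (0, t) = gamma t,
           forall t, I t -> H (1, t) = gamma 0 &
           forall s, I s -> H (s, 0) = gamma 0 /\ H (s, 1) = gamma 0])
  (Tlpc : forall p O, nbhs p O -> \forall q \near p, exists b : R -> T,
     [/\ {within I, continuous b}, b 0 = p, b 1 = q & forall t, I t -> O (b t)]).

Let affine (a b : R) (t : R) : R := a + t * b.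

Let affine_continuous a b : continuous (affine a b).
Proof.
move=> t; have c1 : {for t, continuous (fun=> a : R)} by exact: cst_continuous.
have c2 : {for t, continuous (fun t : R => t * b)}.
  by apply: continuousM; [exact: cvg_id|exact: cst_continuous].
exact: (continuousD c1 c2).
Qed.

Let third : R := 3^-1.
Let t0 : 0 < third. Proof. by rewrite invr_gt0. Qed.
Let t3 : third * 3 = 1. Proof. by rewrite mulVf. Qed.

Let wcont_comp (J : set R) (gam : R -> T) a b : closed J ->
  (forall t, J t -> I (affine a b t)) -> {within I, continuous gam} ->
  {within J, continuous (gam \o affine a b)}.
Proof.
move=> cJ JI /wcontP cg; apply/subspace_continuousP => t Jt O HO.
have nb := cg _ (JI _ Jt) _ HO.
apply: (@filterS _ (nbhs t) _ _ _ _ (affine_continuous nb)) => s /= Hs Js.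
by apply: Hs; exact: JI.
Qed.

(** The three sides form a loop; a primitive along it has total increment zero, and by uniqueness
    its increments over the sides are those of the given primitives. *)
Lemma triangle_lift (ga be gb : R -> T) (U V W : R -> R) :
  {within I, continuous ga} -> {within I, continuous be} -> {within I, continuous gb} ->
  ga 1 = be 0 -> be 1 = gb 1 -> ga 0 = gb 0 ->
  primitive_along I ga U -> primitive_along I be V -> primitive_along I gb W ->
  (U 1 - U 0) + (V 1 - V 0) = W 1 - W 0.
Proof.
move=> ca cb cc E1 E2 E3 pU pV pW.
have t1 : third <= 1 by have := t0; have := t3; lra.
(* The loop traverses each side in a third of the time; the slope -3 on the last third runs [gb]
   backwards. *)
pose la t := if t <= third then ga (affine 0 3 t)
  else if t <= third * 2 then be (affine (-1) 3 t) else gb (affine 3 (-3) t).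
have I0 : I 0 by rewrite /= in_itv /= lexx ler01.
have I1 : I 1 by rewrite /= in_itv /= lexx ler01.
have ea t : I t -> la (affine 0 third t) = ga t.
  rewrite /= in_itv /= => /andP[h0 h1]; rewrite /la /affine add0r ifT; last first.
    by rewrite ler_piMl// ltW.
  by rewrite add0r -mulrA t3 mulr1.
have eb t : I t -> la (affine third third t) = be t.
  rewrite /= in_itv /= => /andP[h0 h1]; rewrite /la /affine.
  have -> : -1 + (third + t * third) * 3 = t by rewrite mulrDl -mulrA t3 mulr1 addrA addNr add0r.
  have [h|h] := leP (third + t * third) third; last first.
    by rewrite ifT// -[third * 2]/(third * (1 + 1)) mulrDr mulr1 lerD2l ler_piMl// ltW.
  have -> : t = 0.
    apply/le_anti; rewrite h0 andbT; move: h; rewrite gerDl.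
    by rewrite pmulr_lle0.
  by rewrite mul0r addr0 add0r t3.
have ec t : I t -> la (affine 1 (- third) t) = gb t.
  rewrite /= in_itv /= => /andP[h0 h1]; rewrite /la /affine.
  have -> : 3 + (1 + t * - third) * -3 = t.
    have : t * third * 3 = t by rewrite -mulrA t3 mulr1.
    by lra.
  have -> : (1 + t * - third <= third) = false.
    apply/negbTE; rewrite -ltNge mulrN ltrBrDr.
    have := t0; have := t3; have : t * third <= third by rewrite ler_piMl// ltW.
    lra.
  have [h|//] := leP (1 + t * - third) (third * 2).
  have -> : t = 1.
    apply/le_anti; rewrite h1 /=.
    have : third <= t * third by have := t3; lra.
    by rewrite ler_pMl.
  have -> : -1 + (1 + 1 * - third) * 3 = 1 by have := t3; lra.
  by [].
have s1 : 0 <= third by rewrite ltW.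
have s2 : third <= third * 2 by have := t0; lra.
have s3 : third * 2 <= 1 by have := t0; have := t3; lra.
have cl : {within I, continuous la}.
  rewrite -(itv_setU (le_trans s1 s2) s3) -(itv_setU s1 s2).
  have eqw (J : set R) (f : R -> T) : {in J, f =1 la} ->
      {within J, continuous f} -> {within J, continuous la}.
    by move=> fl; exact: subspace_eq_continuous.
  apply: withinU_continuous; [|exact: itv_closed|apply: withinU_continuous; [exact: itv_closed|exact: itv_closed| |]|].
  - by apply: closedU; exact: itv_closed.
  - apply: (eqw _ (ga \o affine 0 3)).
      by move=> t; rewrite inE /= in_itv /= => /andP[_ h]; rewrite /la h.
    apply: wcont_comp ca; first exact: itv_closed.
    move=> t; rewrite /= !in_itv /= /affine add0r => /andP[h0 h1].
    by have := t3; lra.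
  - apply: (eqw _ (be \o affine (-1) 3)).
      move=> t; rewrite inE /= in_itv /= => /andP[h0 h1]; rewrite /la h1.
      have [h|//] := leP t third; have -> : t = third by apply/le_anti; rewrite h h0.
      have -> : affine (-1) 3 third = 0 by rewrite /affine; have := t3; lra.
      by have -> : affine 0 3 third = 1 by rewrite /affine; have := t3; lra.
    apply: wcont_comp cb; first exact: itv_closed.
    move=> t; rewrite /= !in_itv /= /affine => /andP[h0 h1].
    by have := t3; lra.
  - apply: (eqw _ (gb \o affine 3 (-3))).
      move=> t; rewrite inE /= in_itv /= => /andP[h0 h1]; rewrite /la.
      have -> : (t <= third) = false by apply/negbTE; rewrite -ltNge; have := t0; lra.
      have [h|//] := leP t (third * 2); have -> : t = third * 2 by apply/le_anti; rewrite h h0.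
      have -> : affine 3 (-3) (third * 2) = 1 by rewrite /affine; have := t3; lra.
      by have -> : affine (-1) 3 (third * 2) = 1 by rewrite /affine; have := t3; lra.
    apply: wcont_comp cc; first exact: itv_closed.
    move=> t; rewrite /= !in_itv /= /affine => /andP[h0 h1].
    by have := t3; lra.
have loop : la 0 = la 1.
  have := ea 0 I0; have := ec 0 I0; rewrite /affine !mul0r !addr0 => -> ->.
  exact: E3.
have [X pX] := path_lift cl.
have [H [cH Hl Hr Htb]] := Thom cl loop.
have X01 := null_homotopic_lift cl cH Hl Hr Htb pX.
have cI : connected I by exact: connected_itvcc.
have piece (f : R -> T) a b Y : (forall t, I t -> I (affine a b t)) ->
    (forall t, I t -> la (affine a b t) = f t) -> {within I, continuous f} ->
    primitive_along I f Y -> Y 1 - Y 0 = X (a + b) - X a.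
  move=> Iab ef cf pY.
  have pXf := primitive_along_eq ef (primitive_along_comp (affine_continuous (a := a) (b := b)) Iab pX).
  have := primitive_along_unique (wcontP cf) cI pY pXf I1 I0.
  rewrite /= /affine mul1r mul0r addr0 => h; lra.
rewrite (piece ga 0 third U)//; last first.
  by move=> t; rewrite /= !in_itv /= /affine add0r => /andP[h0 h1]; rewrite mulr_ge0//= mulr_ile1.
rewrite (piece be third third V)//; last first.
  move=> t; rewrite /= !in_itv /= /affine => /andP[h0 h1].
  have : t * third <= third by rewrite ler_piMl.
  have : 0 <= t * third by rewrite mulr_ge0.
  by have := t3; lra.
rewrite (piece gb 1 (- third) W)//; last first.
  move=> t; rewrite /= !in_itv /= /affine => /andP[h0 h1].
  have : t * third <= third by rewrite ler_piMl.
  have : 0 <= t * third by rewrite mulr_ge0.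
  by rewrite mulrN; have := t3; lra.
have -> : 1 - third = third + third by have := t3; lra.
rewrite add0r -X01; lra.
Qed.

(** [h p] is the increment along some chosen path from [p0] to p. The choices need not vary
    continuously: a triangle with a short third side, inside the region where k is a primitive,
    shows that h - k is constant near p. *)
Theorem global_primitive : exists h, forall p, P p h.
Proof.
have lift p : exists gU : (R -> T) * (R -> R), [/\ {within I, continuous gU.1},
    gU.1 0 = p0, gU.1 1 = p & primitive_along I gU.1 gU.2].
  have [g [cg g0 g1]] := Tpath p0 p; have [U pU] := path_lift cg.
  by exists (g, U).
have [c Hc] := choice lift.
pose h p := (c p).2 1 - (c p).2 0.
exists h => p; have [k Pk] := Pex p.
have np := Tlpc (Pnear Pk).
apply: (Peq _ (Padd (h p - k p) Pk)); apply: filterS np => q [b [cb b0 b1 bP]].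
have [cp g0 g1 pU] := Hc p; have [cq g0' g1' pU'] := Hc q.
have pb : primitive_along I b (k \o b).
  by move=> t It; exists k; [exact: bP|exact: (@filterE _ (nbhs t))].
have := triangle_lift cp cb cq (etrans g1 (esym b0)) (etrans b1 (esym g1'))
  (etrans g0 (esym g0')) pU pb pU'.
by rewrite /= b0 b1 -/(h p) -/(h q) => <-; rewrite addrCA addrA.
Qed.

End Global.

End Monodromy.

(** * The strong maximum principle *)

Section PositiveDefinite.
Context {R : realType}.

Definition posdef k (a : 'M[R]_k) := a^T = a /\ forall v : 'rV[R]_k, v != 0 -> 0 < (v *m a *m v^T) 0 0.

(** Induction on the size. The Schur complement of the corner entry is positive definite, since its
    value at v is that of [a] at v completed by the minimising first coordinate -al^-1 v w^T. *)
Lemma cholesky k (a : 'M[R]_k) : posdef a -> exists B : 'M[R]_k, a = B *m B^T.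
Proof.
elim: k a => [|k IH] a; first by exists 0; apply/matrixP => -[].
rewrite -[k.+1]/(1 + k)%N in a * => -[sa pa].
set al := a 0 0; set w : 'rV[R]_k := ursubmx a; set D : 'M[R]_k := drsubmx a.
have Eul : ulsubmx a = al%:M.
  by apply/matrixP => i j; rewrite !ord1 !mxE /al /=; congr (a _ _); apply: val_inj.
have Edl : dlsubmx a = w^T by rewrite /w trmx_ursub sa.
have Ea : a = block_mx al%:M w w^T D by rewrite -[LHS]submxK Eul Edl.
have sD : D^T = D by rewrite /D trmx_drsub sa.
have al0 : 0 < al.
  have := pa (row_mx 1%:M 0); rewrite Ea mul_row_block tr_row_mx mul_row_col.
  rewrite !mul1mx !mul0mx !trmx0 !mulmx0 !addr0 trmx1 mulmx1 mxE eqxx; apply.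
  by rewrite row_mx_eq0 negb_and oner_eq0.
have aln0 : al != 0 by rewrite gt_eqF.
have [|B' EB'] := IH (D - al^-1 *: (w^T *m w)).
  split; first by rewrite linearB linearZ /= sD trmx_mul trmxK.
  move=> v v0; have := pa (row_mx (- al^-1 *: (v *m w^T)) v).
  rewrite row_mx_eq0 negb_and v0 orbT => /(_ isT).
  rewrite Ea mul_row_block tr_row_mx mul_row_col.
  have -> : - al^-1 *: (v *m w^T) *m al%:M + v *m w^T = 0.
    by rewrite mul_mx_scalar scalerA mulrN divff// scaleN1r addNr.
  rewrite mul0mx add0r; suff -> : v *m (D - al^-1 *: (w^T *m w)) =
    - al^-1 *: (v *m w^T) *m w + v *m D by [].
  by rewrite mulmxBr -scalemxAr mulmxA -scalemxAl scaleNr addrC.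
exists (block_mx (Num.sqrt al)%:M 0 ((Num.sqrt al)^-1 *: w^T) B').
have sq : Num.sqrt al * Num.sqrt al = al by rewrite -expr2 sqr_sqrtr// ltW.
have sn0 : Num.sqrt al != 0 by rewrite gt_eqF// sqrtr_gt0.
rewrite Ea tr_block_mx mulmx_block !tr_scalar_mx !trmx0 !mul0mx !mulmx0 !addr0.
rewrite -EB' linearZ /= trmxK -scalar_mxM sq mul_scalar_mx mul_mx_scalar !scalerA divff//.
rewrite !scale1r -scalemxAl -scalemxAr scalerA -invfM sq.
by rewrite addrC subrK.
Qed.

(** With a = B B^T the contraction is the sum of the values of the quadratic form of H at the
    columns of B. *)
Lemma trace_le0 k (a : 'M[R]_k) (H : 'I_k -> 'I_k -> R) : posdef a ->
  (forall v : 'rV[R]_k, \sum_i \sum_j v 0 i * v 0 j * H i j <= 0) ->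
  \sum_i \sum_j a i j * H i j <= 0.
Proof.
move=> /cholesky[B ->] H0.
have -> : \sum_i \sum_j (B *m B^T) i j * H i j =
    \sum_l \sum_i \sum_j (row l B^T) 0 i * (row l B^T) 0 j * H i j.
  rewrite exchange_big /=; rewrite [RHS]exchange_big /=.
  rewrite exchange_big /=; apply: eq_bigr => i _; rewrite exchange_big /=.
  apply: eq_bigr => j _; rewrite mxE mulr_suml; apply: eq_bigr => l _.
  by rewrite !mxE.
by apply: sumr_le0 => l _; exact: H0.
Qed.

End PositiveDefinite.

Section PartialRules.
Context {R : realType} {k : nat}.
Implicit Types (f g : 'rV[R]_k -> R) (x : 'rV[R]_k) (i j : 'I_k).

Lemma partialD f g x i : derivable f x (delta_mx 0 i) -> derivable g x (delta_mx 0 i) ->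
  partial i (fun y => f y + g y) x = partial i f x + partial i g x.
Proof. by move=> df dg; exact: (deriveD df dg). Qed.

Lemma partialM f g x i : derivable f x (delta_mx 0 i) -> derivable g x (delta_mx 0 i) ->
  partial i (fun y => f y * g y) x = f x * partial i g x + g x * partial i f x.
Proof. by move=> df dg; exact: (deriveM df dg). Qed.

Lemma partial_cst (c : R) x i : partial i (fun=> c) x = 0.
Proof. exact: derive_cst. Qed.

Lemma partial_coord j x i : partial i (fun y : 'rV[R]_k => y 0 j) x = (i == j)%:R.
Proof.
have did : derivable (fun y : 'rV[R]_k => y) x (delta_mx 0 i) by exact: derivable_id.
have := derive_mx did; rewrite derive_id => /rowP/(_ j).
by rewrite [in RHS]mxE /partial => <-; rewrite mxE eqxx eq_sym.
Qed.

Lemma partial_sum (I : Type) (r : seq I) (F : I -> 'rV[R]_k -> R) x i :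
  (forall l, derivable (F l) x (delta_mx 0 i)) ->
  derivable (fun y => \sum_(l <- r) F l y) x (delta_mx 0 i) /\
  partial i (fun y => \sum_(l <- r) F l y) x = \sum_(l <- r) partial i (F l) x.
Proof.
move=> dF; elim: r => [|l r [d E]].
  have -> : (fun y => \sum_(l <- [::]) F l y) = fun=> 0.
    by apply/funext => y; rewrite big_nil.
  by rewrite big_nil; split; [exact: derivable_cst|exact: partial_cst].
have -> : (fun y => \sum_(m <- l :: r) F m y) = fun y => F l y + \sum_(m <- r) F m y.
  by apply/funext => y; rewrite big_cons.
rewrite big_cons (partialD (dF l) d) E; split; last by [].
exact: (derivableD (dF l) d).
Qed.

End PartialRules.

Lemma near_line (R : realType) k (x d : 'rV[R]_k) (A : set 'rV[R]_k) : nbhs x A ->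
  exists2 s : R, 0 < s & forall t, `|t| <= s -> A (x + t *: d).
Proof.
move=> nA; have cl : {for (0 : R), continuous (fun t : R => x + t *: d)}.
  by apply: continuousD; [exact: cst_continuous|exact: scalel_continuous].
have nb : nbhs (x + 0 *: d) A by rewrite scale0r addr0.
have [u /= u0 uP] := (@nbhs_ballP R _ _ _).1 (cl _ nb).
exists (u / 2); first by rewrite divr_gt0.
move=> t tu; apply: uP; rewrite -ball_normE /= sub0r normrN (le_lt_trans tu)//.
by rewrite ltr_pdivrMr// ltr_pMr// ltr1n.
Qed.

Lemma near_gt_at (R : realType) (T : topologicalType) (f : T -> R) (x : T) (c : R) :
  {for x, continuous f} -> c < f x -> nbhs x [set y | c < f y].
Proof. by move=> cf fc; exact: (cvgr_gt (f x) cf). Qed.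

Lemma near_lt_at (R : realType) (T : topologicalType) (f : T -> R) (x : T) (c : R) :
  {for x, continuous f} -> f x < c -> nbhs x [set y | f y < c].
Proof. by move=> cf fc; exact: (cvgr_lt (f x) cf). Qed.

(** * First and second derivatives at a maximum *)

Section SecondDerivativeTest.
Context {R : realType} {k : nat}.
Variables (x : 'rV[R]_k) (r : R) (v : 'rV[R]_k -> R).
Hypotheses (r0 : 0 < r) (Cv : Ck 2 (ball x r) v)
  (vmax : forall y, ball x r y -> v y <= v x).
Let B := ball x r.
Let oB : open B. Proof. exact: ball_open. Qed.
Let Bx : B x. Proof. exact: ballxx. Qed.
Let C1 : Ck 1 B v. Proof. exact: CkW. Qed.

Let small (d : 'rV[R]_k) : exists2 s : R, 0 < s & forall t, `|t| <= s -> B (x + t *: d).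
Proof. exact/near_line/open_nbhs_nbhs. Qed.

Lemma partial_at_max i : partial i v x = 0.
Proof.
have [s s0 sB] := small (delta_mx 0 i).
have D (t : R) : `|t| <= s -> is_derive t 1 (fun t : R => v (x + t *: delta_mx 0 i))
    (partial i v (x + t *: delta_mx 0 i)).
  by move=> ts; apply: is_derive_line; exact: Ck_derivable C1 (sB _ ts).
have I t : t \in `]-s, s[ -> `|t| <= s.
  by rewrite in_itv /= => ts; rewrite ltW// ltr_norml.
have s2 : - s <= s by rewrite (le_trans _ (ltW s0))// oppr_le0 ltW.
have I0 : (0 : R) \in `]-s, s[ by rewrite in_itv /= oppr_lt0 s0.
have [|t ts|_] := @derive1_at_max R (fun t : R => v (x + t *: delta_mx 0 i)) _ _ 0 s2 _ I0.
- by move=> t /I /D [].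
- by rewrite scale0r addr0; apply: vmax; apply: sB; exact: I.
have [|_ ->] := D 0; first by rewrite normr0 ltW.
by rewrite scale0r addr0.
Qed.

(** [g] and [G] are the first and second derivatives of v in direction d. If G were positive at x,
    it would be so on a short ray; the mean value theorem would then make g, and so the increment of
    v, positive there. *)
Lemma hessian_at_max (d : 'rV[R]_k) :
  \sum_i \sum_j d 0 i * d 0 j * partial i (partial j v) x <= 0.
Proof.
pose g y := \sum_j d 0 j * partial j v y.
have Cg : Ck 1 B g.
  apply: (Ck_sum _ oB) => j.
  exact: (CkM oB (Ck_cst 1 B (d 0 j : R^o)) (Ck_partial j Cv)).
have gx : g x = 0 by rewrite /g big1// => j _; rewrite partial_at_max mulr0.
pose G y := \sum_i d 0 i * partial i g y.
have GE : \sum_i \sum_j d 0 i * d 0 j * partial i (partial j v) x = G x.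
  rewrite /G; apply: eq_bigr => i _.
  have dj j : derivable (fun y => d 0 j * partial j v y) x (delta_mx 0 i).
    apply: derivableM; first exact: derivable_cst.
    exact: Ck_derivable (Ck_partial j Cv) Bx.
  have [_ ->] := partial_sum (index_enum 'I_k) dj.
  rewrite mulr_sumr; apply: eq_bigr => j _.
  have dc : derivable (fun=> d 0 j) x (delta_mx 0 i) by exact: derivable_cst.
  rewrite (partialM dc (Ck_derivable (Ck_partial j Cv) Bx)) partial_cst mulr0 addr0.
  by rewrite mulrA.
rewrite GE leNgt; apply/negP => Gpos.
have cG : {for x, continuous G}.
  apply: continuous_sum_at => i _; apply: continuousM; first exact: cst_continuous.
  exact: Ck_continuous (Ck_partial i Cg) Bx.
have [s s0 sB] := small d.
have [u u0 uP] := near_line d (near_gt_at cG Gpos).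
pose e := Num.min s u.
have e0 : 0 < e by rewrite lt_min s0.
have eB t : 0 <= t <= e -> B (x + t *: d).
  by move=> /andP[t0 te]; apply: sB; rewrite ger0_norm// (le_trans te)// ge_min lexx.
have eG t : 0 <= t <= e -> 0 < G (x + t *: d).
  by move=> /andP[t0 te]; apply: uP; rewrite ger0_norm// (le_trans te)// ge_min lexx orbT.
have gpos t : 0 < t <= e -> 0 < g (x + t *: d).
  move=> /andP[t0 te].
  have E : x + t *: d - x = t *: d by rewrite addrC addKr.
  have seg c : 0 <= c <= 1 -> 0 <= c * t <= e.
    move=> /andP[c0 c1]; rewrite mulr_ge0 ?(ltW t0)//= (le_trans _ te)//.
    by rewrite ler_piMl// ltW.
  have [c c01|c /andP[c0 c1] Ec] := @MVT_open _ _ g x (x + t *: d).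
    rewrite E scalerA; apply: diff_derivable; apply: (C1_differentiable oB Cg).
    exact: eB (seg _ c01).
  rewrite -[g _]subr0 -[X in _ - X]gx Ec E scalerA.
  have c01 : 0 <= c <= 1 by rewrite !ltW.
  rewrite (C1_derive _ oB Cg (eB _ (seg _ c01))).
  have -> : \sum_i (t *: d) 0 i * partial i g (x + (c * t) *: d) = t * G (x + (c * t) *: d).
    by rewrite /G mulr_sumr; apply: eq_bigr => i _; rewrite mxE mulrA.
  exact: mulr_gt0 t0 (eG _ (seg _ c01)).
have E : x + e *: d - x = e *: d by rewrite addrC addKr.
have seg c : 0 <= c <= 1 -> 0 <= c * e <= e.
  move=> /andP[c0 c1]; rewrite mulr_ge0 ?(ltW e0)//=.
  by rewrite ler_piMl// ltW.
have [c c01|c /andP[c0 c1] Ec] := @MVT_open _ _ v x (x + e *: d).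
  rewrite E scalerA; apply: diff_derivable; apply: (C1_differentiable oB C1).
  exact: eB (seg _ c01).
have c01 : 0 <= c <= 1 by rewrite !ltW.
have Be := eB e; rewrite lexx (ltW e0) in Be.
have := vmax (Be isT); rewrite leNgt => /negP; apply.
rewrite -subr_gt0 Ec E scalerA (C1_derive _ oB C1 (eB _ (seg _ c01))).
have -> : \sum_i (e *: d) 0 i * partial i v (x + (c * e) *: d) = e * g (x + (c * e) *: d).
  by rewrite /g mulr_sumr; apply: eq_bigr => i _; rewrite mxE mulrA.
have gc : 0 < c * e <= e by rewrite mulr_gt0//=; case/andP: (seg _ c01).
exact: mulr_gt0 e0 (gpos _ gc).
Qed.

End SecondDerivativeTest.

Section SquaredDistance.
Context {R : realType} {k : nat}.
Implicit Types x y z : 'rV[R]_k.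

(** The norm of row vectors is the maximum norm, whose balls are cubes; round spheres and a smooth
    distance call for the Euclidean square. *)
Definition sqd x y : R := \sum_i (x 0 i - y 0 i) * (x 0 i - y 0 i).

Lemma sqd_ge0 x y : 0 <= sqd x y.
Proof. by apply: sumr_ge0 => i _; rewrite -expr2 sqr_ge0. Qed.

Lemma sqdC x y : sqd x y = sqd y x.
Proof. by apply: eq_bigr => i _; rewrite -mulrNN !opprB. Qed.

Lemma sqdxx x : sqd x x = 0.
Proof. by apply: big1 => i _; rewrite subrr mul0r. Qed.

Lemma sqd_coord x y i : (x 0 i - y 0 i) ^+ 2 <= sqd x y.
Proof.
rewrite /sqd (bigD1 i)//= expr2 lerDl; apply: sumr_ge0 => j _.
by rewrite -expr2 sqr_ge0.
Qed.

Lemma sqd_gt0 x y : x != y -> 0 < sqd x y.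
Proof.
move=> xy; rewrite lt_neqAle sqd_ge0 andbT eq_sym; apply: contraNneq xy => E.
apply/eqP/rowP => i; apply/eqP; rewrite -subr_eq0 -sqrf_eq0 eq_le sqr_ge0 andbT.
by rewrite -E sqd_coord.
Qed.

Lemma sqd_triangle x y z : sqd x z <= 2 * sqd x y + 2 * sqd y z.
Proof.
rewrite /sqd !mulr_sumr -big_split /=; apply: ler_sum => i _.
rewrite -subr_ge0; move: (x 0 i) (y 0 i) (z 0 i) => a b c.
have -> : 2 * ((a - b) * (a - b)) + 2 * ((b - c) * (b - c)) - (a - c) * (a - c)
  = (a - b - (b - c)) ^+ 2 by ring.
exact: sqr_ge0.
Qed.

Lemma sqd_parallelogram x y z : let m := 2^-1 *: (y + z) in
  sqd x y = 2 * sqd x m + 2 * sqd m y - sqd x z.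
Proof.
rewrite /sqd !mulr_sumr -big_split /= -sumrB; apply: eq_bigr => i _.
by rewrite !mxE; field.
Qed.

Lemma sqd_midpoint y z : let m := 2^-1 *: (y + z) in sqd z m = sqd m y.
Proof. by apply: eq_bigr => i _; rewrite !mxE; field. Qed.

Lemma sqd_ball (d : R) x y : 0 < d -> sqd x y < d ^+ 2 -> ball x d y.
Proof.
move=> d0 xy; rewrite -ball_normE /=; apply: norm_mx_lt => // i j; rewrite ord1 !mxE.
rewrite -(@ltr_pXn2r _ 2)// ?nnegrE ?(ltW d0)// real_normK ?num_real//.
exact: le_lt_trans (sqd_coord x y j) xy.
Qed.

Lemma Ck_sqd n (y : 'rV[R]_k) : Ck n setT (fun x => sqd x y).
Proof.
have oT : open [set: 'rV[R]_k] by exact: openT.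
apply: (Ck_sum _ oT) => i.
have C := CkD oT (Ck_coord n i oT) (Ck_cst n setT (- y 0 i : R^o)).
exact: (CkM oT C C).
Qed.

Lemma sqd_continuous y : continuous (fun x => sqd x y).
Proof. by move=> x; exact: Ck_continuous (Ck_sqd 0 y) I. Qed.

End SquaredDistance.

Section Compactness.
Context {R : realType}.

Lemma closed_sublevel (T : topologicalType) (f : T -> R) c : continuous f ->
  closed [set x | f x <= c].
Proof.
move=> cf; apply: (@closed_comp _ _ f [set x | x <= c]); last exact: closed_le.
by move=> x _; exact: cf.
Qed.

Lemma cube_compact k (z : 'rV[R]_k) (d : R) : compact [set x | `|z - x| <= d].
Proof.
apply: bounded_closed_compact; last first.
  apply: closed_sublevel => x.
  have c1 : {for x, continuous (fun x : 'rV[R]_k => z - x)}.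
    by apply: continuousB; [exact: cst_continuous|exact: cvg_id].
  exact: (continuous_comp c1 (@norm_continuous _ _ _)).
exists (`|z| + d); split; first exact: num_real.
move=> e ze x /= xd; apply: le_trans (ltW ze).
by rewrite -[x](subKr z) (le_trans (ler_normB _ _))// lerD2l.
Qed.

Lemma compact_max_on k (A : set 'rV[R]_k) (f : 'rV[R]_k -> R) : compact A -> A !=set0 ->
  (forall x, A x -> {for x, continuous f}) ->
  exists2 c, A c & forall t, A t -> f t <= f c.
Proof.
move=> cA A0 cf.
have [|c cA' H] := @EVT_max_rV R k f A A0 cA.
  by apply: continuous_in_subspaceT => x; rewrite inE; exact: cf.
exists c; first by rewrite inE in cA'.
by move=> t At; apply: H; rewrite inE.
Qed.

Lemma compact_min_on k (A : set 'rV[R]_k) (f : 'rV[R]_k -> R) : compact A -> A !=set0 ->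
  (forall x, A x -> {for x, continuous f}) ->
  exists2 c, A c & forall t, A t -> f c <= f t.
Proof.
move=> cA A0 cf.
have [|c Ac H] := @compact_max_on k A (fun x => - f x) cA A0.
  by move=> x Ax; apply: continuousN; exact: cf.
by exists c => // t /H; rewrite lerN2.
Qed.

End Compactness.

(** * Hopf's barrier argument *)

Section Hopf.
Context {R : realType} {k : nat}.
Variables (a : 'rV[R]_k -> 'M[R]_k) (b : 'rV[R]_k -> 'rV[R]_k).

Definition elliptic (v : 'rV[R]_k -> R) (x : 'rV[R]_k) : R :=
  \sum_i \sum_j a x i j * partial i (partial j v) x + \sum_i b x 0 i * partial i v x.

Lemma elliptic_at_max (x : 'rV[R]_k) (r : R) (v : 'rV[R]_k -> R) : 0 < r -> Ck 2 (ball x r) v ->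
  (forall y, ball x r y -> v y <= v x) -> posdef (a x) -> elliptic v x <= 0.
Proof.
move=> r0 Cv vmax pa; rewrite /elliptic [X in _ + X]big1 ?addr0.
  by apply: (@trace_le0 _ _ _ (fun i j => partial i (partial j v) x) pa) => d; exact: (hessian_at_max r0 Cv vmax d).
by move=> i _; rewrite (partial_at_max r0 Cv vmax) mulr0.
Qed.

Lemma ellipticD (W : set 'rV[R]_k) (u w : 'rV[R]_k -> R) (c : R) x : open W -> W x ->
  Ck 2 W u -> Ck 2 W w ->
  elliptic (fun y => u y + c * w y) x = elliptic u x + c * elliptic w x.
Proof.
move=> oW Wx Cu Cw.
have Pcw i y : W y -> derivable (fun y => c * w y) y (delta_mx 0 i) /\
    partial i (fun y => c * w y) y = c * partial i w y.
  move=> Wy; have dc : derivable (fun=> c) y (delta_mx 0 i) by exact: derivable_cst.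
  have dw : derivable w y (delta_mx 0 i) by exact: Ck_derivable Cw Wy.
  split; first exact: (derivableM dc dw).
  by rewrite (partialM dc dw) partial_cst mulr0 addr0.
have P i y : W y -> partial i (fun y => u y + c * w y) y = partial i u y + c * partial i w y.
  move=> Wy; have [d <-] := Pcw i y Wy.
  exact: (partialD (Ck_derivable Cu Wy) d).
have PP i j : partial i (partial j (fun y => u y + c * w y)) x =
    partial i (partial j u) x + c * partial i (partial j w) x.
  have du : derivable (partial j u) x (delta_mx 0 i).
    exact: Ck_derivable (Ck_partial j Cu) Wx.
  have dw : derivable (partial j w) x (delta_mx 0 i).
    exact: Ck_derivable (Ck_partial j Cw) Wx.
  have dc : derivable (fun=> c) x (delta_mx 0 i) by exact: derivable_cst.
  have -> : partial i (partial j (fun y => u y + c * w y)) x =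
      partial i (fun y => partial j u y + c * partial j w y) x.
    apply: near_eq_derive; apply: filterS (open_nbhs_nbhs (conj oW Wx)) => y.
    exact: P.
  by rewrite (partialD du (derivableM dc dw)) (partialM dc dw) partial_cst mulr0 addr0.
have E1 : \sum_i \sum_j a x i j * partial i (partial j (fun y => u y + c * w y)) x =
    \sum_i \sum_j a x i j * partial i (partial j u) x +
    c * \sum_i \sum_j a x i j * partial i (partial j w) x.
  rewrite mulr_sumr -big_split /=; apply: eq_bigr => i _.
  rewrite mulr_sumr -big_split /=; apply: eq_bigr => j _.
  by rewrite PP mulrDr [a x i j * (c * _)]mulrCA.
have E2 : \sum_i b x 0 i * partial i (fun y => u y + c * w y) x =
    \sum_i b x 0 i * partial i u x + c * \sum_i b x 0 i * partial i w x.
  rewrite mulr_sumr -big_split /=; apply: eq_bigr => i _.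
  by rewrite (P i x Wx) mulrDr [b x 0 i * (c * _)]mulrCA.
have lin (p q s t : R) : p + c * q + (s + c * t) = p + s + c * (q + t).
  by rewrite mulrDr addrACA.
exact: etrans (congr2 +%R E1 E2) (lin _ _ _ _).
Qed.

Section Barrier.
Variables (y : 'rV[R]_k) (sg al : R).

Let e x := sg - sqd x y.
(** A polynomial counterpart of Hopf's exponential barrier: it vanishes on the sphere of squared
    radius [sg] about y, and for large [al] the quadratic term makes the elliptic operator positive
    on it there. *)
Definition barrier x := e x + al * (e x * e x).

Let oT : open [set: 'rV[R]_k]. Proof. exact: openT. Qed.

Let Ce n : Ck n setT e.
Proof. exact: (CkD oT (Ck_cst n setT (sg : R^o)) (CkN oT (Ck_sqd n y))). Qed.

Lemma Ck_barrier n : Ck n setT barrier.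
Proof.
exact: (CkD oT (Ce n) (CkM oT (Ck_cst n setT (al : R^o)) (CkM oT (Ce n) (Ce n)))).
Qed.

Let xi (x : 'rV[R]_k) i : R := x 0 i - y 0 i.

Let pxi x i j : derivable (fun x => xi x j) x (delta_mx 0 i) /\
  partial i (fun x => xi x j) x = (i == j)%:R.
Proof.
have d1 : derivable (fun x : 'rV[R]_k => x 0 j) x (delta_mx 0 i).
  exact: Ck_derivable (Ck_coord 1 j oT) I.
have d2 : derivable (fun _ : 'rV[R]_k => - y 0 j) x (delta_mx 0 i) by exact: derivable_cst.
split; first exact: (derivableD d1 d2).
by rewrite (partialD d1 d2) partial_cst addr0 partial_coord.
Qed.

Let pe x i : partial i e x = - 2 * xi x i.
Proof.
have dsq : derivable (fun x => sqd x y) x (delta_mx 0 i).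
  exact: Ck_derivable (Ck_sqd 1 y) I.
have dsg : derivable (fun _ : 'rV[R]_k => sg) x (delta_mx 0 i) by exact: derivable_cst.
have -> : partial i e x = - partial i (fun x => sqd x y) x.
  rewrite /partial -[LHS]/('D_(delta_mx 0 i) ((fun=> sg) - (fun x => sqd x y)) x).
  by rewrite (deriveB dsg dsq) derive_cst sub0r.
have dx j : derivable (fun x => xi x j * xi x j) x (delta_mx 0 i).
  by have [d _] := pxi x i j; exact: (derivableM d d).
have [_ E] := partial_sum (index_enum 'I_k) dx.
rewrite [X in - X]E (bigD1 i)//= big1 ?addr0.
  have [d Ed] := pxi x i i; by rewrite (partialM d d) Ed eqxx mulr1 mulNr mulr_natl mulr2n.
move=> j ji; have [d Ed] := pxi x i j; rewrite (partialM d d) Ed eq_sym (negPf ji).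
by rewrite mulr0 addr0.
Qed.

Let pw x i : partial i barrier x = (1 + 2 * al * e x) * (- 2 * xi x i).
Proof.
have de : derivable e x (delta_mx 0 i) by exact: Ck_derivable (Ce 1) I.
have dc : derivable (fun _ : 'rV[R]_k => al) x (delta_mx 0 i) by exact: derivable_cst.
rewrite (partialD de (derivableM dc (derivableM de de))).
rewrite (partialM dc (derivableM de de)) (partialM de de) partial_cst pe; ring.
Qed.

Let ppw x i j : partial i (partial j barrier) x =
  8 * al * (xi x i * xi x j) - 2 * (1 + 2 * al * e x) * (i == j)%:R.
Proof.
have -> : partial j barrier = fun x => (1 + (2 * al) * e x) * (- 2 * xi x j).
  by apply/funext => z; rewrite pw.
have de : derivable e x (delta_mx 0 i) by exact: Ck_derivable (Ce 1) I.
have c1 : derivable (fun _ : 'rV[R]_k => 1 : R) x (delta_mx 0 i) by exact: derivable_cst.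
have c2 : derivable (fun _ : 'rV[R]_k => 2 * al : R) x (delta_mx 0 i) by exact: derivable_cst.
have c3 : derivable (fun _ : 'rV[R]_k => - 2 : R) x (delta_mx 0 i) by exact: derivable_cst.
have [d Ed] := pxi x i j.
have d2 : derivable (fun x => 2 * al * e x) x (delta_mx 0 i) := derivableM c2 de.
have d1 : derivable (fun x => 1 + 2 * al * e x) x (delta_mx 0 i) := derivableD c1 d2.
have d3 : derivable (fun x => - 2 * xi x j) x (delta_mx 0 i) := derivableM c3 d.
rewrite (partialM d1 d3) (partialD c1 d2) (partialM c2 de) (partialM c3 d).
rewrite !partial_cst pe Ed; ring.
Qed.

(** An explicit formula, free of derivatives, so that its continuity and its sign at a point of the
    sphere can be read off. *)
Definition Lbarrier x := 8 * al * (\sum_i \sum_j a x i j * (xi x i * xi x j))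
  - 2 * (1 + 2 * al * e x) * (\sum_i a x i i + \sum_i b x 0 i * xi x i).

Lemma elliptic_barrier x : elliptic barrier x = Lbarrier x.
Proof.
rewrite /elliptic /Lbarrier.
have -> : \sum_i \sum_j a x i j * partial i (partial j barrier) x =
    8 * al * (\sum_i \sum_j a x i j * (xi x i * xi x j)) - 2 * (1 + 2 * al * e x) * \sum_i a x i i.
  rewrite !mulr_sumr -sumrB; apply: eq_bigr => i _.
  have -> : 2 * (1 + 2 * al * e x) * a x i i =
      \sum_j 2 * (1 + 2 * al * e x) * (a x i j * (i == j)%:R).
    rewrite (bigD1 i)//= eqxx mulr1 big1 ?addr0// => j ji.
    by rewrite eq_sym (negPf ji) !mulr0.
  rewrite mulr_sumr -sumrB; apply: eq_bigr => j _; rewrite ppw; ring.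
have -> : \sum_i b x 0 i * partial i barrier x =
    - 2 * (1 + 2 * al * e x) * \sum_i b x 0 i * xi x i.
  by rewrite mulr_sumr; apply: eq_bigr => i _; rewrite pw; ring.
by ring.
Qed.

Lemma Lbarrier_continuous x : {for x, continuous a} -> {for x, continuous b} ->
  {for x, continuous Lbarrier}.
Proof.
move=> /continuous_mxP ca /continuous_mxP cb.
have cxi i : {for x, continuous (fun x => xi x i)}.
  by apply: continuousB; [exact: coord_continuous|exact: cst_continuous].
have ce : {for x, continuous e} by exact: Ck_continuous (Ce 0) I.
have cc (c : R) : {for x, continuous (fun=> c)} by exact: cst_continuous.
have c1 : {for x, continuous (fun x => \sum_i \sum_j a x i j * (xi x i * xi x j))}.
  apply: continuous_sum_at => i _; apply: continuous_sum_at => j _.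
  exact: (continuousM (ca i j) (continuousM (cxi i) (cxi j))).
have c2 : {for x, continuous (fun x => \sum_i a x i i)}.
  by apply: continuous_sum_at => i _; exact: ca.
have c3 : {for x, continuous (fun x => \sum_i b x 0 i * xi x i)}.
  by apply: continuous_sum_at => i _; exact: (continuousM (cb 0 i) (cxi i)).
exact: (continuousB (continuousM (cc (8 * al)) c1) (continuousM (continuousM (cc 2)
  (continuousD (cc 1) (continuousM (cc (2 * al)) ce))) (continuousD c2 c3))).
Qed.

End Barrier.

Variables (W : set 'rV[R]_k) (u : 'rV[R]_k -> R).
Hypotheses (oW : open W) (Cu : Ck 2 W u)
  (ca : forall x, W x -> {for x, continuous a})
  (cb : forall x, W x -> {for x, continuous b})
  (pa : forall x, W x -> posdef (a x))
  (Lu : forall x, W x -> 0 <= elliptic u x).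

(* A sphere through the interior maximum point [z], with [u < u z] on the rest
   of the closed ball, contradicts the maximum principle for [u + eps * barrier]. *)
Lemma hopf_touching (z y : 'rV[R]_k) : W z -> z != y ->
  (forall x, W x -> u x <= u z) ->
  (forall x, W x -> x != z -> sqd x y <= sqd z y -> u x < u z) -> False.
Proof.
move=> Wz zy umax ulow; pose sg := sqd z y; have sg0 : 0 < sg by exact: sqd_gt0.
pose S2 := \sum_i \sum_j a z i j * ((z 0 i - y 0 i) * (z 0 j - y 0 j)).
have S20 : 0 < S2.
  have := (pa Wz).2 (z - y); rewrite subr_eq0 => /(_ zy).
  rewrite mxE => H; rewrite (lt_le_trans H)// le_eqVlt; apply/orP; left; apply/eqP.
  rewrite /S2 exchange_big /=; apply: eq_bigr => j _.
  rewrite !mxE mulr_suml; apply: eq_bigr => i _; rewrite !mxE; ring.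
pose S1 := \sum_i a z i i + \sum_i b z 0 i * (z 0 i - y 0 i).
(* At z, on the sphere, the operator applied to the barrier equals 8 al S2 - 2 S1, which becomes 8
   (1 + |S1|) - 2 S1 > 0. *)
pose al := (1 + `|S1|) / S2.
have al0 : 0 < al by rewrite divr_gt0// ltr_pwDl.
have Lz : 0 < Lbarrier y sg al z.
  rewrite /Lbarrier -/S2 -/S1 /sg subrr mulr0 addr0 mulr1 /al -mulrA divfK ?gt_eqF//.
  by have := ler_norm S1; have := normr_ge0 S1; lra.
have cL : {for z, continuous (Lbarrier y sg al)}.
  by apply: Lbarrier_continuous; [exact: ca|exact: cb].
have ce : {for z, continuous (fun x => al * (sqd x y - sg))}.
  apply: continuousM; first exact: cst_continuous.
  by apply: continuousB; [exact: sqd_continuous|exact: cst_continuous].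
have e1 : al * (sqd z y - sg) < 1 by rewrite /sg subrr mulr0.
have [d0 /= d00 dP] := (@nbhs_ballP R _ _ _).1 (filterI (open_nbhs_nbhs (conj oW Wz))
  (filterI (near_gt_at cL Lz) (near_lt_at ce e1))).
pose d := d0 / 2.
have dd : 0 < d by rewrite divr_gt0.
have dP' x : `|z - x| <= d -> [/\ W x, 0 < Lbarrier y sg al x & al * (sqd x y - sg) < 1].
  move=> zx; have [|? []] := dP x; last by [].
  by rewrite -ball_normE /= (le_lt_trans zx)// ltr_pdivrMr// ltr_pMr// ltr1n.
pose w := barrier y sg al.
have Cw : Ck 2 W w by apply: (@Ck_subset _ _ _ _ setT) => //; exact: Ck_barrier.
have wz : w z = 0 by rewrite /w /barrier /sg subrr !mulr0 addr0.
(* Far outside the ball the square term would win; the last bound in [dP'] excludes this on the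
   small cube. *)
have w_neg x : `|z - x| <= d -> sg < sqd x y -> w x < 0.
  move=> /dP'[_ _ h1] h2.
  have -> : w x = - ((sqd x y - sg) * (1 - al * (sqd x y - sg))).
    by rewrite /w /barrier; ring.
  by rewrite oppr_lt0 mulr_gt0// subr_gt0.
have cu x : `|z - x| <= d -> {for x, continuous u}.
  by move=> /dP'[Wx _ _]; exact: Ck_continuous Cu Wx.
have cw x : {for x, continuous w} by exact: Ck_continuous (Ck_barrier y sg al 0) I.
(* The part of the boundary of the cube inside the closed Euclidean ball; the negated norms present
   the reverse inequality as a sublevel set, hence closed. *)
pose Sp := [set x : 'rV[R]_k | `|z - x| <= d] `&` ([set x | - `|z - x| <= - d] `&` [set x | sqd x y <= sg]).
have cnorm : continuous (fun x : 'rV[R]_k => `|z - x|).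
  move=> x; have c1 : {for x, continuous (fun x : 'rV[R]_k => z - x)}.
    by apply: continuousB; [exact: cst_continuous|exact: cvg_id].
  exact: (continuous_comp c1 (@norm_continuous _ _ _)).
have cSp : compact Sp.
  apply: (@subclosed_compact _ _ [set x : 'rV[R]_k | `|z - x| <= d]); last by move=> x [].
    apply: closedI; first exact: closed_sublevel.
    apply: closedI; last by apply: closed_sublevel; exact: sqd_continuous.
    by apply: closed_sublevel => x; exact: (continuousN (cnorm x)).
  exact: cube_compact.
have [eta eta0 etaP] : exists2 eta, 0 < eta & forall x, Sp x -> u x <= u z - eta.
  have [Sp0|nSp] := pselect (Sp !=set0); last first.
    by exists 1 => // x Sx; case: nSp; exists x.
  have [|c [/= c1 [/= c2 c3]] cmax] := compact_max_on cSp Sp0 (f := u).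
    by move=> x [/= zx _]; exact: cu.
  exists (u z - u c); last by move=> x /cmax; rewrite subKr.
  rewrite subr_gt0; apply: ulow => //; first by have [] := dP' c c1.
  by apply: contraTneq c2 => ->; rewrite subrr normr0 oppr0 -ltNge oppr_lt0.
have w_ub x : Sp x -> w x <= 2 * sg + al * (sg * sg).
  move=> [_ [_ /= xs]]; rewrite /w /barrier.
  have h0 : 0 <= sg - sqd x y by rewrite subr_ge0.
  have h1 : sg - sqd x y <= sg by rewrite gerBl sqd_ge0.
  apply: lerD; first by rewrite (le_trans h1)// ler_peMl ?ler1n// ltW.
  by rewrite ler_pM2l// ler_pM.
pose B := 2 * sg + al * (sg * sg).
have B0 : 0 < B by apply: addr_gt0; apply: mulr_gt0 => //; exact: mulr_gt0.
(* The perturbation then uses up at most half of the gap [eta] on [Sp]. *)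
pose eps := eta / (2 * B).
have eps0 : 0 < eps by rewrite divr_gt0// mulr_gt0.
pose v x := u x + eps * w x.
have vz : v z = u z by rewrite /v wz mulr0 addr0.
have zz : `|z - z| <= d by rewrite subrr normr0 ltW.
have [||x0 /= x0d x0max] := compact_max_on (@cube_compact R k z d) (f := v).
- by exists z.
- move=> x /= zx; apply: continuousD; first exact: cu.
  by apply: continuousM; [exact: cst_continuous|exact: cw].
have vx0 : u z <= v x0 by rewrite -vz; exact: x0max.
have [Wx0 Lx0 _] := dP' _ x0d.
(* On the boundary of the cube v stays below v z = u z: by the gap on [Sp], and by the negative
   barrier elsewhere. So the maximum of v over the cube is interior. *)
have x0lt : `|z - x0| < d.
  rewrite ltNge; apply/negP => dx0.
  have [xs|xs] := leP (sqd x0 y) sg.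
    have Spx : Sp x0 by split=> //; split=> //=; rewrite lerN2.
    have h1 := etaP _ Spx; have h2 := w_ub _ Spx.
    have h3 : eps * w x0 <= eta / 2.
      apply: (@le_trans _ _ (eps * B)); first by rewrite ler_pM2l.
      by rewrite /eps invfM mulrA divfK// gt_eqF.
    by move: vx0; rewrite /v; move: h1 h3 eta0; move: (u x0) (eps * w x0) => p q; lra.
  have h1 := w_neg _ x0d xs.
  have h2 : eps * w x0 < 0 by rewrite pmulr_rlt0.
  have h3 := umax _ Wx0.
  by move: vx0; rewrite /v; move: h2 h3; move: (u x0) (eps * w x0) => p q; lra.
pose r := d - `|z - x0|.
have r0 : 0 < r by rewrite subr_gt0.
have rB x : ball x0 r x -> `|z - x| <= d.
  rewrite -ball_normE /= => xr; rewrite -(subrKA x0) (le_trans (ler_normD _ _))//.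
  by rewrite addrC -lerBrDr ltW.
have rW : ball x0 r `<=` W by move=> x /rB /dP'[].
have Cv : Ck 2 W v.
  exact: (CkD oW Cu (CkM oW (Ck_cst 2 W (eps : R^o)) Cw)).
have := elliptic_at_max r0 (Ck_subset rW Cv) (fun x Bx => x0max x (rB x Bx)) (pa Wx0).
rewrite leNgt => /negP; apply.
rewrite (ellipticD eps oW Wx0 Cu Cw) elliptic_barrier.
by apply: ltr_wpDl; [exact: Lu|exact: mulr_gt0].
Qed.

(** If u were smaller at a point y close to x0, then among the maximum points there would be one, z,
    nearest to y, and a ball touching the set of maximum points only at z contradicts
    [hopf_touching]. *)
Theorem strong_maximum_principle (x0 : 'rV[R]_k) : W x0 ->
  (forall x, W x -> u x <= u x0) -> \forall x \near x0, u x = u x0.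
Proof.
move=> Wx0 umax.
have [d /= d0 dW] := (@nbhs_ballP R _ _ _).1 (open_nbhs_nbhs (conj oW Wx0)).
(* The bound 4 r2 on the squared distance means Euclidean radius 2 d / 3 < d, so it still gives
   points of W. The factor 4 comes from [sqd_triangle], applied to x, y and x0 below. *)
pose r2 := (d / 3) ^+ 2.
have r20 : 0 < r2 by rewrite exprn_gt0// divr_gt0.
have r2d : 4 * r2 < d ^+ 2.
  have d2 : 0 < d ^+ 2 by rewrite exprn_gt0.
  by have -> : r2 = d ^+ 2 / 9 by [rewrite /r2; field]; lra.
have inW x : sqd x x0 <= 4 * r2 -> W x.
  by move=> xr; apply: dW; apply: sqd_ball => //; rewrite sqdC (le_lt_trans xr).
have s0 : sqd x0 x0 < r2 by rewrite sqdxx.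
apply: filterS (near_lt_at (@sqd_continuous R k x0 x0) s0) => y /= yr.
apply/eqP/negPn/negP => uy.
have Wy : W y by apply: inW; apply: ltW (lt_le_trans yr _); rewrite ler_peMl ?ler1n// ltW.
have {}uy : u y < u x0 by rewrite lt_neqAle uy umax.
pose K := [set x | sqd x x0 <= 4 * r2].
have clK : closed K by apply: closed_sublevel; exact: sqd_continuous.
have cK : compact K.
  apply: (subclosed_compact clK (@cube_compact R k x0 d)) => x /= xr.
  have : ball x0 d x by apply: sqd_ball => //; rewrite sqdC (le_lt_trans xr).
  by rewrite -ball_normE => /ltW.
pose Z := K `&` [set x | u x = u x0].
have clZ : closed Z.
  rewrite -openC openE => x nZ; rewrite /interior.
  have [Kx|nK] := pselect (K x); last first.
    have : nbhs x (~` K) by apply: open_nbhs_nbhs; split=> //; exact: closed_openC.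
    by apply: filterS => x' nK' [].
  have {}nZ : u x != u x0 by apply/eqP => E; apply: nZ.
  have cux := Ck_continuous Cu (inW _ Kx).
  have lt1 : u x < u x0 by rewrite lt_neqAle nZ umax//; exact: inW.
  apply: filterS (near_lt_at cux lt1) => x' /= h [_ /= E].
  by move: h; rewrite E ltxx.
have cZ : compact Z by apply: (subclosed_compact clZ cK) => x [].
have Zx0 : Z x0 by split=> //; rewrite /K /= sqdxx mulr_ge0// ltW.
have [||z [Kz /= uz] zmin] := compact_min_on cZ _ (f := fun x => sqd x y).
- by exists x0.
- by move=> x _; exact: sqd_continuous.
have Wz := inW _ Kz.
have zy : z != y by apply: contraTneq uy => <-; rewrite uz ltxx.
have zyr : sqd z y < r2 by rewrite (le_lt_trans (zmin _ Zx0))// sqdC.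
(* Other maximum points may be as near to y as z is. The half-size ball centred at the midpoint of y
   and z touches the larger sphere at z alone. *)
pose y' := 2^-1 *: (y + z).
apply: (@hopf_touching z y') => //.
- apply: contraNneq zy => E; apply/eqP/rowP => i.
  by have /rowP/(_ i) := E; rewrite !mxE; lra.
- by move=> x Wx; rewrite uz; exact: umax.
move=> x Wx xz xs; rewrite uz.
have P := sqd_parallelogram x y z; have Pz := sqd_parallelogram z y z.
have M := sqd_midpoint y z.
rewrite /= -/y' in P Pz M.
have xz0 : 0 < sqd x z by exact: sqd_gt0.
rewrite sqdxx subr0 in Pz.
have xy : sqd x y < sqd z y by lra.
have Kx : K x.
  have := sqd_triangle x y x0; rewrite /K /=; lra.
rewrite lt_neqAle umax// andbT; apply/eqP => E.
by have := zmin x (conj Kx E); rewrite leNgt xy.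
Qed.

End Hopf.

(** * Charts and coordinate representatives *)

Section Inverse.
Context {R : realType} {m : nat}.

Lemma Ck_det p k (U : set 'rV[R]_m) (A : 'rV[R]_m -> 'M[R]_p) : open U ->
  Ck k U A -> Ck k U (fun x => \det (A x)).
Proof.
move=> oU CA; have Aij := (Ck_mxP k A oU).1 CA.
apply: (Ck_sum _ oU) => s.
have C1 := Ck_cst k U ((-1) ^+ s : R^o).
have C2 := Ck_prod (index_enum 'I_p) oU (fun i => Aij i (s i)).
by have := CkM oU C1 C2; apply: (eq_Ck oU) => x _.
Qed.

Lemma Ck_adj p k (U : set 'rV[R]_m) (A : 'rV[R]_m -> 'M[R]_p) : open U ->
  Ck k U A -> Ck k U (fun x => \adj (A x)).
Proof.
move=> oU CA; have Aij := (Ck_mxP k A oU).1 CA.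
apply/(Ck_mxP _ _ oU) => i j.
have Cd : Ck k U (fun x => row' j (col' i (A x))).
  apply/(Ck_mxP _ _ oU) => i' j'.
  by apply: (eq_Ck oU _ (Aij (lift j i') (lift i j'))) => x _; rewrite !mxE.
have C1 := Ck_cst k U ((-1) ^+ (j + i) : R^o).
by apply: (eq_Ck oU _ (CkM oU C1 (Ck_det oU Cd))) => x _; rewrite mxE.
Qed.

(** Cramer's rule: adjugate over determinant, both polynomial in the entries. *)
Lemma Ck_invmx p k (U : set 'rV[R]_m) (A : 'rV[R]_m -> 'M[R]_p) : open U ->
  (forall x, U x -> A x \in unitmx) -> Ck k U A -> Ck k U (fun x => invmx (A x)).
Proof.
move=> oU uA CA; apply/(Ck_mxP _ _ oU) => i j.
have d0 x : U x -> \det (A x) != 0 by move/uA; rewrite unitmxE unitfE.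
have Cij := (Ck_mxP _ _ oU).1 (Ck_adj oU CA) i j.
apply: (eq_Ck oU _ (CkM oU (CkV oU d0 (Ck_det oU CA)) Cij)) => x /uA u.
by rewrite /invmx u [RHS]mxE.
Qed.

Lemma posdef_unit p (A : 'M[R]_p) : posdef A -> A \in unitmx.
Proof.
move=> [_ pA]; rewrite -row_free_unit; apply: inj_row_free => v vA.
by apply/eqP/negPn/negP => /pA; rewrite vA mul0mx mxE ltxx.
Qed.

Lemma posdef_inv p (A : 'M[R]_p) : posdef A -> posdef (invmx A).
Proof.
move=> pA; have uA := posdef_unit pA; have [sA lA] := pA.
split=> [|v v0]; first by rewrite trmx_inv sA.
have w0 : v *m invmx A != 0.
  by apply: contraNneq v0 => E; rewrite -[v]mulmx1 -(mulVmx uA) mulmxA E mul0mx.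
by have := lA _ w0; rewrite trmx_mul trmx_inv sA -!mulmxA (mulmxA A) mulmxV// mul1mx mulmxA.
Qed.

Lemma posdef_pullback p q (J : 'M[R]_(p, q)) (A : 'M[R]_q) : row_free J -> posdef A ->
  posdef (J *m A *m J^T).
Proof.
move=> fJ [sA lA]; split=> [|v v0]; first by rewrite !trmx_mul trmxK sA mulmxA.
have w0 : v *m J != 0.
  apply: contraNneq v0 => E; apply/eqP; apply: (row_free_inj fJ).
  by rewrite E mul0mx.
by have := lA _ w0; rewrite trmx_mul !mulmxA.
Qed.

End Inverse.

Lemma open_nearP (T : topologicalType) (A : set T) :
  (forall t, A t -> \forall u \near t, A u) -> open A.
Proof. by move=> H; rewrite openE => t At; exact: H. Qed.

Section Charts.
Context {R : realType} {n : nat} {M : manifold R n}.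
Implicit Types (c d : chart_index M) (x : 'rV[R]_n) (p : M).

Lemma chart_img_chart c p : chart_dom c p -> chart_img c (chart c p).
Proof. by move=> cp; exists p. Qed.

Lemma chart_inv_dom c x : chart_img c x -> chart_dom c (chart_inv c x).
Proof. by move=> [p cp <-]; rewrite chartK. Qed.

Lemma chart_invK c x : chart_img c x -> chart c (chart_inv c x) = x.
Proof. by move=> [p cp <-]; rewrite chartK. Qed.

Lemma chart_img_nbhs c x (O : set M) : chart_img c x -> nbhs (chart_inv c x) O ->
  \forall y \near x, chart_img c y /\ O (chart_inv c y).
Proof.
move=> cx nO; have n1 : nbhs x (chart_img c).
  by apply: open_nbhs_nbhs; split=> //; exact: chart_img_open.
have n2 : nbhs x (chart_inv c @^-1` O) := chart_inv_continuous cx nO.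
exact: (filterI n1 n2).
Qed.

Lemma chart_dom_nbhs c p (O : set 'rV[R]_n) : chart_dom c p -> nbhs (chart c p) O ->
  \forall q \near p, chart_dom c q /\ O (chart c q).
Proof.
move=> cp nO; have n1 : nbhs p (chart_dom c).
  by apply: open_nbhs_nbhs; split=> //; exact: chart_dom_open.
have n2 : nbhs p (chart c @^-1` O) := chart_continuous cp nO.
exact: (filterI n1 n2).
Qed.

End Charts.

Section Representatives.
Context {R : realType} {m n : nat} {N : manifold R m} {M : manifold R n}.
Implicit Types (f : N -> M) (c : chart_index N) (d : chart_index M) (x : 'rV[R]_m).

Lemma rep_domP f c d x :
  rep_dom f c d x <-> chart_img c x /\ chart_dom d (f (chart_inv c x)).
Proof.
split=> [[p [cp dp] <-]|[[p cp <-]]].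
  by rewrite chartK//; split=> //; exists p.
by rewrite chartK// => dp; exists p.
Qed.

Lemma rep_dom_open f c d : continuous f -> open (rep_dom f c d).
Proof.
move=> cf; apply: open_nearP => x /rep_domP[cx dx].
have nd : nbhs (chart_inv c x) (f @^-1` chart_dom d).
  exact: (cf _ _ (open_nbhs_nbhs (conj (chart_dom_open d) dx))).
by apply: filterS (chart_img_nbhs cx nd) => y h; apply/rep_domP.
Qed.

Lemma rep_img f c d x : rep_dom f c d x -> chart_img d (rep f c d x).
Proof. by move=> /rep_domP[_]; exact: chart_img_chart. Qed.

Lemma repK f c d x : rep_dom f c d x -> chart_inv d (rep f c d x) = f (chart_inv c x).
Proof. by move=> /rep_domP[_ dx]; rewrite /rep /= chartK. Qed.

Lemma rep_dom_chart f c d p : chart_dom c p -> chart_dom d (f p) -> rep_dom f c d (chart c p).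
Proof. by move=> cp dp; exists p. Qed.

End Representatives.

Section Transitions.
Context {R : realType} {n : nat} {M : manifold R n}.
Implicit Types (c d e : chart_index M) (x : 'rV[R]_n).

Notation T := (@rep R n n M M idfun).
Notation Tdom := (@rep_dom R n n M M idfun).

Lemma transition_open c d : open (Tdom c d).
Proof. by apply: rep_dom_open => x; exact: cvg_id. Qed.

Lemma transition_Ck k c d : Ck k (Tdom c d) (T c d).
Proof. exact: transition_smooth. Qed.

Lemma transition_domC c d x : Tdom c d x -> Tdom d c (T c d x).
Proof.
move=> Tx; have [cx dx] := (rep_domP _ _ _ _).1 Tx; apply/rep_domP.
by split; [exact: rep_img|rewrite repK//; exact: chart_inv_dom].
Qed.

Lemma transitionK c d x : Tdom c d x -> T d c (T c d x) = x.
Proof.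
move=> Tx; have [cx dx] := (rep_domP _ _ _ _).1 Tx.
by rewrite {1}/rep /= repK// /= chart_invK.
Qed.

End Transitions.

(** * The closed form theta and its potential *)

Section MatrixRules.
Context {R : realType} {m : nat}.

Lemma partial_mulmx p q r (U : set 'rV[R]_m) (A : 'rV[R]_m -> 'M[R]_(p, q))
    (B : 'rV[R]_m -> 'M[R]_(q, r)) x i : open U -> Ck 1 U A -> Ck 1 U B -> U x ->
  partial i (fun y => A y *m B y) x = partial i A x *m B x + A x *m partial i B x.
Proof.
move=> oU CA CB Ux; apply/matrixP => s t.
rewrite (partial_mxE i s t (Ck_mulmx oU CA CB) Ux).
have -> : (fun y => (A y *m B y) s t) = fun y => \sum_l A y s l * B y l t.
  by apply/funext => y; rewrite mxE.
have dA l := Ck_derivable (i := i) ((Ck_mxP 1 A oU).1 CA s l) Ux.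
have dB l := Ck_derivable (i := i) ((Ck_mxP 1 B oU).1 CB l t) Ux.
have [_ ->] := partial_sum (index_enum 'I_q) (fun l => derivableM (dA l) (dB l)).
rewrite !mxE -big_split /=; apply: eq_bigr => l _.
rewrite (partialM (dA l) (dB l)) (partial_mxE i s l CA Ux) (partial_mxE i l t CB Ux).
by rewrite addrC; congr (_ + _); rewrite mulrC.
Qed.

Lemma partial_trmx p q (U : set 'rV[R]_m) (A : 'rV[R]_m -> 'M[R]_(p, q)) x i :
  open U -> Ck 1 U A -> U x -> partial i (fun y => (A y)^T) x = (partial i A x)^T.
Proof.
move=> oU CA Ux; apply/matrixP => s t.
rewrite (partial_mxE i s t (Ck_trmx oU CA) Ux) mxE (partial_mxE i t s CA Ux).
by congr (partial i _ x); apply/funext => y; rewrite mxE.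
Qed.

Lemma C1_derive_mx p q (U : set 'rV[R]_m) (A : 'rV[R]_m -> 'M[R]_(p, q)) x v :
  open U -> Ck 1 U A -> U x -> 'D_v A x = \sum_i v 0 i *: partial i A x.
Proof.
move=> oU CA Ux; have dA := C1_differentiable_mx oU CA Ux.
rewrite (deriveE _ dA) {1}[v]row_sum_delta linear_sum /=.
by apply: eq_bigr => i _; rewrite linearZ /= /partial (deriveE _ dA).
Qed.

Lemma partialC_mx p q (U : set 'rV[R]_m) (A : 'rV[R]_m -> 'M[R]_(p, q)) x i j :
  open U -> Ck 2 U A -> U x -> partial i (partial j A) x = partial j (partial i A) x.
Proof.
move=> oU CA Ux; apply/matrixP => s t.
have E k l : partial k (partial l A) x s t = partial k (partial l (fun y => A y s t)) x.
  rewrite (partial_mxE k s t (Ck_partial l CA) Ux); apply: near_eq_derive.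
  apply: filterS (open_nbhs_nbhs (conj oU Ux)) => y Uy.
  exact: (partial_mxE l s t (CkW CA) Uy).
have S := partialC i j oU ((Ck_mxP 2 A oU).1 CA s t) Ux.
exact: etrans (E i j) (etrans S (esym (E j i))).
Qed.

End MatrixRules.

(* Pointwise algebra in a chart: [k] = K, [G] = g, [pg l] = d_l g, [Q] = D_K g,
   [Jk] = dK, [w] = flat K, [Om] = dw, [ph] = |K|^2, [Th] = d(w / ph), with
   derivatives indexed by rows. *)
Section FormAlgebra.
Context {R : realType} {n : nat}.
Variables (k w dph : 'rV[R]_n) (ph : R) (G Jk Om Th Q : 'M[R]_n) (pg : 'I_n -> 'M[R]_n).
Hypotheses (GT : G^T = G) (pgT : forall i, (pg i)^T = pg i) (wG : w = k *m G)
  (uG : G \in unitmx)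
  (rOm : forall i, row i Om = row i Jk *m G + k *m pg i)
  (QE : Q = \sum_l k 0 l *: pg l)
  (killE : Q + Jk *m G + G *m Jk^T = 0)
  (wE : w *m k^T = ph%:M) (phn0 : ph != 0)
  (rdph : forall j, dph 0 j = (row j Om *m k^T + w *m (row j Jk)^T) 0 0)
  (rTh : forall i, row i Th = ph^-1 *: row i Om - (ph ^- 2 * dph 0 i) *: w).

Let P : 'M[R]_n := \matrix_i (k *m pg i).
Let th := ph^-1 *: w.

Let OmE : Om = Jk *m G + P.
Proof. by apply/row_matrixP => i; rewrite rOm linearD /= row_mul rowK. Qed.

Let QT : Q^T = Q.
Proof. by rewrite QE linear_sum; apply: eq_bigr => l _; rewrite linearZ /= pgT. Qed.

Let kP : k *m P = k *m Q.
Proof.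
rewrite mulmx_sum_row QE mulmx_sumr; apply: eq_bigr => i _.
by rewrite rowK scalemxAr.
Qed.

Let dphE : dph = k *m Om^T + w *m Jk^T.
Proof.
apply/rowP => j; rewrite rdph !mxE; congr (_ + _); apply: eq_bigr => i _; rewrite !mxE //.
by rewrite mulrC.
Qed.

(** The Lie derivative of w along K vanishes, because K preserves both g and itself. *)
Let lieE : k *m Om + w *m Jk^T = 0.
Proof.
rewrite OmE mulmxDr kP wG -mulmxA [k *m (Jk *m G) + _]addrC.
by rewrite -mulmxDr -mulmxDr killE mulmx0.
Qed.

(** Cartan's formula: contracting dw with K gives minus the differential of w(K) = |K|^2. *)
Let kA : k *m (Om - Om^T) = - dph.
Proof.
rewrite mulmxBr dphE opprD addrC; congr (_ + _).
  by apply/eqP; rewrite -addr_eq0 lieE.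
Qed.

Let ThE : Th = ph^-1 *: Om - ph ^- 2 *: (dph^T *m w).
Proof.
apply/matrixP => i j; have := congr1 (fun r : 'rV_n => r 0 j) (rTh i).
by rewrite !mxE big_ord1 mxE mulrA.
Qed.

Let ThT : Th^T = ph^-1 *: Om^T - ph ^- 2 *: (w^T *m dph).
Proof.
by apply/matrixP => i j; rewrite ThE !mxE !big_ord1 !mxE [w 0 i * _]mulrC.
Qed.

(** The Killing equation says that the symmetrised covariant derivative of w is zero; in terms of
    theta this is the equality [CE]. What remains of the derivative of theta = w / ph comes from the
    factor 1 / ph alone. *)
Lemma hessian_algebra (Gam : 'I_n -> 'I_n -> 'rV[R]_n) :
  (forall i j r, Gam i j 0 r = 2^-1 * \sum_l invmx G r l * (pg i j l + pg j i l - pg l i j)) ->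
  let C := \matrix_(i, j) (Gam i j *m th^T) 0 0 in
  Th + Th^T - (C + C^T) = - (ph^-1 *: (dph^T *m th + th^T *m dph)).
Proof.
move=> GamE C; have CE : C + C^T = ph^-1 *: (Om + Om^T).
  have C'E i j : (Gam i j *m w^T) 0 0 = 2^-1 * (P i j + P j i - Q i j).
    rewrite mxE.
    have -> : \sum_l Gam i j 0 l * w^T l 0 =
      2^-1 * \sum_l (\sum_r w 0 r * invmx G r l) *
        (pg i j l + pg j i l - pg l i j).
      rewrite mulr_sumr.
      under [RHS]eq_bigr => l _ do rewrite mulr_suml mulr_sumr.
      rewrite exchange_big /=; apply: eq_bigr => r _.
      by rewrite GamE mxE -mulrA mulr_suml mulr_sumr; apply: eq_bigr => l _; ring.
    congr (_ * _).
    have kE l : \sum_r w 0 r * invmx G r l = k 0 l.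
      have -> : \sum_r w 0 r * invmx G r l = (w *m invmx G) 0 l by rewrite mxE.
      by rewrite wG mulmxK.
    under eq_bigr => l _ do rewrite kE mulrBr mulrDr.
    rewrite big_split /= sumrN big_split /=.
    have PE a b : P a b = \sum_l k 0 l * pg a b l.
      rewrite mxE mxE; apply: eq_bigr => l _; congr (_ * _).
      by rewrite -[in RHS]pgT mxE.
    rewrite -!PE; congr (_ - _).
    by rewrite QE summxE; apply: eq_bigr => l _; rewrite mxE.
  apply/matrixP => i j; rewrite !mxE.
  have thE (v : 'rV[R]_n) : (v *m th^T) 0 0 = ph^-1 * (v *m w^T) 0 0.
    by rewrite /th linearZ /= -scalemxAr mxE.
  have E1 : \sum_l Gam i j 0 l * th^T l 0 = ph^-1 * (2^-1 * (P i j + P j i - Q i j)).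
    by rewrite -C'E -thE mxE.
  have E2 : \sum_l Gam j i 0 l * th^T l 0 = ph^-1 * (2^-1 * (P j i + P i j - Q i j)).
    have QJI : Q i j = Q j i by rewrite -[in LHS]QT mxE.
    by rewrite QJI -C'E -thE mxE.
  rewrite E1 E2 -mulrDr; congr (_ * _).
  have ad (A B : 'M[R]_n) a b : (A + B) a b = A a b + B a b by rewrite mxE.
  have tE : (G *m Jk^T) i j = (Jk *m G) j i.
    have -> : G *m Jk^T = (Jk *m G)^T by rewrite trmx_mul GT.
    by rewrite mxE.
  have := congr1 (fun A : 'M[R]_n => A i j) killE; rewrite /= !ad tE [RHS]mxE OmE !ad.
  move: (P i j) (P j i) (Q i j) ((Jk *m G) i j) ((Jk *m G) j i) => p p' q s t; lra.
apply/matrixP => i j; rewrite CE ThT ThE /th !mxE !big_ord1 !mxE.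
move: (Om i j) (Om j i) (w 0 i) (w 0 j) (dph 0 i) (dph 0 j) => *.
by field.
Qed.

(* The alternating form [ph *: dw - dph /\ w] is killed by K because K is
   Killing, and vanishes on the orthogonal complement, spanned by the rows of
   [X], because that distribution is integrable; so it is zero. *)
Lemma closed_algebra (p : nat) (X : 'M[R]_(p, n)) : (p.+1 = n)%N -> row_free X ->
  X *m w^T = 0 -> (X *m Om *m X^T)^T = X *m Om *m X^T -> Th^T = Th.
Proof.
move=> pn fX Xw Xs.
have [A AE] : exists A, A = Om - Om^T by exists (Om - Om^T).
pose B := ph *: A - (dph^T *m w - w^T *m dph).
have AT : A^T = - A by rewrite AE linearB /= trmxK opprB.
have BT : B^T = - B.
  apply/matrixP => i j; rewrite /B AE !mxE !big_ord1 !mxE.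
  by move: (Om i j) (Om j i) (w 0 i) (w 0 j) (dph 0 i) (dph 0 j) => *; ring.
have kAk : (k *m A *m k^T) 0 0 = 0.
  have : (k *m A *m k^T)^T = - (k *m A *m k^T).
    by rewrite !trmx_mul trmxK AT !mulNmx !mulmxN mulmxA.
  move=> /matrixP/(_ 0 0); rewrite !mxE => E; lra.
have dk : dph *m k^T = 0.
  by apply/matrixP => i j; rewrite !ord1 -[dph]opprK -kA -AE mulNmx [LHS]mxE kAk oppr0 mxE.
have kdT : k *m dph^T = 0 by rewrite -[k]trmxK -trmx_mul dk trmx0.
have kw : k *m w^T = ph%:M by rewrite -[k]trmxK -trmx_mul wE tr_scalar_mx.
have kB : k *m B = 0.
  rewrite /B mulmxBr -scalemxAr AE kA mulmxBr !mulmxA kdT mul0mx sub0r kw mul_scalar_mx.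
  by rewrite scalerN opprK addNr.
have Bk : B *m k^T = 0.
  have : (k *m B)^T = 0 by rewrite kB trmx0.
  by rewrite trmx_mul BT mulNmx => /eqP; rewrite oppr_eq0 => /eqP.
have XB : X *m B *m X^T = 0.
  rewrite /B mulmxBr mulmxBl -scalemxAr -scalemxAl mulmxBr mulmxBl.
  have -> : X *m A *m X^T = 0.
    rewrite AE mulmxBr mulmxBl -[X in X - _]Xs !trmx_mul trmxK mulmxA subrr//.
  rewrite scaler0 sub0r !mulmxA Xw !mul0mx subr0.
  have wX : w *m X^T = 0 by rewrite -[w]trmxK -trmx_mul Xw trmx0.
  by rewrite -(mulmxA _ w) wX mulmx0 oppr0.
(* K together with the rows of X is a frame: a multiple of K orthogonal to K is zero, since
   [k *m w^T] is the nonzero [ph]. So [B] may be tested on this frame. *)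
pose T := col_mx k X.
have fT : row_free T.
  apply: inj_row_free => v; rewrite -[v]hsubmxK /T mul_row_col => vT.
  have := congr1 (mulmx^~ w^T) vT; rewrite mulmxDl -!mulmxA Xw mulmx0 addr0 kw mul0mx.
  rewrite mul_mx_scalar => /eqP; rewrite scaler_eq0 (negPf phn0) /= => /eqP l0.
  move: vT; rewrite l0 mul0mx add0r => vX.
  have -> : rsubmx v = 0 by apply: (row_free_inj fX); rewrite vX mul0mx.
  by rewrite row_mx0.
have /row_fullP[T' T'T] : row_full T.
  by rewrite /row_full (eqP fT) add1n pn.
have TB : T *m B *m T^T = 0.
  rewrite /T mul_col_mx kB tr_col_mx mul_col_row !mul0mx XB -mulmxA Bk mulmx0.
  by rewrite block_mx0.
have B0 : B = 0.
  have : T' *m (T *m B *m T^T) *m T'^T = 0 by rewrite TB mulmx0 mul0mx.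
  by rewrite !mulmxA T'T mul1mx -mulmxA -trmx_mul T'T trmx1 mulmx1.
have : ph ^+ 2 *: (Th - Th^T) = B.
  apply/matrixP => i j; rewrite ThT ThE /B AE !mxE !big_ord1 !mxE.
  move: (Om i j) (Om j i) (w 0 i) (w 0 j) (dph 0 i) (dph 0 j) => *.
  by field.
rewrite B0 => /eqP; rewrite scaler_eq0 sqrf_eq0 (negPf phn0) subr_eq0 /= => /eqP.
exact: esym.
Qed.

End FormAlgebra.

Section Form.
Context {R : realType} {n : nat} {M : manifold R n}.
Variables (g : riemannian_metric M) (K : vector_field M).
Implicit Types (c d : chart_index M) (x : 'rV[R]_n).

Definition flat d x : 'rV[R]_n := K d x *m g d x.
Definition speed2 d x : R := (flat d x *m (K d x)^T) 0 0.

(* For an irrotational Killing field this closed form replaces the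
   (non-closed) dual form [flat]; both have the same kernel. *)
Definition theta d x : 'rV[R]_n := (speed2 d x)^-1 *: flat d x.

Let oimg d : open (chart_img d). Proof. exact: chart_img_open. Qed.

Lemma metric_Ck k d : Ck k (chart_img d) (g d).
Proof. exact: metric_smooth. Qed.

Lemma field_Ck k d : Ck k (chart_img d) (K d).
Proof. exact: vf_smooth. Qed.

Lemma flat_Ck k d : Ck k (chart_img d) (flat d).
Proof. exact: (Ck_mulmx (@oimg d) (@field_Ck k d) (@metric_Ck k d)). Qed.

Lemma speed2_Ck k d : Ck k (chart_img d) (speed2 d).
Proof.
exact: ((Ck_mxP _ _ (@oimg d)).1 (Ck_mulmx (@oimg d) (@flat_Ck k d)
  (Ck_trmx (@oimg d) (@field_Ck k d)))).
Qed.

Lemma metric_posdefP d x : chart_img d x -> posdef (g d x).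
Proof. move=> dx; exact (conj (Defs.metric_sym g dx) (metric_posdef g dx)). Qed.

Lemma flat_tr d x : chart_img d x -> (flat d x)^T = g d x *m (K d x)^T.
Proof. by move=> dx; rewrite /flat trmx_mul Defs.metric_sym. Qed.

Lemma flat_transform c d x : rep_dom idfun c d x ->
  flat c x = flat d (rep idfun c d x) *m ('J (rep idfun c d) x)^T.
Proof.
by move=> Tx; rewrite /flat (metric_transform g Tx) (vf_transform K Tx) !mulmxA.
Qed.

Lemma speed2_transform c d x : rep_dom idfun c d x ->
  speed2 c x = speed2 d (rep idfun c d x).
Proof.
move=> Tx; rewrite /speed2 (flat_transform Tx) (vf_transform K Tx).
by rewrite trmx_mul mulmxA.
Qed.

Lemma theta_transform c d x : rep_dom idfun c d x ->
  theta c x = theta d (rep idfun c d x) *m ('J (rep idfun c d) x)^T.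
Proof.
by move=> Tx; rewrite /theta (speed2_transform Tx) (flat_transform Tx) scalemxAl.
Qed.

Hypothesis (K0 : nowhere_zero K).

Lemma speed2_gt0 d x : chart_img d x -> 0 < speed2 d x.
Proof. by move=> dx; apply: metric_posdef => //; exact: K0. Qed.

Let speed2_neq0 d x : chart_img d x -> speed2 d x != 0.
Proof. by move=> dx; rewrite gt_eqF// speed2_gt0. Qed.

Lemma theta_coord_Ck k d j : Ck k (chart_img d) (fun x => theta d x 0 j).
Proof.
have C1 := CkV (@oimg d) (@speed2_neq0 d) (@speed2_Ck k d).
have C2 := (Ck_mxP _ _ (@oimg d)).1 (@flat_Ck k d) 0 j.
by apply: (eq_Ck (@oimg d) _ (CkM (@oimg d) C1 C2)) => x _; rewrite mxE.
Qed.

Lemma theta_Ck k d : Ck k (chart_img d) (theta d).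
Proof. by apply/(Ck_mxP _ _ (@oimg d)) => i j; rewrite ord1; exact: theta_coord_Ck. Qed.

Lemma theta_kernel d x (p : nat) (v : 'M[R]_(p, n)) : chart_img d x ->
  (v *m (theta d x)^T == 0) = (v *m (flat d x)^T == 0).
Proof.
move=> dx; rewrite /theta linearZ /= -scalemxAr scaler_eq0 invr_eq0.
by rewrite (negPf (speed2_neq0 dx)).
Qed.


Section AtPoint.
Variables (d : chart_index M) (x : 'rV[R]_n).
Hypotheses (dx : chart_img d x) (hK : killing g K).

Definition dspeed2 : 'rV[R]_n := \row_i partial i (speed2 d) x.

Let pgT i : (partial i (g d) x)^T = partial i (g d) x.
Proof.
apply: etrans (esym (partial_trmx i (@oimg d) (@metric_Ck 1 d) dx)) _.
apply: near_eq_derive.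
by apply: filterS (open_nbhs_nbhs (conj (@oimg d) dx)) => y dy; exact: Defs.metric_sym.
Qed.

Let rOm i : row i ('J (flat d) x) =
  row i ('J (K d) x) *m g d x + K d x *m partial i (g d) x.
Proof.
have E1 := row_jacobian i (@oimg d) (@flat_Ck 1 d) dx.
have E2 := row_jacobian i (@oimg d) (@field_Ck 1 d) dx.
have E := partial_mulmx i (@oimg d) (@field_Ck 1 d) (@metric_Ck 1 d) dx.
exact: etrans E1 (etrans E (congr1 (fun r => r *m g d x + _) (esym E2))).
Qed.

Let QE : 'D_(K d x) (g d) x = \sum_l K d x 0 l *: partial l (g d) x.
Proof. exact: (C1_derive_mx (K d x) (@oimg d) (@metric_Ck 1 d) dx). Qed.

Let rdph j : dspeed2 0 j =
  (row j ('J (flat d) x) *m (K d x)^T + flat d x *m (row j ('J (K d) x))^T) 0 0.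
Proof.
have E1 := row_jacobian j (@oimg d) (@flat_Ck 1 d) dx.
have E2 := row_jacobian j (@oimg d) (@field_Ck 1 d) dx.
have CKT := Ck_trmx (@oimg d) (@field_Ck 1 d).
have E := partial_mulmx j (@oimg d) (@flat_Ck 1 d) CKT dx.
have E3 := partial_mxE j 0 0 (Ck_mulmx (@oimg d) (@flat_Ck 1 d) CKT) dx.
have E4 := partial_trmx j (@oimg d) (@field_Ck 1 d) dx.
have E5 : dspeed2 0 j = partial j (speed2 d) x by rewrite mxE.
have E6 : row j ('J (flat d) x) *m (K d x)^T + flat d x *m (row j ('J (K d) x))^T =
    partial j (flat d) x *m (K d x)^T + flat d x *m partial j (fun y => (K d y)^T) x.
  exact: (f_equal2 (fun (r : 'rV[R]_n) (s : 'cV[R]_n) => r *m (K d x)^T + flat d x *m s) E1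
    (etrans (congr1 trmx E2) (esym E4))).
exact: etrans E5 (etrans (esym E3) (congr1 (fun A : 'M[R]_1 => A 0 0) (etrans E (esym E6)))).
Qed.

Let rTh i : row i ('J (theta d) x) =
  (speed2 d x)^-1 *: row i ('J (flat d) x) - ((speed2 d x) ^- 2 * dspeed2 0 i) *: flat d x.
Proof.
have E1 := row_jacobian i (@oimg d) (@flat_Ck 1 d) dx.
have E2 := row_jacobian i (@oimg d) (@theta_Ck 1 d) dx.
apply/rowP => j.
have Ci := CkV (@oimg d) (@speed2_neq0 d) (@speed2_Ck 1 d).
have d1 := Ck_derivable (i := i) Ci dx.
have d2 := Ck_derivable (i := i) ((Ck_mxP _ _ (@oimg d)).1 (@flat_Ck 1 d) 0 j) dx.
have d3 := Ck_derivable (i := i) (@speed2_Ck 1 d) dx.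
have F1 : row i ('J (theta d) x) 0 j = partial i (fun y => theta d y 0 j) x.
  exact: etrans (congr1 (fun r : 'rV_n => r 0 j) E2) (partial_mxE i 0 j (@theta_Ck 1 d) dx).
have F2 : row i ('J (flat d) x) 0 j = partial i (fun y => flat d y 0 j) x.
  exact: etrans (congr1 (fun r : 'rV_n => r 0 j) E1) (partial_mxE i 0 j (@flat_Ck 1 d) dx).
have F3 : partial i (fun y => theta d y 0 j) x =
    (speed2 d x)^-1 * partial i (fun y => flat d y 0 j) x +
    flat d x 0 j * partial i (fun y => (speed2 d y)^-1) x.
  apply: etrans _ (partialM d1 d2); congr (partial i _ x).
  by apply/funext => y; rewrite mxE.
have F4 : partial i (fun y => (speed2 d y)^-1) x = - (speed2 d x) ^- 2 * dspeed2 0 i.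
  by apply: etrans (deriveV (speed2_neq0 dx) d3) _; rewrite mxE.
have F5 (p q : R) (r v : 'rV[R]_n) : (p *: r - q *: v) 0 j = p * r 0 j - q * v 0 j.
  by rewrite !mxE.
apply: etrans F1 (etrans F3 _); rewrite F5 F2 F4.
by rewrite mulNr mulrN [flat d x 0 j * _]mulrC.
Qed.

Let wE : flat d x *m (K d x)^T = (speed2 d x)%:M.
Proof. by apply/matrixP => i j; rewrite !ord1 [RHS]mxE mulr1n. Qed.

(** The left-hand side is twice the symmetrised covariant derivative of theta, that is twice the
    Hessian of a potential. *)
Lemma theta_hessian :
  let C := \matrix_(i, j) (christoffel g d x i j *m (theta d x)^T) 0 0 in
  'J (theta d) x + ('J (theta d) x)^T - (C + C^T) =
  - ((speed2 d x)^-1 *: (dspeed2^T *m theta d x + (theta d x)^T *m dspeed2)).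
Proof.
have GamE i j r : christoffel g d x i j 0 r = 2^-1 * \sum_l invmx (g d x) r l *
    (partial i (g d) x j l + partial j (g d) x i l - partial l (g d) x i j).
  by rewrite mxE.
exact (hessian_algebra (Defs.metric_sym g dx) pgT erefl (posdef_unit (metric_posdefP dx))
  rOm QE (hK dx) (speed2_neq0 dx) rTh GamE).
Qed.

Lemma theta_closed_at (p : nat) (X : 'M[R]_(p, n)) : (p.+1 = n)%N -> row_free X ->
  X *m (flat d x)^T = 0 ->
  (X *m 'J (flat d) x *m X^T)^T = X *m 'J (flat d) x *m X^T ->
  ('J (theta d) x)^T = 'J (theta d) x.
Proof.
move=> pn fX Xw Xs.
exact (closed_algebra erefl rOm QE (hK dx) wE (speed2_neq0 dx) rdph rTh pn fX Xw Xs).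
Qed.

End AtPoint.

End Form.

Lemma quad_entry (R : comNzRingType) (p n : nat) (X : 'M[R]_(p, n)) (B : 'M[R]_n) a b :
  (X *m B *m X^T) b a = (row a X *m (row b X *m B)^T) 0 0.
Proof.
rewrite -(row_mul b); move: (X *m B) => Y.
by rewrite !mxE; apply: eq_bigr => l _; rewrite !mxE mulrC.
Qed.

(** * Local and global potentials of theta *)

Section Potential.
Context {R : realType} {n : nat} {M : manifold R n}.
Variables (g : riemannian_metric M) (K : vector_field M).
Hypotheses (hK : killing g K) (hI : irrotational g K) (K0 : nowhere_zero K).
Implicit Types (c d e : chart_index M) (p q : M) (h : M -> R).

Local Notation th := (theta g K).

Let oimg d : open (chart_img d). Proof. exact: chart_img_open. Qed.

(** Along an integral manifold F through the point, w vanishes on tangent vectors. Differentiating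
    this identity expresses the derivative of w on the tangent space as minus the second partials of
    F paired with w, and these are symmetric. *)
Lemma theta_closed d (x : 'rV[R]_n) : chart_img d x -> ('J (th d) x)^T = 'J (th d) x.
Proof.
move=> dx; have [N [f [[[_ _ [[cf sf] imf]] _ tan] [q _ fq]]]] := hI (chart_inv d x).
(* A nonzero vector K excludes n = 0, where [n.-1.+1] would be 1. *)
have n0 : (n.-1.+1 = n)%N.
  have := K0 dx; case: (n) (K d x) => // v /eqP[].
  by apply/rowP => -[].
have [c cq] := chart_cover q.
set F := rep f c d; pose U := rep_dom f c d; pose y := chart c q.
have dq : chart_dom d (f q) by rewrite fq; exact: chart_inv_dom.
have Uy : U y by exact: rep_dom_chart.
have oU : open U by exact: rep_dom_open.
have CF k : Ck k U F by exact: sf.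
have Fy : F y = x by rewrite /F /rep /= /y chartK// fq chart_invK.
set X := 'J F y.
have tanU z : U z -> 'J F z *m (flat g K d (F z))^T = 0.
  by move=> Uz; rewrite flat_tr ?mulmxA; [exact: tan|exact: rep_img].
have rX a : row a X = partial a F y := row_jacobian a oU (CF 1) Uy.
have Fimg z : U z -> chart_img d (F z) by exact: rep_img.
have CwF k : Ck k U (flat g K d \o F).
  exact: (Ck_comp_mx oU (@oimg d) Fimg (CF k) (@flat_Ck R n M g K k d)).
have key a b : (X *m 'J (flat g K d) x *m X^T) b a =
    - (partial b (partial a F) y *m (flat g K d x)^T) 0 0.
  have E := partial_mulmx b oU (Ck_partial a (CF 2)) (Ck_trmx oU (CwF 1)) Uy.
  have E0 : partial b (fun z => partial a F z *m ((flat g K d \o F) z)^T) y = 0.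
    rewrite -[RHS](derive_cst (0 : 'M[R]_1) y (delta_mx 0 b)); apply: near_eq_derive.
    apply: filterS (open_nbhs_nbhs (conj oU Uy)) => z Uz.
    by rewrite -(row_jacobian a oU (CF 1) Uz) -row_mul (tanU z Uz) row0.
  have E1 := partial_trmx b oU (CwF 1) Uy.
  have E2 : partial b (flat g K d \o F) y = row b X *m 'J (flat g K d) x.
    apply: etrans (partial_comp_mx b oU (@oimg d) (CF 1) (@flat_Ck R n M g K 1 d) Uy (Fimg _ Uy)) _.
    rewrite mulmx_sum_row; apply: eq_bigr => j _.
    rewrite (rX b) Fy; congr (_ *: _).
    exact: esym (row_jacobian j (@oimg d) (@flat_Ck R n M g K 1 d) dx).
  have E3 : partial b (partial a F) y *m (flat g K d x)^T +
      row a X *m (row b X *m 'J (flat g K d) x)^T = 0.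
    apply: etrans (etrans (esym E) E0); rewrite /= Fy rX; congr (_ + _ *m _).
    exact: esym (etrans E1 (congr1 trmx E2)).
  have -> : (X *m 'J (flat g K d) x *m X^T) b a =
      (row a X *m (row b X *m 'J (flat g K d) x)^T) 0 0.
    exact: quad_entry.
  by apply/eqP; rewrite -addr_eq0 addrC; have /matrixP/(_ 0 0) := E3; rewrite !mxE => ->.
apply: (theta_closed_at K0 dx hK n0 (imf c d y Uy)).
  by rewrite -Fy; exact: tanU.
apply/matrixP => a b; have C := partialC_mx b a oU (CF 2) Uy.
have trE (B : 'M[R]_n.-1) : B^T a b = B b a by rewrite mxE.
exact: etrans (trE _) (etrans (key a b) (etrans
  (congr1 (fun r : 'rV[R]_n => - (r *m (flat g K d x)^T) 0 0) C) (esym (key b a)))).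
Qed.

(** Only the partial derivatives are prescribed; continuity and smoothness of h follow from the
    smoothness of theta. *)
Definition primitive_on d (V : set 'rV[R]_n) h :=
  [/\ open V, V `<=` chart_img d &
      forall y j, V y -> is_derive y (delta_mx 0 j) (h \o chart_inv d) (th d y 0 j)].

Definition primitive_at p h :=
  exists d V, [/\ chart_dom d p, V (chart d p) & primitive_on d V h].

Lemma primitive_on_Ck d V h k : primitive_on d V h -> Ck k V (h \o chart_inv d).
Proof.
move=> [oV Vd dh]; have C : Ck k.+1 V (h \o chart_inv d).
  apply: (Ck_intro oV) => [i y Vy|i]; first by have [] := dh y i Vy.
  apply: (eq_Ck oV _ (Ck_subset Vd (@theta_coord_Ck R n M g K K0 k d i))) => y Vy.
  by have [_] := dh y i Vy; rewrite /partial => ->.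
exact: CkW.
Qed.

Lemma primitive_on_partial d V h y j : primitive_on d V h -> V y ->
  partial j (h \o chart_inv d) y = th d y 0 j.
Proof. by move=> [_ _ dh] Vy; have [_] := dh y j Vy. Qed.

(** The chain rule for a transition map matches the transformation law of theta as a covector, so
    the choice of chart in [primitive_at] is immaterial. *)
Lemma primitive_at_chart p h e : primitive_at p h -> chart_dom e p ->
  exists2 V, V (chart e p) & primitive_on e V h.
Proof.
move=> [d [V [dp Vp pV]]] ep; have [oV Vd _] := pV.
pose T := @rep R n n M M idfun e d; pose D := @rep_dom R n n M M idfun e d.
have oD : open D by exact: transition_open.
have CT k : Ck k D T by exact: transition_Ck.
pose W := [set y | D y /\ V (T y)].
have cT y : D y -> {for y, continuous T} by move=> Dy; exact: Ck_continuous (CT 0) Dy.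
have oW : open W.
  apply: open_nearP => y [Dy Vy].
  have n1 : nbhs y D by exact: open_nbhs_nbhs.
  have n2 : nbhs y (T @^-1` V) by apply: (cT _ Dy); exact: open_nbhs_nbhs.
  exact: (filterI n1 n2).
have We : W `<=` chart_img e by move=> y [/rep_domP[]].
exists W; first by split; [exists p|rewrite /T /rep /= chartK].
split=> // y j Wy; have [Dy Vy] := Wy.
have CWT : Ck 1 W T by apply: (Ck_subset _ (CT 1)) => z [].
have WV z : W z -> V (T z) by case.
have Ch := primitive_on_Ck 1 pV.
have near_eq : \forall z \near y, ((h \o chart_inv d) \o T) z = (h \o chart_inv e) z.
  apply: filterS (open_nbhs_nbhs (conj oW Wy)) => z [Dz _].
  by rewrite /T /= repK.
apply: (near_eq_is_derive near_eq); apply: DeriveDef.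
  exact (derivable_comp oW oV CWT Ch Wy Vy).
have E := partial_comp j oW oV CWT Ch Wy Vy; apply: etrans E _.
rewrite (theta_transform g K Dy) mxE; apply: eq_bigr => i _.
have trE (B : 'M[R]_n) a b : B^T a b = B b a by rewrite mxE.
rewrite (primitive_on_partial i pV Vy) mulrC trE; congr (_ * _).
exact: esym (jacobianE j i oW CWT Wy).
Qed.

Lemma primitive_at_near p h : primitive_at p h -> \forall q \near p, primitive_at q h.
Proof.
move=> [d [V [dp Vp pV]]]; have [oV _ _] := pV.
apply: filterS (chart_dom_nbhs dp (open_nbhs_nbhs (conj oV Vp))) => q [dq Vq].
by exists d, V.
Qed.

Lemma primitive_atD p h a : primitive_at p h -> primitive_at p (fun q => h q + a).
Proof.
move=> [d [V [dp Vp [oV Vd dh]]]]; exists d, V; split=> //; split=> // y j Vy.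
have D0 := is_derive_cst a y (delta_mx 0 j : 'rV[R]_n).
by have := is_deriveD (dh y j Vy) D0; rewrite addr0.
Qed.

Lemma primitive_at_eq p h1 h2 : (\forall q \near p, h1 q = h2 q) ->
  primitive_at p h1 -> primitive_at p h2.
Proof.
move=> h12 [d [V [dp Vp [oV Vd dh]]]].
pose W := V `&` interior [set y | h1 (chart_inv d y) = h2 (chart_inv d y)].
exists d, W; split=> //.
  split=> //; have dx := chart_img_chart dp.
  have n12 : nbhs (chart_inv d (chart d p)) [set q | h1 q = h2 q] by rewrite chartK.
  by apply: filterS (chart_img_nbhs dx n12) => y [].
split; first by apply: openI => //; exact: open_interior.
  by move=> y [/Vd].
by move=> y j [Vy Hy]; exact: near_eq_is_derive Hy (dh y j Vy).
Qed.

Lemma primitive_at_unique p h1 h2 : primitive_at p h1 -> primitive_at p h2 ->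
  \forall q \near p, h1 q - h2 q = h1 p - h2 p.
Proof.
move=> p1 p2; have [d dp] := chart_cover p.
have [V1 V1p pV1] := primitive_at_chart p1 dp.
have [V2 V2p pV2] := primitive_at_chart p2 dp.
have [oV1 _ d1] := pV1; have [oV2 _ d2] := pV2.
have nV : nbhs (chart d p) (V1 `&` V2).
  by apply: open_nbhs_nbhs; split=> //; exact: openI.
have [r /= r0 rV] := (@nbhs_ballP R _ _ _).1 nV.
have oB : open (ball (chart d p) r) by exact: ball_open.
pose k y := (h1 \o chart_inv d) y + - (h2 \o chart_inv d) y.
have B1 y : ball (chart d p) r y -> V1 y by move=> /rV[].
have B2 y : ball (chart d p) r y -> V2 y by move=> /rV[].
have Ck1 : Ck 1 (ball (chart d p) r) k.
  exact: (CkD oB (Ck_subset B1 (primitive_on_Ck 1 pV1))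
    (CkN oB (Ck_subset B2 (primitive_on_Ck 1 pV2)))).
have k0 y i : ball (chart d p) r y -> partial i k y = 0.
  move=> By; have [_] := is_deriveB (d1 y i (B1 _ By)) (d2 y i (B2 _ By)).
  by rewrite subrr.
have nB : nbhs (chart d p) (ball (chart d p) r) by exact: nbhsx_ballx.
apply: filterS (chart_dom_nbhs dp nB) => q [dq Bq].
have := ball_const Ck1 k0 Bq (ballxx _ r0).
by rewrite /k /= !chartK.
Qed.

Lemma primitive_at_ex p : exists h, primitive_at p h.
Proof.
have [d dp] := chart_cover p; have dx := chart_img_chart dp.
have cl i j y : chart_img d y ->
    partial i (fun y => th d y 0 j) y = partial j (fun y => th d y 0 i) y.
  move=> dy; have Cth := @theta_Ck R n M g K K0 1 d.
  have E a b : partial a (fun y => th d y 0 b) y = ('J (th d) y) a b :=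
    esym (etrans (jacobianE a b (@oimg d) Cth dy) (partial_mxE a 0 b Cth dy)).
  have trE (B : 'M[R]_n) a b : B^T a b = B b a by rewrite mxE.
  have S := congr1 (fun B : 'M[R]_n => B j i) (theta_closed dy).
  exact: etrans (E i j) (etrans (esym (trE _ _ _)) (etrans S (esym (E j i)))).
have [r [r0 rd [h dh]]] := poincare (@oimg d) dx (@theta_coord_Ck R n M g K K0 1 d) cl.
exists (h \o chart d), d, (ball (chart d p) r); split=> //; first exact: ballxx.
split=> //; first exact: ball_open.
move=> y j By; apply: near_eq_is_derive (dh y j By).
apply: filterS (open_nbhs_nbhs (conj (@oimg d) (rd _ By))) => z dz.
by rewrite /= chart_invK.
Qed.

(** Straight segments in a chart; they are the short sides of the triangles in the construction of
    the global primitive. *)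
Lemma locally_path_connected p (O : set M) : nbhs p O ->
  \forall q \near p, exists b : R -> M,
     [/\ {within `[0, 1], continuous b}, b 0 = p, b 1 = q &
         forall t, `[0, 1]%classic t -> O (b t)].
Proof.
move=> nO; have [d dp] := chart_cover p; have dx := chart_img_chart dp.
have nO' : nbhs (chart_inv d (chart d p)) O by rewrite chartK.
have [r /= r0 rO] := (@nbhs_ballP R _ _ _).1 (chart_img_nbhs dx nO').
have nB : nbhs (chart d p) (ball (chart d p) r) by exact: nbhsx_ballx.
apply: filterS (chart_dom_nbhs dp nB) => q [dq Bq].
pose l (t : R) := chart d p + t *: (chart d q - chart d p).
have lB t : `[0, 1]%classic t -> ball (chart d p) r (l t).
  by rewrite /= in_itv /= => t01; apply: ball_convex => //; exact: ballxx.
exists (chart_inv d \o l); split.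
- apply: continuous_in_subspaceT => t; rewrite inE => t01.
  have cl : {for t, continuous l}.
    by apply: continuousD; [exact: cst_continuous|exact: scalel_continuous].
  have [dl _] := rO _ (lB t t01).
  exact: (continuous_comp cl (chart_inv_continuous dl)).
- by rewrite /l /= scale0r addr0 chartK.
- by rewrite /l /= scale1r addrC subrK chartK.
- by move=> t /lB /rO[].
Qed.

Theorem potential_exists : simply_connected M ->
  exists h : M -> R, forall d, primitive_on d (chart_img d) h.
Proof.
move=> [[p0 _] hpath hhom].
have [h Ph] := global_primitive primitive_at_ex primitive_at_near primitive_at_unique
  primitive_atD primitive_at_eq p0 hpath hhom locally_path_connected.
exists h => d; split=> // y j dy.
have [V Vy [_ _ dh]] := primitive_at_chart (Ph (chart_inv d y)) (chart_inv_dom dy).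
by apply: dh; move: Vy; rewrite chart_invK.
Qed.

Lemma potential_continuous h : (forall d, primitive_on d (chart_img d) h) -> continuous h.
Proof.
move=> ph p; have [d dp] := chart_cover p.
have c1 := Ck_continuous (primitive_on_Ck 0 (ph d)) (chart_img_chart dp).
have c2 := continuous_comp (chart_continuous dp) c1.
apply: eq_continuous_at c2.
apply: filterS (open_nbhs_nbhs (conj (chart_dom_open d) dp)) => q dq /=.
by rewrite chartK.
Qed.

Section Gradient.
Context {k : nat} {N : manifold R k} (f : N -> M) (h : M -> R).
Hypotheses (ph : forall d, primitive_on d (chart_img d) h) (cf : continuous f)
  (sf : forall (c : chart_index N) d, smooth_on (rep_dom f c d) (rep f c d)).

Lemma potential_gradient (c : chart_index N) d x a : rep_dom f c d x ->
  partial a ((h \o chart_inv d) \o rep f c d) x =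
  ('J (rep f c d) x *m (th d (rep f c d x))^T) a 0.
Proof.
move=> Ux; have oU : open (rep_dom f c d) by exact: rep_dom_open.
have C1 := primitive_on_Ck 1 (ph d).
apply: etrans (partial_comp a oU (@oimg d) (sf c d 1) C1 Ux (rep_img Ux)) _.
rewrite [RHS]mxE; apply: eq_bigr => j _.
have E1 := jacobianE a j oU (sf c d 1) Ux.
have E2 := primitive_on_partial j (ph d) (rep_img Ux).
have trE (v : 'rV[R]_n) : v^T j 0 = v 0 j by rewrite mxE.
exact: f_equal2 (esym E1) (etrans E2 (esym (trE _))).
Qed.

(** Tangent vectors in the kernel of w are in the kernel of theta, so h o f is locally constant.
    Applied to integral manifolds, it confines them to level sets. *)
Lemma potential_const_tangent : connected [set: N] ->
  (forall (c : chart_index N) d x, rep_dom f c d x -> 'J (rep f c d) x *m (flat g K d (rep f c d x))^T = 0) ->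
  forall q q' : N, h (f q) = h (f q').
Proof.
move=> cN tan q q'.
apply: (connected_loc_const cN (k := h \o f)) => // {q q'} q _.
have [c cq] := chart_cover q; have [d dq] := chart_cover (f q).
have oU : open (rep_dom f c d) by exact: rep_dom_open.
have Uq := rep_dom_chart cq dq.
have [r /= r0 rU] := (@nbhs_ballP R _ _ _).1 (open_nbhs_nbhs (conj oU Uq)).
have oB : open (ball (chart c q) r) by exact: ball_open.
have Cu : Ck 1 (ball (chart c q) r) ((h \o chart_inv d) \o rep f c d).
  apply: (Ck_comp oB (@oimg d) _ (Ck_subset rU (sf c d 1)) (primitive_on_Ck 1 (ph d))).
  by move=> x /rU; exact: rep_img.
have du x a : ball (chart c q) r x -> partial a ((h \o chart_inv d) \o rep f c d) x = 0.
  move=> /rU Ux; apply: etrans (potential_gradient a Ux) _.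
  have /eqP := tan c d x Ux; rewrite -(theta_kernel g K0 _ (rep_img Ux)) => /eqP E.
  have E0 : (0 : 'cV[R]_k) a 0 = 0 by rewrite mxE.
  exact: etrans (congr1 (fun A : 'cV[R]_k => A a 0) E) E0.
have nB : nbhs (chart c q) (ball (chart c q) r) by exact: nbhsx_ballx.
apply: filterS (chart_dom_nbhs cq nB) => q' [cq' Bq'] _.
have := ball_const Cu du Bq' (ballxx _ r0).
by rewrite /= !repK; rewrite ?chartK//; exact: rU.
Qed.

End Gradient.

End Potential.

(** * The maximum principle along a minimal immersion *)

(* Pointwise algebra in charts: [Gi] is the inverse of the induced metric,
   [J] the Jacobian of the immersion F, [DD] its second partials, [Gm] the
   Christoffel terms, [th] = theta, [Th] = d theta, and [ua], [uab] are the
   partials of the potential along F. *)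
Section MinimalAlgebra.
Context {R : realType} {k n : nat}.
Variables (Gi : 'M[R]_k) (J : 'M[R]_(k, n)) (G Th C : 'M[R]_n) (th dph : 'rV[R]_n)
  (ph : R) (DD Gm : 'I_k -> 'I_k -> 'rV[R]_n) (uab : 'I_k -> 'I_k -> R) (ua : 'I_k -> R).
Hypotheses (GiT : Gi^T = Gi)
  (GmE : forall a b, (Gm a b *m th^T) 0 0 = (J *m C *m J^T) a b)
  (min0 : \sum_a \sum_b Gi a b *: ((DD a b + Gm a b) *m (1%:M - G *m J^T *m Gi *m J)) = 0)
  (hess : Th + Th^T - (C + C^T) = - (ph^-1 *: (dph^T *m th + th^T *m dph)))
  (uabE : forall a b, uab a b = (DD a b *m th^T) 0 0 + (J *m Th *m J^T) a b)
  (uaE : forall a, ua a = (J *m th^T) a 0).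

Let S := \sum_a \sum_b Gi a b *: (DD a b + Gm a b).
Let t := J *m th^T.
Let p := J *m dph^T.

(** Minimality: the trace [S] of the second derivatives has no normal part, so it equals its
    tangential projection. *)
Let S_proj : S = S *m G *m J^T *m Gi *m J.
Proof.
apply/eqP; rewrite -subr_eq0 -[X in X - _]mulmx1 -!mulmxA -mulmxBr !mulmxA.
apply/eqP; rewrite -[RHS]min0 /S mulmx_suml; apply: eq_bigr => a _.
by rewrite mulmx_suml; apply: eq_bigr => b _; rewrite scalemxAl.
Qed.

Let contract (X : 'M[R]_k) := \sum_a \sum_b Gi a b * X a b.

Let contractT X : contract X^T = contract X.
Proof.
rewrite /contract exchange_big /=; apply: eq_bigr => a _; apply: eq_bigr => b _.
by rewrite mxE -[in LHS]GiT mxE.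
Qed.

Let contractD X Y : contract (X + Y) = contract X + contract Y.
Proof.
rewrite /contract -big_split /=; apply: eq_bigr => a _.
by rewrite -big_split /=; apply: eq_bigr => b _; rewrite mxE mulrDr.
Qed.

Let contractZ c X : contract (c *: X) = c * contract X.
Proof.
rewrite /contract mulr_sumr; apply: eq_bigr => a _.
by rewrite mulr_sumr; apply: eq_bigr => b _; rewrite mxE mulrCA.
Qed.

Let contract_outer : contract (p *m t^T) = \sum_a (p^T *m Gi) 0 a * t a 0.
Proof.
rewrite /contract exchange_big /=; apply: eq_bigr => b _.
rewrite mxE mulr_suml; apply: eq_bigr => a _.
by rewrite mxE big_ord1 !mxE mulrA [Gi a b * _]mulrC.
Qed.

(** The second order part splits into [S] paired with theta and the trace of the Hessian of h. Since
    [S] is tangent to N and the Hessian has dh as a factor, both are linear in the first partials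
    [ua]. *)
Lemma minimal_algebra : \sum_a \sum_b Gi a b * uab a b +
  \sum_a (ph^-1 *: (dph *m J^T *m Gi) - S *m G *m J^T *m Gi) 0 a * ua a = 0.
Proof.
have E1 : \sum_a \sum_b Gi a b * uab a b =
    (S *m th^T) 0 0 + contract (J *m (Th - C) *m J^T).
  have -> : (S *m th^T) 0 0 = \sum_a \sum_b Gi a b * ((DD a b *m th^T) 0 0 + (J *m C *m J^T) a b).
    rewrite /S mulmx_suml summxE; apply: eq_bigr => a _.
    rewrite mulmx_suml summxE; apply: eq_bigr => b _.
    rewrite -scalemxAl mxE mulmxDl; congr (_ * _).
    by rewrite mxE GmE.
  rewrite /contract -big_split /=; apply: eq_bigr => a _.
  rewrite -big_split /=; apply: eq_bigr => b _; rewrite uabE -mulrDr; congr (_ * _).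
  rewrite mulmxBr mulmxBl.
  have subE (A B : 'M[R]_k) : (A - B) a b = A a b - B a b by rewrite !mxE.
  rewrite subE; move: ((J *m Th *m J^T) a b) ((J *m C *m J^T) a b) ((_ *m _) 0 0) => *.
  by ring.
have E2 : contract (J *m (Th - C) *m J^T) = - (ph^-1 * contract (p *m t^T)).
  (* [hess] concerns only the symmetrisation of [Th - C]; contraction with the symmetric [Gi] does
     not see the difference. *)
  have half : 2 * contract (J *m (Th - C) *m J^T) = - (ph^-1 * (2 * contract (p *m t^T))).
    rewrite [in LHS]mulr_natl mulr2n -{1}contractT -contractD.
    have -> : (J *m (Th - C) *m J^T)^T + J *m (Th - C) *m J^T =
        - ph^-1 *: (p *m t^T + (p *m t^T)^T).
      have -> : (J *m (Th - C) *m J^T)^T = J *m (Th - C)^T *m J^T.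
        by rewrite !trmx_mul trmxK mulmxA.
      rewrite -mulmxDl -mulmxDr.
      have -> : (Th - C)^T + (Th - C) = Th + Th^T - (C + C^T).
        by apply/matrixP => i j; rewrite !mxE; ring.
      rewrite hess mulmxN mulNmx scaleNr -scalemxAr -scalemxAl; congr (- (_ *: _)).
      by rewrite /p /t !trmx_mul !trmxK mulmxDr mulmxDl !mulmxA.
    by rewrite contractZ contractD contractT mulNr mulr_natl mulr2n.
  lra.
have E3 : (S *m th^T) 0 0 = \sum_a (S *m G *m J^T *m Gi) 0 a * t a 0.
  by rewrite {1}S_proj -mulmxA mxE.
rewrite E1 E2 E3 contract_outer.
have -> : \sum_a (ph^-1 *: (dph *m J^T *m Gi) - S *m G *m J^T *m Gi) 0 a * ua a =
   ph^-1 * (\sum_a (p^T *m Gi) 0 a * t a 0) - \sum_a (S *m G *m J^T *m Gi) 0 a * t a 0.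
  rewrite mulr_sumr -sumrB; apply: eq_bigr => a _.
  have -> : p^T = dph *m J^T by rewrite /p trmx_mul trmxK.
  move: (dph *m J^T *m Gi) (S *m G *m J^T *m Gi) => Y Z.
  by rewrite uaE -/t !mxE mulrBl mulrA.
by rewrite -[X in _ + X]opprB subrr.
Qed.

End MinimalAlgebra.

Lemma CkZ_mx (R : realType) (m p q k : nat) (U : set 'rV[R]_m) (s : 'rV[R]_m -> R)
    (A : 'rV[R]_m -> 'M[R]_(p, q)) : open U -> Ck k U s -> Ck k U A ->
  Ck k U (fun x => s x *: A x).
Proof.
move=> oU Cs CA; apply/(Ck_mxP _ _ oU) => i j.
have C := CkM oU Cs ((Ck_mxP _ _ oU).1 CA i j).
by apply: (eq_Ck oU _ C) => x _; rewrite mxE.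
Qed.

Section MinimalMaximum.
Context {R : realType} {k n : nat} {N : manifold R k} {M : manifold R n}.
Variables (g : riemannian_metric M) (K : vector_field M) (f : N -> M) (h : M -> R).
Hypotheses (hK : killing g K) (K0 : nowhere_zero K)
  (ph : forall d, primitive_on g K d (chart_img d) h)
  (cf : continuous f) (sf : forall c d, smooth_on (rep_dom f c d) (rep f c d))
  (imf : forall c d x, rep_dom f c d x -> row_free ('J (rep f c d) x))
  (minf : minimal g f).

Section InChart.
Variables (c : chart_index N) (d : chart_index M).
Let U := rep_dom f c d.
Let F := rep f c d.
Let H := h \o chart_inv d.
Let u := H \o F.

Let oU : open U. Proof. exact: rep_dom_open. Qed.
Let oimg : open (chart_img d). Proof. exact: chart_img_open. Qed.
Let CF l : Ck l U F. Proof. exact: sf. Qed.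
Let CH l : Ck l (chart_img d) H. Proof. exact: (primitive_on_Ck K0 l (ph d)). Qed.
Let UF x : U x -> chart_img d (F x). Proof. exact: rep_img. Qed.
Let Cu l : Ck l U u. Proof. exact: (Ck_comp oU oimg UF (CF l) (CH l)). Qed.

Let CJ l : Ck l U (fun x => 'J F x).
Proof.
apply/(Ck_mxP _ _ oU) => i j.
have C := (Ck_mxP _ _ oU).1 (Ck_partial i (CF l.+1)) 0 j.
by apply: (eq_Ck oU _ C) => x Ux; exact: esym (jacobianE i j oU (CF 1) Ux).
Qed.

Let CG l : Ck l U (fun x => g d (F x)).
Proof. exact: (Ck_comp_mx oU oimg UF (CF l) (@metric_Ck R n M g l d)). Qed.

Let ind x := induced_metric g f c d x.

Let Cind l : Ck l U ind.
Proof. exact: (Ck_mulmx oU (Ck_mulmx oU (CJ l) (CG l)) (Ck_trmx oU (CJ l))). Qed.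

Let pind x : U x -> posdef (ind x).
Proof. by move=> Ux; apply: posdef_pullback; [exact: imf|exact: metric_posdefP (UF Ux)]. Qed.

Let Gi x := invmx (ind x).

Let CGi l : Ck l U Gi.
Proof. by apply: (Ck_invmx oU _ (Cind l)) => x Ux; exact: posdef_unit (pind Ux). Qed.

Let Cchr l i j : Ck l (chart_img d) (fun y => christoffel g d y i j).
Proof.
apply/(Ck_mxP _ _ oimg) => z r.
have ug y : chart_img d y -> g d y \in unitmx.
  by move=> dy; exact: posdef_unit (metric_posdefP g dy).
have Ci s t := (Ck_mxP _ _ oimg).1 (Ck_invmx oimg ug (@metric_Ck R n M g l d)) s t.
have Cp a s t := (Ck_mxP _ _ oimg).1 (Ck_partial a (@metric_Ck R n M g l.+1 d)) s t.
have Cs := Ck_sum (index_enum 'I_n) oimg (fun s => CkM oimg (Ci r s)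
  (CkD oimg (CkD oimg (Cp i j s) (Cp j i s)) (CkN oimg (Cp s i j)))).
have C := CkM oimg (Ck_cst l (chart_img d) (2^-1 : R^o)) Cs.
by apply: (eq_Ck oimg _ C) => y _; rewrite mxE.
Qed.

Let chrf a b x := christoffel_form g d (F x) (row a ('J F x)) (row b ('J F x)).

Let Cchrf l a b : Ck l U (chrf a b).
Proof.
apply: (Ck_sum _ oU) => i; apply: (Ck_sum _ oU) => j.
apply: (CkZ_mx oU); last exact: (Ck_comp_mx oU oimg UF (CF l) (Cchr l i j)).
have Cr r s : Ck l U (fun x => row r ('J F x) 0 s).
  by apply: (eq_Ck oU _ ((Ck_mxP _ _ oU).1 (CJ l) r s)) => x _; rewrite [RHS]mxE.
exact: (CkM oU (Cr a i) (Cr b j)).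
Qed.

Let S x : 'rV[R]_n :=
  \sum_a \sum_b Gi x a b *: (partial a (partial b F) x + chrf a b x).

Let CS l : Ck l U S.
Proof.
apply: (Ck_sum _ oU) => a; apply: (Ck_sum _ oU) => b; apply: (CkZ_mx oU).
  exact: ((Ck_mxP _ _ oU).1 (CGi l)).
exact: (CkD oU (Ck_partial a (Ck_partial b (CF l.+2))) (Cchrf l a b)).
Qed.

(** The first term is the tangential gradient of log |K|^2 in the induced metric, the second minus
    the tangential coefficients of [S]. *)
Let drift x : 'rV[R]_k :=
  (speed2 g K d (F x))^-1 *: (dspeed2 g K d (F x) *m ('J F x)^T *m Gi x)
  - S x *m g d (F x) *m ('J F x)^T *m Gi x.

Let Cdrift l : Ck l U drift.
Proof.
have s0 y : chart_img d y -> speed2 g K d y != 0.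
  by move=> dy; rewrite gt_eqF// (speed2_gt0 g K0 dy).
have Csp := Ck_comp oU oimg UF (CF l) (CkV oimg s0 (@speed2_Ck R n M g K l d)).
have Cds : Ck l (chart_img d) (dspeed2 g K d).
  apply/(Ck_mxP _ _ oimg) => i j.
  have C := Ck_partial j (@speed2_Ck R n M g K l.+1 d).
  by apply: (eq_Ck oimg _ C) => y _; rewrite mxE.
have CdsF := Ck_comp_mx oU oimg UF (CF l) Cds.
have CJT := Ck_trmx oU (CJ l).
have C1 := CkZ_mx oU Csp (Ck_mulmx oU (Ck_mulmx oU CdsF CJT) (CGi l)).
have C2 := Ck_mulmx oU (Ck_mulmx oU (Ck_mulmx oU (CS l) (CG l)) CJT) (CGi l).
have C3 := CkD oU C1 (CkZ_mx oU (Ck_cst l U (-1 : R^o)) C2).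
by apply: (eq_Ck oU _ C3) => x _; rewrite /drift /= scaleN1r.
Qed.

Let Cth l := @theta_Ck R n M g K K0 l d.

Let partial_u x a : U x -> partial a u x = ('J F x *m (theta g K d (F x))^T) a 0.
Proof. exact: (potential_gradient K0 ph cf sf). Qed.

Let partial2_u x a b : U x -> partial a (partial b u) x =
  (partial a (partial b F) x *m (theta g K d (F x))^T) 0 0 +
  ('J F x *m 'J (theta g K d) (F x) *m ('J F x)^T) a b.
Proof.
move=> Ux; have nU := open_nbhs_nbhs (conj oU Ux).
have CthF l : Ck l U (theta g K d \o F) := Ck_comp_mx oU oimg UF (CF l) (Cth l).
have E0 : partial a (partial b u) x =
    partial a (fun y => (partial b F y *m ((theta g K d \o F) y)^T) 0 0) x.
  apply: near_eq_derive; apply: filterS nU => y Uy.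
  apply: etrans (partial_u b Uy) _.
  have E := row_jacobian b oU (CF 1) Uy.
  have rowE (A : 'M[R]_(k, n)) (v : 'cV[R]_n) : (A *m v) b 0 = (row b A *m v) 0 0.
    by rewrite -row_mul [RHS]mxE.
  exact: etrans (rowE _ _) (congr1 (fun r : 'rV[R]_n => (r *m (theta g K d (F y))^T) 0 0) E).
have Cprod := Ck_mulmx oU (Ck_partial b (CF 2)) (Ck_trmx oU (CthF 1)).
have E1 := esym (partial_mxE a 0 0 Cprod Ux).
have E2 := partial_mulmx a oU (Ck_partial b (CF 2)) (Ck_trmx oU (CthF 1)) Ux.
have E3 := partial_trmx a oU (CthF 1) Ux.
have rJ r : row r ('J F x) = partial r F x := row_jacobian r oU (CF 1) Ux.
have E4 : partial a (theta g K d \o F) x = row a ('J F x) *m 'J (theta g K d) (F x).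
  apply: etrans (partial_comp_mx a oU oimg (CF 1) (Cth 1) Ux (UF Ux)) _.
  rewrite mulmx_sum_row; apply: eq_bigr => j _.
  have E5 := row_jacobian j oimg (Cth 1) (UF Ux).
  exact: f_equal2 (congr1 (fun r : 'rV[R]_n => r 0 j) (esym (rJ a))) (esym E5).
have addE (A B : 'M[R]_1) : (A + B) 0 0 = A 0 0 + B 0 0 by rewrite mxE.
apply: etrans E0 (etrans E1 (etrans (congr1 (fun A : 'M[R]_1 => A 0 0) E2) _)).
have E6 : partial b F x *m partial a (fun y => ((theta g K d \o F) y)^T) x =
    row b ('J F x) *m (row a ('J F x) *m 'J (theta g K d) (F x))^T :=
  f_equal2 (fun (r : 'rV[R]_n) (s : 'cV[R]_n) => r *m s) (esym (rJ b)) (etrans E3 (congr1 trmx E4)).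
have E7 := quad_entry ('J F x) ('J (theta g K d) (F x)) b a.
have E8 := etrans (congr1 (fun A : 'M[R]_1 => A 0 0) E6) (esym E7).
exact: etrans (addE _ _) (f_equal2 +%R erefl E8).
Qed.

Lemma elliptic_potential x : U x -> elliptic Gi drift u x = 0.
Proof.
move=> Ux; have dx := UF Ux.
have pi := posdef_inv (pind Ux).
have GmE a b : (chrf a b x *m (theta g K d (F x))^T) 0 0 = ('J F x *m
    \matrix_(i, j) (christoffel g d (F x) i j *m (theta g K d (F x))^T) 0 0 *m ('J F x)^T) a b.
  rewrite quad_entry /chrf /christoffel_form.
  move: ('J F x) (theta g K d (F x))^T (christoffel g d (F x)) => A v Gam.
  have -> : ((\sum_i \sum_j (row a A 0 i * row b A 0 j) *: Gam i j) *m v) 0 0 =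
      \sum_i \sum_j (A a i * A b j) * (Gam i j *m v) 0 0.
    rewrite mulmx_suml summxE; apply: eq_bigr => i _.
    rewrite mulmx_suml summxE; apply: eq_bigr => j _.
    by rewrite -scalemxAl mxE; congr (_ * _); rewrite !mxE.
  rewrite exchange_big /= [RHS]mxE; apply: eq_bigr => j _.
  rewrite [X in _ = _ * X]mxE [X in _ = _ * X]mxE [row b A 0 j]mxE mulr_sumr.
  apply: eq_bigr => i _; rewrite [row a A 0 i]mxE [X in _ = _ * (_ * X)]mxE.
  by rewrite [RHS]mulrCA mulrA.
have M0 := minf Ux; rewrite /mean_curvature /second_fundamental_form /normal_proj in M0.
exact (minimal_algebra pi.1 GmE M0 (theta_hessian K0 dx hK)
  (fun a b => partial2_u a b Ux) (fun a => partial_u a Ux)).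
Qed.

Lemma local_max_chart (x0 : 'rV[R]_k) : U x0 -> (forall x, U x -> u x <= u x0) ->
  \forall x \near x0, u x = u x0.
Proof.
move=> Ux0 umax.
apply: (@strong_maximum_principle R k Gi drift U u oU (Cu 2) _ _ _ _ x0 Ux0 umax).
- by move=> x Ux; exact: Ck_continuous (CGi 0) Ux.
- by move=> x Ux; exact: Ck_continuous (Cdrift 0) Ux.
- by move=> x Ux; exact: posdef_inv (pind Ux).
- by move=> x Ux; rewrite (elliptic_potential Ux).
Qed.

End InChart.

Lemma local_max (q0 : N) : (forall q, h (f q) <= h (f q0)) ->
  \forall q \near q0, h (f q) = h (f q0).
Proof.
move=> qmax; have [c cq] := chart_cover q0; have [d dq] := chart_cover (f q0).
have Ux0 := rep_dom_chart cq dq.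
have E x : rep_dom f c d x -> (h \o chart_inv d \o rep f c d) x = h (f (chart_inv c x)).
  by move=> Ux; rewrite /= repK.
have E0 : (h \o chart_inv d \o rep f c d) (chart c q0) = h (f q0) by rewrite E// chartK.
have umax x : rep_dom f c d x -> (h \o chart_inv d \o rep f c d) x <=
    (h \o chart_inv d \o rep f c d) (chart c q0).
  by move=> Ux; rewrite E0 (E x Ux).
have nm := local_max_chart Ux0 umax.
have nU := open_nbhs_nbhs (conj (@rep_dom_open _ _ _ _ _ f c d cf) Ux0).
apply: filterS (chart_dom_nbhs cq (filterI nm nU)) => q [cq' [Eq Uq]].
by move: Eq; rewrite E// E0 chartK.
Qed.

Lemma potential_const : [set: N] !=set0 -> connected [set: N] -> compact [set: N] ->
  forall q q', h (f q) = h (f q').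
Proof.
move=> N0 cN kN q q'.
have ch := potential_continuous K0 ph.
have cu : continuous (h \o f) by move=> x; exact: continuous_comp (cf (x:=x)) (ch _).
have [q0 _ qmax] := compact_EVT_max N0 kN (continuous_subspaceT cu).
have {}qmax r : h (f r) <= h (f q0) by apply: qmax; rewrite inE.
pose A := [set r | h (f r) = h (f q0)].
suff AT : A = setT.
  have Aq r : A r by rewrite AT.
  by rewrite (Aq q) (Aq q').
apply: cN; first by exists q0.
  exists A; last by rewrite setTI.
  apply: open_nearP => r Ar; have := @local_max r.
  by rewrite Ar; apply.
exists A; last by rewrite setTI.
have -> : A = (h \o f) @^-1` [set h (f q0)] by [].
apply: closed_comp => [x _|]; first exact: cu.
exact: closed_eq.
Qed.

End MinimalMaximum.

(** * Level sets of the potential as leaves *)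

Section Subtype.
Context {T : topologicalType} (A : set T).

Lemma val_continuous : continuous (fun q : A => val q : T).
Proof. exact: initial_continuous. Qed.

Lemma nbhs_subtype (q : A) (O : set A) : nbhs q O ->
  exists2 V : set T, open V /\ V (val q) & (fun q' : A => val q') @^-1` V `<=` O.
Proof. by case=> _ /= [[V oV <-] Vq VO]; exists V. Qed.

Lemma continuous_to_subtype (S : topologicalType) (F : S -> A) x :
  {for x, continuous (fun y => val (F y) : T)} -> {for x, continuous F}.
Proof.
move=> cF O /nbhs_subtype[V [oV Vx] VO].
have nV : nbhs x ((fun y => val (F y)) @^-1` V) by apply: cF; exact: open_nbhs_nbhs.
by apply: (@filterS _ (nbhs x) _ _ _ _ nV) => y Vy; exact: VO.
Qed.

Lemma subtype_hausdorff : hausdorff_space T -> hausdorff_space A.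
Proof.
move=> hT p q pq; apply: val_inj; apply: hT => B C nB nC.
have [r [Br Cr]] := pq _ _ (val_continuous nB) (val_continuous nC).
by exists (val r).
Qed.

Lemma subtype_second_countable : @second_countable T -> @second_countable A.
Proof.
move=> [B cB [oB bB]]; exists [set (fun q : A => val q) @^-1` U | U in B].
  exact: card_le_trans (card_image_le _ _) cB.
split=> [_ [U BU <-]|q O /nbhs_subtype[V [oV Vq] VO]].
  by apply: open_comp => [q _|]; [exact: val_continuous|exact: oB].
have [U [BU Uq] UV] := bB (val q) V (open_nbhs_nbhs (conj oV Vq)).
exists ((fun q : A => val q) @^-1` U); first by split=> //; exists U.
by move=> r /= Ur; apply: VO; exact: UV.
Qed.

Lemma subtype_connected : connected A -> connected [set: A].
Proof.
move=> cA B [q Bq] [C oC BC] [D cD BD].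
have ex (O : set A) : open O -> exists2 V : set T, open V & O = (fun q : A => val q) @^-1` V.
  by move=> [V oV <-]; exists V.
have [V oV CV] := ex C oC; have [V' oV' DV'] := ex (~` D) (closed_openC cD).
have BVE r : B r <-> V (val r) by rewrite BC CV setTI.
have BV'E r : B r <-> ~ V' (val r).
  have E : (~` D) r <-> V' (val r) by rewrite DV'.
  rewrite BD setTI; split=> [Dr /E//|nV]; apply: contrapT => nD; apply: nV; exact/E.
have mk (r : T) : A r -> exists r' : A, val r' = r.
  by move=> Ar; exists (exist _ r (mem_set Ar)).
have AV : A `&` V = A.
  apply: cA; first by exists (val q); split; [exact: set_valP|exact/BVE].
    by exists V.
  exists (~` V'); first exact: open_closedC.
  apply/seteqP; split=> r [Ar rV]; split=> //; have [r' E] := mk r Ar; subst r.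
    by apply/BV'E/BVE.
  by apply/BVE/BV'E.
apply/seteqP; split=> // r _; apply/BVE.
have : (A `&` V) (val r) by rewrite AV; exact: set_valP.
by case.
Qed.

End Subtype.

(* A box in a chart on which a level set is the graph of one coordinate over the
   others. *)
Record slice (R : realType) (m : nat) (M : manifold R m.+1) := Slice {
  slice_chart : chart_index M ;
  slice_coord : 'I_m.+1 ;
  slice_radius : R ;
  slice_height : R ;
  slice_graph : 'rV[R]_m -> R
}.

(** * The manifold structure on a component of a level set *)

Section Level.
Context {R : realType} {m : nat} {M : manifold R m.+1}.
Variables (h : M -> R).
Hypotheses (sh : forall d, smooth_on (chart_img d) (h \o chart_inv d))
  (reg : forall d x, chart_img d x -> exists i, partial i (h \o chart_inv d) x != 0).

Definition slice_at (z : M) (D : slice M) :=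
  let d := slice_chart D in let i := slice_coord D in
  let psi := slice_graph D in let x := chart d z in
  [/\ chart_dom d z, 0 < slice_radius D, 0 < slice_height D,
      smooth_on (ball (del i x) (slice_radius D)) psi &
      forall y, ball (del i x) (slice_radius D) y ->
        [/\ `|x 0 i - psi y| < slice_height D,
            forall t, `|x 0 i - t| < slice_height D -> chart_img d (ins i t y) &
            forall t, `|x 0 i - t| < slice_height D ->
              h (chart_inv d (ins i t y)) = h z <-> t = psi y]].

Lemma slice_exists z : exists D, slice_at z D.
Proof.
have [d dz] := chart_cover z; have dx := chart_img_chart dz.
have [i hi] := reg dx.
have [r [s [psi [r0 s0 spsi P]]]] := implicit_function (@chart_img_open R m.+1 M d) (@sh d) dx hi.
exists (Slice d i r s psi); split=> // y By; have [h1 h2 h3] := P y By; split=> // t ts.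
by rewrite -(h3 t ts) /= chartK.
Qed.

Variable p0 : M.

Definition level_component : set M := connected_component [set q | h q = h p0] p0.

Local Notation L := level_component.

Lemma level_component_base : L p0.
Proof. exact: connected_component_refl. Qed.

Lemma level_componentE q : L q -> h q = h p0.
Proof. by move/connected_component_sub. Qed.

Lemma level_component_connected : connected L.
Proof. exact: component_connected. Qed.

Lemma level_component_max (A : set M) q : connected A -> A `<=` [set q | h q = h p0] ->
  A q -> L q -> A `<=` L.
Proof.
move=> cA Ah Aq Lq; rewrite /L (same_connected_component Lq).
exact: connected_component_max.
Qed.

Let base : L := exist _ p0 (mem_set level_component_base).

(** An inverse chart must be a total function into L; the default [base] is taken only at points
    outside L. *)
Let to_L (q : M) : L :=
  if pselect (L q) is left Lq then exist _ q (mem_set Lq) else base.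

Let to_LK q : L q -> val (to_L q) = q.
Proof. by move=> Lq; rewrite /to_L; case: pselect. Qed.

Let sl (z : L) : slice M := sval (cid (slice_exists (val z))).
Let slP (z : L) : slice_at (val z) (sl z). Proof. exact: svalP. Qed.

Let d z := slice_chart (sl z).
Let i z := slice_coord (sl z).
Let r z := slice_radius (sl z).
Let s z := slice_height (sl z).
Let psi z := slice_graph (sl z).
Let x z := chart (d z) (val z).
Let B z := ball (del (i z) (x z)) (r z).
Let gam z y := ins (i z) (psi z y) y.

Let oB z : open (B z). Proof. exact: ball_open. Qed.

Let dz z : chart_dom (d z) (val z). Proof. by have [] := slP z. Qed.
Let r0 z : 0 < r z. Proof. by have [] := slP z. Qed.
Let s0 z : 0 < s z. Proof. by have [] := slP z. Qed.
Let Cpsi k z : Ck k (B z) (psi z). Proof. by have [_ _ _] := slP z. Qed.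
Let Cgam k z : Ck k (B z) (gam z). Proof. exact: (Ck_ins (i z) (@oB z) (@Cpsi k z)). Qed.

Let psi_s z y : B z y -> `|x z 0 (i z) - psi z y| < s z.
Proof. by have [_ _ _ _ P] := slP z; move=> /P[]. Qed.

Let gam_img z y : B z y -> chart_img (d z) (gam z y).
Proof. by have [_ _ _ _ P] := slP z; move=> By; have [h1 h2 _] := P y By; exact: h2. Qed.

Let psi_unique z y t : B z y -> `|x z 0 (i z) - t| < s z ->
  h (chart_inv (d z) (ins (i z) t y)) = h p0 <-> t = psi z y.
Proof.
have [_ _ _ _ P] := slP z; move=> By ts; have [_ _ h3] := P y By.
by rewrite -(h3 t ts) (level_componentE (set_valP z)).
Qed.

Let gam_level z y : B z y -> h (chart_inv (d z) (gam z y)) = h p0.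
Proof. by move=> By; apply/(psi_unique By (psi_s By)). Qed.

Let gam_center z : gam z (del (i z) (x z)) = x z.
Proof.
have Bc : B z (del (i z) (x z)) by exact: ballxx.
rewrite /gam -[RHS](delK (i z)); congr (ins _ _ _); apply/esym/psi_unique => //.
  by rewrite subrr normr0.
by rewrite delK chartK// (level_componentE (set_valP z)).
Qed.

Let gam_continuous z y : B z y ->
  {for y, continuous (fun y => chart_inv (d z) (gam z y))}.
Proof.
move=> By; have c1 := Ck_continuous (@Cgam 0 z) By.
exact: continuous_comp c1 (chart_inv_continuous (gam_img By)).
Qed.

(** The graph over the segment from the centre to y is a connected part of the level set that
    contains z, so it stays in the component. *)
Let gam_L z y : B z y -> L (chart_inv (d z) (gam z y)).
Proof.
move=> By; set y0 := del (i z) (x z).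
pose l (t : R) := y0 + t *: (y - y0).
have Bl t : `[0, 1]%classic t -> B z (l t).
  by rewrite /= in_itv /= => t01; apply: ball_convex => //; exact: ballxx.
pose F t := chart_inv (d z) (gam z (l t)).
have cF : {within `[0, 1], continuous F}.
  apply: continuous_in_subspaceT => t; rewrite inE => t01.
  have cl : {for t, continuous l}.
    by apply: continuousD; [exact: cst_continuous|exact: scalel_continuous].
  exact: (continuous_comp cl (gam_continuous (Bl t t01))).
have cA : connected (F @` `[0, 1]).
  by apply: connected_continuous_connected cF; exact: connected_itvcc.
have I0 : `[0, 1]%classic (0 : R) by rewrite /= in_itv /= lexx ler01.
have I1 : `[0, 1]%classic (1 : R) by rewrite /= in_itv /= lexx ler01.
apply: (level_component_max cA _ _ (set_valP z)).
- by move=> _ [t t01 <-]; exact: gam_level (Bl t t01).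
- by exists 0 => //; rewrite /F /l scale0r addr0 gam_center chartK.
- by exists 1 => //; rewrite /F /l scale1r addrC subrK.
Qed.

(** Bounding the height in the solved coordinate as well keeps out further sheets of L in the same
    chart, which would project onto the same ball. *)
Definition leaf_dom (z : L) : set L := [set q : L |
  [/\ chart_dom (d z) (val q), B z (del (i z) (chart (d z) (val q))) &
      `|x z 0 (i z) - chart (d z) (val q) 0 (i z)| < s z]].

Definition leaf_chart (z : L) (q : L) : 'rV[R]_m := del (i z) (chart (d z) (val q)).

Definition leaf_inv (z : L) (y : 'rV[R]_m) : L := to_L (chart_inv (d z) (gam z y)).

Let leaf_invE z y : B z y -> val (leaf_inv z y) = chart_inv (d z) (gam z y).
Proof. by move=> By; rewrite /leaf_inv to_LK//; exact: gam_L. Qed.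

Let leaf_chart_inv z y : B z y -> leaf_dom z (leaf_inv z y) /\ leaf_chart z (leaf_inv z y) = y.
Proof.
move=> By; have E := leaf_invE By; have gI := gam_img By.
rewrite /leaf_dom /leaf_chart /= E chart_invK// /gam insK ins_at; split=> //.
by split=> //; [exact: chart_inv_dom|exact: psi_s].
Qed.

Let leaf_imgE z : leaf_chart z @` leaf_dom z = B z.
Proof.
apply/seteqP; split=> [_ [q [_ Bq _] <-] //|y By].
by have [Dy Ey] := leaf_chart_inv By; exists (leaf_inv z y).
Qed.

Let leaf_dom_open z : open (leaf_dom z).
Proof.
have -> : leaf_dom z = (fun q : L => val q) @^-1`
    [set q | [/\ chart_dom (d z) q, B z (del (i z) (chart (d z) q)) &
      `|x z 0 (i z) - chart (d z) q 0 (i z)| < s z]] by [].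
apply: open_comp => [q _|]; first exact: val_continuous.
apply: open_nearP => q [dq Bq sq].
have oT : open [set: 'rV[R]_m.+1] by exact: openT.
have cd : {for chart (d z) q, continuous (del (i z) : 'rV[R]_m.+1 -> 'rV[R]_m)}.
  exact: Ck_continuous (Ck_del 0 (i z) oT) I.
have n1 : nbhs (chart (d z) q) (del (i z) @^-1` B z) by apply: cd; exact: open_nbhs_nbhs.
have cn : {for chart (d z) q, continuous (fun y : 'rV[R]_m.+1 => `|x z 0 (i z) - y 0 (i z)|)}.
  have c1 : {for chart (d z) q, continuous (fun y : 'rV[R]_m.+1 => x z 0 (i z) - y 0 (i z))}.
    by apply: continuousB; [exact: cst_continuous|exact: coord_continuous].
  exact: (continuous_comp c1 (@norm_continuous _ R _)).
have n2 := near_lt_at cn sq.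
by apply: filterS (chart_dom_nbhs dq (filterI n1 n2)) => q' [dq' [Bq' sq']].
Qed.

(** Uniqueness in the box: a point of L there has the height that [psi] prescribes, so deleting that
    coordinate loses nothing. *)
Let leaf_chartK z q : leaf_dom z q -> leaf_inv z (leaf_chart z q) = q.
Proof.
move=> [dq Bq sq]; apply: val_inj; rewrite [LHS](leaf_invE Bq) /gam.
have <- : chart (d z) (val q) 0 (i z) = psi z (leaf_chart z q).
  apply/psi_unique => //; rewrite /leaf_chart delK chartK//.
  exact: level_componentE (set_valP q).
by rewrite /leaf_chart delK chartK.
Qed.

Let leaf_chart_continuous z q : leaf_dom z q -> {for q, continuous (leaf_chart z)}.
Proof.
move=> [dq _ _]; have c1 := @val_continuous M L q.
have c2 := continuous_comp c1 (chart_continuous dq).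
have oT : open [set: 'rV[R]_m.+1] by exact: openT.
exact: (continuous_comp c2 (Ck_continuous (Ck_del 0 (i z) oT) I)).
Qed.

Let leaf_inv_continuous z y : B z y -> {for y, continuous (leaf_inv z)}.
Proof.
move=> By; apply: continuous_to_subtype; apply: eq_continuous_at (gam_continuous By).
by apply: filterS (open_nbhs_nbhs (conj (@oB z) By)) => y' By'; rewrite leaf_invE.
Qed.

(** It is the graph map of one slice, then a change of charts of M, then the deletion of a
    coordinate. *)
Let leaf_transition z w : smooth_on (leaf_chart z @` (leaf_dom z `&` leaf_dom w))
  (leaf_chart w \o leaf_inv z).
Proof.
move=> k; set V := _ @` _.
have VE y : V y <-> B z y /\ leaf_dom w (leaf_inv z y).
  split=> [[q [Dq Dq'] <-]|[By Dy]].
    by rewrite leaf_chartK//; split=> //; case: Dq.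
  by have [D1 E1] := leaf_chart_inv By; exists (leaf_inv z y).
have oV : open V.
  apply: open_nearP => y /VE[By Dy].
  have n1 : nbhs y (B z) by exact: open_nbhs_nbhs.
  have n2 : nbhs y (leaf_inv z @^-1` leaf_dom w).
    by apply: (leaf_inv_continuous By); apply: open_nbhs_nbhs; split=> //; exact: leaf_dom_open.
  by apply: filterS (filterI n1 n2) => y' [? ?]; apply/VE.
have VB y : V y -> B z y by move=> /VE[].
pose T := @rep R m.+1 m.+1 M M idfun (d z) (d w).
have VT y : V y -> rep_dom idfun (d z) (d w) (gam z y).
  move=> /VE[By [dy _ _]]; apply/rep_domP; split; first exact: gam_img.
  by move: dy; rewrite leaf_invE.
have C1 := Ck_comp_mx oV (@transition_open R m.+1 M (d z) (d w)) VT
  (Ck_subset VB (@Cgam k z)) (@transition_Ck R m.+1 M k (d z) (d w)).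
have oT : open [set: 'rV[R]_m.+1] by exact: openT.
have C2 := Ck_comp_mx oV oT (fun _ _ => I) C1 (Ck_del k (i w) oT).
apply: (eq_Ck oV _ C2) => y /VB By.
by rewrite /leaf_chart /= (leaf_invE By).
Qed.

Let leaf_cover q : exists z, leaf_dom z q.
Proof. by exists q; split=> //; [exact: ballxx|rewrite subrr normr0]. Qed.

Let leaf_img_open z : open (leaf_chart z @` leaf_dom z).
Proof. by rewrite leaf_imgE. Qed.

Let leaf_inv_continuous' z y : (leaf_chart z @` leaf_dom z) y -> {for y, continuous (leaf_inv z)}.
Proof. by rewrite leaf_imgE; exact: leaf_inv_continuous. Qed.

(** L carries the subspace topology, and its charts are indexed by its own points, one slice for
    each. Each slice meets L in exactly one graph, which is why the subspace topology is the right
    one. *)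
Definition level_manifold : manifold R m :=
  @Manifold R m L L leaf_dom leaf_chart leaf_inv
    (@subtype_hausdorff M L (@manifold_hausdorff R m.+1 M))
    (@subtype_second_countable M L (@manifold_second_countable R m.+1 M))
    leaf_cover leaf_dom_open leaf_img_open leaf_chartK leaf_chart_continuous
    leaf_inv_continuous' leaf_transition.

Definition level_inclusion (q : level_manifold) : M := val (q : L).

Lemma level_inclusion_range : range level_inclusion = L.
Proof.
apply/seteqP; split=> [_ [q _ <-]|q Lq]; first exact: set_valP.
by exists (exist _ q (mem_set Lq)).
Qed.

Lemma level_inclusion_inj : injective level_inclusion.
Proof. exact: val_inj. Qed.

(** In charts the inclusion is a graph map followed by a change of charts. It has a smooth left
    inverse, and the chain rule turns that into a right inverse of the Jacobian. *)
Lemma level_inclusion_submanifold : submanifold level_inclusion.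
Proof.
have ci : continuous level_inclusion by exact: val_continuous.
have key (z : chart_index level_manifold) e y : rep_dom level_inclusion z e y ->
    B z y /\ rep_dom idfun (d z) e (gam z y).
  move=> /rep_domP[[q [dq Bq sq] <-]]; rewrite /level_inclusion [chart_inv _ _]leaf_chartK//.
  move=> eq; have By : B z (leaf_chart z q) by [].
  split=> //; apply/rep_domP; split; first exact: gam_img.
  by rewrite /= -(leaf_invE By) leaf_chartK.
have oD (z : chart_index level_manifold) e : open (rep_dom level_inclusion z e).
  exact: rep_dom_open.
have CR k (z : chart_index level_manifold) e :
    Ck k (rep_dom level_inclusion z e) (rep level_inclusion z e).
  have VB : rep_dom level_inclusion z e `<=` B z by move=> y /key[].
  have VT y : rep_dom level_inclusion z e y -> rep_dom idfun (d z) e (gam z y) by move=> /key[].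
  have C1 := Ck_comp_mx (@oD z e) (@transition_open R m.+1 M (d z) e) VT
    (Ck_subset VB (@Cgam k z)) (@transition_Ck R m.+1 M k (d z) e).
  apply: (eq_Ck (@oD z e) _ C1) => y /VB By.
  by rewrite /rep /level_inclusion /= [val _](leaf_invE By).
split.
- by exists base.
- exact: subtype_connected level_component_connected.
split; first by split=> // z e k; exact: CR.
move=> z e y Dy; have oT : open [set: 'rV[R]_m.+1] by exact: openT.
have Rimg w : rep_dom level_inclusion z e w -> chart_img e (rep level_inclusion z e w).
  exact: rep_img.
have RT w : rep_dom level_inclusion z e w ->
    rep_dom idfun e (d z) (rep level_inclusion z e w) /\
    (rep idfun e (d z) (rep level_inclusion z e w)) = gam z w.
  move=> Dw; have [Bw Tw] := key z e w Dw.
  have -> : rep level_inclusion z e w = rep idfun (d z) e (gam z w).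
    by rewrite /rep /level_inclusion /= [val _](leaf_invE Bw).
  by split; [exact: transition_domC|exact: transitionK].
(* The left inverse: return to the chart of the slice and delete the solved coordinate. *)
pose P := (del (i z) : 'rV[R]_m.+1 -> 'rV[R]_m) \o rep idfun e (d z).
have CP : Ck 1 (rep_dom idfun e (d z)) P.
  exact: (Ck_comp_mx (@transition_open R m.+1 M e (d z)) oT (fun _ _ => I)
    (@transition_Ck R m.+1 M 1 e (d z)) (Ck_del 1 (i z) oT)).
have E w : rep_dom level_inclusion z e w -> (P \o rep level_inclusion z e) w = w.
  by move=> Dw; have [_ Ew] := RT w Dw; rewrite /P /= Ew /gam insK.
have J1 : 'J (P \o rep level_inclusion z e) y = 1%:M.
  have C1 : Ck 1 (rep_dom level_inclusion z e) (P \o rep level_inclusion z e).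
    apply: (eq_Ck (@oD z e) _ (Ck_id 1 (@oD z e))) => w Dw.
    by rewrite E.
  apply/matrixP => a b; apply: etrans (jacobianE a b (@oD z e) C1 Dy) _.
  have E1 : partial a (P \o rep level_inclusion z e) y = partial a (fun w : 'rV[R]_m => w) y.
    apply: near_eq_derive; apply: filterS (open_nbhs_nbhs (conj (@oD z e) Dy)) => w.
    exact: E.
  by rewrite E1 /partial derive_id !mxE eqxx eq_sym.
have [RTy _] := RT y Dy.
have J2 := jacobian_comp (@oD z e) (@transition_open R m.+1 M e (d z)) (CR 1 z e) CP Dy RTy.
by apply/row_freeP; exists ('J P (rep level_inclusion z e y)); rewrite -J2.
Qed.

End Level.

Section Leaf.
Context {R : realType} {m : nat} {M : manifold R m.+1}.
Variables (g : riemannian_metric M) (K : vector_field M) (h : M -> R).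
Hypotheses (K0 : nowhere_zero K) (ph : forall d, primitive_on g K d (chart_img d) h).

(** If theta vanished at x, then K would be in the kernel of w, against w(K) = |K|^2 > 0. *)
Lemma potential_regular d x : chart_img d x -> exists i, partial i (h \o chart_inv d) x != 0.
Proof.
move=> dx; have s0 := speed2_gt0 g K0 dx.
have t0 : theta g K d x != 0.
  apply/negP => /eqP E; have := theta_kernel g K0 (K d x) dx.
  rewrite E trmx0 mulmx0 eqxx => /esym/eqP E2.
  by move: s0; rewrite /speed2 -mulmxA -(flat_tr g K dx) E2 mxE ltxx.
have [i hi] := rV0Pn _ t0; exists i.
by have E := primitive_on_partial i (ph d) dx; rewrite E.
Qed.

Lemma level_range (N : manifold R m) (f : N -> M) : integral_manifold g K f ->
  forall p, range f p -> range f `<=` level_component h p.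
Proof.
move=> [[_ cN [[cf sf] _]] _ tan] _ [q _ <-].
have Hc : forall q q', h (f q) = h (f q').
  apply: (potential_const_tangent K0 ph cf sf cN) => c d x Ux.
  by rewrite (flat_tr g K (rep_img Ux)) mulmxA; exact: tan.
apply: (@level_component_max R m M h (f q) (range f) (f q)).
- apply: connected_continuous_connected => //; exact: continuous_subspaceT.
- by move=> _ [q' _ <-]; exact: Hc.
- by exists q.
- exact: level_component_base.
Qed.

Lemma constant_tangent k (N : manifold R k) (f : N -> M) y0 : continuous f ->
  (forall (c : chart_index N) d, smooth_on (rep_dom f c d) (rep f c d)) ->
  (forall q, h (f q) = y0) ->
  forall (c : chart_index N) d x, rep_dom f c d x ->
    'J (rep f c d) x *m g d (rep f c d x) *m (K d (rep f c d x))^T = 0.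
Proof.
move=> cf sf hf c d x Ux; have oU : open (rep_dom f c d) by exact: rep_dom_open.
have dx := rep_img Ux.
rewrite -mulmxA -(flat_tr g K dx); apply/eqP; rewrite -(theta_kernel g K0 _ dx); apply/eqP.
apply/matrixP => a b; rewrite ord1 {b}.
apply: etrans (esym (potential_gradient K0 ph cf sf a Ux)) _.
have E : partial a ((h \o chart_inv d) \o rep f c d) x = partial a (fun=> y0) x.
  apply: near_eq_derive; apply: filterS (open_nbhs_nbhs (conj oU Ux)) => y Uy.
  by rewrite /= (repK Uy) hf.
by rewrite E /partial derive_cst mxE.
Qed.

(** Maximality: an integral manifold that contains the component contains p, and being connected
    with h constant on it, it cannot leave the component of p. *)
Lemma level_component_leaf p : leaf g K (level_component h p).
Proof.
have sh d : smooth_on (chart_img d) (h \o chart_inv d).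
  by move=> j; exact: primitive_on_Ck (ph d).
have [nI cI [[ci si] ri]] := level_inclusion_submanifold sh potential_regular p.
have hI (q : level_manifold sh potential_regular p) : h (level_inclusion q) = h p.
  by apply: level_componentE; exact: set_valP.
split=> [|N f If sub].
  exists (level_manifold sh potential_regular p), (@level_inclusion R m M h sh potential_regular p).
  split; last exact: level_inclusion_range.
  split; [by split|exact: level_inclusion_inj|].
  exact: (constant_tangent ci si (fun q => hI q)).
have rp : range f p by apply: sub; exact: level_component_base.
exact: level_range If _ rp.
Qed.

End Leaf.

Theorem theorem17 (R : realType) (n : nat) (M : manifold R n)
    (g : riemannian_metric M) (K : vector_field M)
    (hcomplete : complete_metric g)
    (hsimply : simply_connected M)
    (hkilling : killing g K)
    (hirrotational : irrotational g K)
    (hnonzero : nowhere_zero K)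
    (k : nat) (hk : (0 < k)%N) (N : manifold R k) (f : N -> M)
    (hsubmanifold : submanifold f)
    (hcompact : compact [set: N])
    (hminimal : minimal g f) :
  exists L : set M, leaf g K L /\ range f `<=` L.
Proof.
move: hsubmanifold => [nN cN [[cf sf] imf]]; have [q0 _] := nN.
case: n => [|m] in M g K hcomplete hsimply hkilling hirrotational hnonzero f cf sf imf hminimal *.
  (* In dimension zero every vector is zero, so a nowhere-zero K cannot exist at the point
     [f q0]. *)
  have [d dq] := chart_cover (f q0).
  by case/negP: (hnonzero d _ (chart_img_chart dq)); rewrite thinmx0.
have [h ph] := potential_exists hkilling hirrotational hnonzero hsimply.
have hf := potential_const hkilling hnonzero ph cf sf imf hminimal nN cN hcompact.
exists (level_component h (f q0)); split; first exact: level_component_leaf hnonzero ph _.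
apply: (@level_component_max R m M h (f q0) (range f) (f q0)).
- apply: connected_continuous_connected => //; exact: continuous_subspaceT.
- by move=> _ [q _ <-]; exact: hf.
- by exists q0.
- exact: level_component_base.
Qed.
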